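(* Let $(L,\omega,\upsilon)$ be a generalized indefinite string with Weyl--Titchmarsh function $m$ and spectral measure $\rho$. If $m$ is not rational and such that the moments of the spectral measure $\rho$ exist up to order $2K$ for some $K\in\mathbb{N}_0$, then, with $N\in\mathbb{N}$, $\kappa:\{1,\dots,N\}\to\{0,\dots,K\}$ and the Hankel determinants $\Delta_{j,k}$ as described in the context, the generalized indefinite string $(L,\omega,\upsilon)$ has the form $$\omega|_{[0,x_N)}=\omega_0\delta_0+\sum_{n=1}^{N-1}\omega_n\delta_{x_n},\qquad \upsilon|_{[0,x_N)}=\upsilon_0\delta_0+\sum_{n=1}^{N-1}\upsilon_n\delta_{x_n},$$ where the increasing points $x_1,\ldots,x_N$ in $(0,L)$, the real weights $\omega_0,\ldots,\omega_{N-1}$ and the non-negative weights $\upsilon_0,\ldots,\upsilon_{N-1}$ are given by $$x_n=\frac{\Delta_{2,\kappa(n)}}{\Delta_{0,\kappa(n)+1}}\quad(n=1,\dots,N),$$ $$\omega_0 = -\frac{\Delta_{-1,1}}{\Delta_{1,0}},\qquad \omega_n = \frac{\Delta_{-1,\kappa(n)+1}}{\Delta_{1,\kappa(n)}} - \frac{\Delta_{-1,\kappa(n+1)+1}}{\Delta_{1,\kappa(n+1)}}\quad(n=1,\dots,N-1),$$ $$\upsilon_0 = -\frac{\Delta_{-2,1}}{\Delta_{0,0}},\qquad \upsilon_n = \frac{\Delta_{-2,\kappa(n)+2}}{\Delta_{0,\kappa(n)+1}} - \frac{\Delta_{-2,\kappa(n+1)+1}}{\Delta_{0,\kappa(n+1)}}\quad(n=1,\dots,N-1).$$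 Furthermore, if the determinant $\Delta_{1,K}$ is zero, then $\kappa(N)=K-1$ and one has $$\upsilon(\{x_N\})=\frac{\Delta_{-1,\kappa(N)+2}^2}{\Delta_{0,\kappa(N)+1}\Delta_{0,\kappa(N)+2}}>0.$$
   Context: **Generalized indefinite strings.** For $L\in(0,\infty]$ let $H^1_{\mathrm{loc}}[0,L)=\{f\in AC_{\mathrm{loc}}[0,L)\,|\,f'\in L^2_{\mathrm{loc}}[0,L)\}$ and $H^1_{\mathrm{c}}[0,L)=\{f\in H^1_{\mathrm{loc}}[0,L)\,|\,\mathrm{supp}(f)\text{ compact in }[0,L)\}$, and let $H^{-1}_{\mathrm{loc}}[0,L)$ be the topological dual of $H^1_{\mathrm{c}}[0,L)$. A distribution $\chi\in H^{-1}_{\mathrm{loc}}[0,L)$ is real if $\chi(h)$ is real for each real-valued $h\in H^1_{\mathrm{c}}[0,L)$. A generalized indefinite string is a triple $(L,\omega,\upsilon)$ with $L\in(0,\infty]$, $\omega$ a real distribution in $H^{-1}_{\mathrm{loc}}[0,L)$ and $\upsilon$ a non-negative Borel measure on $[0,L)$ (finite on compact subsets). $\delta_x$ denotes the unit Dirac measure at $x\in[0,L)$, also viewed as the distribution $h\mapsto h(x)$. The restriction $\omega|_{[0,c)}$ is the restriction of $\omega$ to test functions in $H^1_{\mathrm{c}}[0,L)$ with compact support in $[0,c)$. A solution of $-f''=z\,\omega f+z^2\upsilon f$ ($z\in\mathbb{C}$) is a function $f\in H^1_{\mathrm{loc}}[0,L)$ such that $$d_f h(0)+\int_0^L f'(x)h'(x)\,dx=z\,\omega(fh)+z^2\int_{[0,L)}fh\,d\upsilon,\quad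 h\in H^1_{\mathrm{c}}[0,L),$$ for some constant $d_f\in\mathbb{C}$; this constant is uniquely determined and denoted by $f'(0-)$. The Weyl--Titchmarsh function is $$m(z)=\frac{\psi'(z,0-)}{z\psi(z,0)},\quad z\in\mathbb{C}\backslash\mathbb{R},$$ where $\psi(z,\cdot)$ is a non-trivial solution (unique up to scalar multiples) satisfying $\int_0^L|\psi'(z,x)|^2dx+\int_{[0,L)}|z\psi(z,x)|^2d\upsilon(x)<\infty$ and vanishing at the right endpoint $L$ when $L$ is finite. The function $m$ is a Herglotz--Nevanlinna function, i.e. analytic on $\mathbb{C}\backslash\mathbb{R}$, mapping the upper half-plane into its closure, with $m(z)^\ast=m(z^\ast)$. **Spectral measure, moments, Hankel determinants.** $m$ has a unique representation $m(z)= a + bz + \int_{\mathbb{R}} \big(\frac{1}{\lambda-z} - \frac{\lambda}{1+\lambda^2}\big)d\rho(\lambda)$ with $a\in\mathbb{R}$, $b\geq0$ and a non-negative Borel measure $\rho$ on $\mathbb{R}$ with $\int_{\mathbb{R}}(1+\lambda^2)^{-1}d\rho(\lambda)<\infty$; $\rho$ is called the spectral measure. Its moments exist up to order $k$ if $\int_{\mathbb{R}}|\lambda|^i\,d\rho(\lambda)<\infty$ for all $i\in\{0,\dots,k\}$. When they exist up to order $2K$, define $s_k=\int_{\mathbb{R}}\lambda^k\,d\rho(\lambda)$ for $k\in\{0,\dots,2K\}$ and $s_{-2}=-b$, $s_{-1}=\int_{\mathbb{R}}\frac{\lambda}{1+\lambda^2}d\rho(\lambda)-a$. For $j\in\{-2,-1,0,1,2\}$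 let $\Delta_{j,k}=\det(s_{j+p+q})_{p,q=0}^{k-1}$ be the $k\times k$ Hankel determinant with top-left entry $s_j$ and bottom-right entry $s_{j+2k-2}$, as long as all entries are defined; all are equal to one when $k=0$. **$N$ and $\kappa$.** $N\in\mathbb{N}$ is the number of non-zero elements of the sequence $\Delta_{1,0},\ldots,\Delta_{1,K}$, and $\kappa:\{1,\dots,N\}\to\{0,\dots,K\}$ is such that $\kappa(n)$ is the smallest $k\in\{0,\dots,K\}$ for which $\Delta_{1,0},\ldots,\Delta_{1,k}$ has precisely $n$ non-zero elements (so $\kappa(1)=0$). *)

(* Defs.v *)
From HB Require Import structures.
From mathcomp Require Import all_boot all_order all_algebra.
From mathcomp Require Import all_classical all_reals all_analysis.
From mathcomp.real_closed Require Import complex.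
Set Implicit Arguments.
Unset Strict Implicit.
Unset Printing Implicit Defensive.
Import Order.TTheory GRing.Theory Num.Theory.
Import numFieldNormedType.Exports.
Local Open Scope classical_set_scope.
Local Open Scope ring_scope.
Local Open Scope complex_scope.

(* Functions on [0,L) are represented by total functions R -> R[i]; only their
   values on [0,L) are ever relevant. *)
Section function_spaces.
Variable R : realType.
Local Notation C := R[i].
Local Notation normc := (@ComplexField.Normc.normc R).
Local Notation leb := (@lebesgue_measure R).

Definition halfopen (L : \bar R) : set R := [set x | 0 <= x /\ (x%:E < L)%E].

Definition cintegral d (T : measurableType d) (mu : {measure set T -> \bar R})
    (D : set T) (f : T -> C) : C :=
  (\int[mu]_(x in D) complex.Re (f x)) +i* (\int[mu]_(x in D) complex.Im (f x)).

(* The pointwise derivative of a function of a real variable; it is the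
   a.e. derivative f' when f is absolutely continuous (its values at the null
   set of points where f is not differentiable do not matter). *)
Definition cderiv (f : R -> C) (x : R) : C :=
  derive1 (fun t => complex.Re (f t)) x +i* derive1 (fun t => complex.Im (f t)) x.

Definition abs_continuous (a b : R) (f : R -> C) : Prop :=
  forall e : R, 0 < e -> exists2 d : R, 0 < d &
    forall (n : nat) (u v : 'I_n -> R),
      (forall i, [/\ a <= u i, u i <= v i & v i <= b]) ->
      trivIset setT (fun i => [set t | u i < t < v i]) ->
      \sum_(i < n) (v i - u i) < d ->
      \sum_(i < n) normc (f (v i) - f (u i)) < e.

Definition H1loc (L : \bar R) (f : R -> C) : Prop :=
  forall c, c \in halfopen L ->
    abs_continuous 0 c f /\
    (\int[leb]_(x in `[0%R, c]) (normc (cderiv f x) ^+ 2)%R%:E < +oo)%E.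

(* the support, i.e. the closure relative to [0,L) *)
Definition supp (L : \bar R) (f : R -> C) : set R :=
  closure [set x | halfopen L x /\ f x != 0] `&` halfopen L.

Definition H1c (L : \bar R) (f : R -> C) : Prop :=
  H1loc L f /\ compact (supp L f).

Definition H1norm (c : R) (f : R -> C) : R :=
  Num.sqrt (\int[leb]_(x in `[0, c])
              (normc (f x) ^+ 2 + normc (cderiv f x) ^+ 2)).

(* Topological dual of H^1_c[0,L): H^1_c[0,L) carries the inductive limit
   topology of its subspaces of functions supported in [0,c], 0 <= c < L, each
   with the H^1 norm, so a linear functional is continuous iff it is bounded on
   each of these subspaces.  In particular chi h only depends on the values of
   h on [0,L); the values of chi outside of H^1_c[0,L) are irrelevant. *)
Definition Hm1loc (L : \bar R) (chi : (R -> C) -> C) : Prop :=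
  (forall (a : C) (f g : R -> C), H1c L f -> H1c L g ->
     chi (fun x => a * f x + g x) = a * chi f + chi g) /\
  (forall c, c \in halfopen L -> exists M : R,
     forall h, H1c L h -> supp L h `<=` `[0, c] ->
       normc (chi h) <= M * H1norm c h).

Definition real_distribution (L : \bar R) (chi : (R -> C) -> C) : Prop :=
  forall h, H1c L h -> (forall x, x \in halfopen L -> complex.Im (h x) = 0) ->
    complex.Im (chi h) = 0.

(* A Borel measure on [0,L) is a Borel measure on R that does not charge the
   complement of [0,L). *)
Record indefinite_string := GeneralizedIndefiniteString {
  len : \bar R;
  omega : (R -> C) -> C;
  upsilon : {measure set (measurableTypeR R) -> \bar R};
  len_gt0 : (0 < len)%E;
  omega_dual : Hm1loc len omega;
  omega_real : real_distribution len omega;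
  upsilon_dom : upsilon (~` halfopen len) = 0%E;
  upsilon_fin : forall A : set R, compact A -> A `<=` halfopen len ->
    (upsilon A < +oo)%E
}.

(* f solves -f'' = z omega f + z^2 upsilon f, with f'(0-) = d *)
Definition is_solution (S : indefinite_string) (z : C) (f : R -> C) (d : C) : Prop :=
  H1loc (len S) f /\
  forall h, H1c (len S) h ->
    d * h 0 + cintegral leb (halfopen (len S)) (fun x => cderiv f x * cderiv h x)
    = z * omega S (fun x => f x * h x)
      + z ^+ 2 * cintegral (upsilon S) (halfopen (len S)) (fun x => f x * h x).

Definition is_Weyl_solution (S : indefinite_string) (z : C) (psi : R -> C) (d : C) : Prop :=
  [/\ is_solution S z psi d,
      (exists2 x, x \in halfopen (len S) & psi x != 0),
      (\int[leb]_(x in halfopen (len S)) (normc (cderiv psi x) ^+ 2)%R%:E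
       + \int[upsilon S]_(x in halfopen (len S)) (normc (z * psi x) ^+ 2)%R%:E
       < +oo)%E
    & forall l : R, len S = l%:E -> normc (psi x) @[x --> l^'-] --> (0 : R)].

Definition nonreal (z : C) : Prop := complex.Im z != 0.

Definition is_Weyl_Titchmarsh (S : indefinite_string) (m : C -> C) : Prop :=
  forall z, nonreal z -> exists psi d,
    is_Weyl_solution S z psi d /\ m z = d / (z * psi 0).

Definition is_rational (m : C -> C) : Prop :=
  exists p q : {poly C}, q != 0 /\
    forall z, nonreal z -> q.[z] != 0 -> m z = p.[z] / q.[z].

Local Notation measR := ({measure set (measurableTypeR R) -> \bar R}).

(* m(z) = a + b z + \int (1/(t - z) - t/(1 + t^2)) d rho(t) *)
Definition Herglotz_representation (m : C -> C) (a b : R) (rho : measR) : Prop :=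
  [/\ 0 <= b,
      (\int[rho]_t ((1 + t ^+ 2)^-1)%R%:E < +oo)%E
    & forall z, nonreal z ->
        m z = a%:C + b%:C * z
          + cintegral rho setT (fun t => (t%:C - z)^-1 - (t / (1 + t ^+ 2))%:C)].

Definition moments_exist (rho : measR) (k : nat) : Prop :=
  forall i, (i <= k)%N -> (\int[rho]_t (`|t| ^+ i)%R%:E < +oo)%E.

(* s_k for k >= -2; Negz 0 is -1, Negz 1 is -2, and s_k is junk for k < -2 *)
Definition moment (a b : R) (rho : measR) (k : int) : R :=
  match k with
  | Posz n => \int[rho]_t (t ^+ n)
  | Negz 0 => \int[rho]_t (t / (1 + t ^+ 2)) - a
  | Negz _ => - b
  end.

(* Delta_{j,k} = det (s_{j+p+q})_{0 <= p,q < k} *)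
Definition Hankel (s : int -> R) (j : int) (k : nat) : R :=
  \det (\matrix_(p < k, q < k) s (j + p%:Z + q%:Z)).

End function_spaces.

(* the number of non-zero elements among u 0, ..., u k *)
Definition nonzeros (R : realType) (u : nat -> R) (k : nat) : nat :=
  count (fun i => u i != 0) (iota 0 k.+1).

(* the smallest k in {0, ..., K} for which u 0, ..., u k has precisely n
   non-zero elements (K.+1 if there is no such k) *)
Definition nonzero_index (R : realType) (u : nat -> R) (K n : nat) : nat :=
  find (fun k => nonzeros u k == n) (iota 0 K.+1).

(* Main.v *)
Require Import Defs.
From HB Require Import structures.
From mathcomp Require Import all_boot all_order all_algebra.
From mathcomp Require Import perm.
From mathcomp Require Import all_classical all_reals all_analysis.
From mathcomp.real_closed Require Import complex.
From mathcomp Require Import measurable_realfun ring lra zify.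
Set Implicit Arguments.
Unset Strict Implicit.
Unset Printing Implicit Defensive.
Import Order.TTheory GRing.Theory Num.Theory.
Import numFieldNormedType.Exports.
Local Open Scope classical_set_scope.
Local Open Scope ring_scope.
Local Open Scope complex_scope.

(** Let m(z) = b z + c0 - s_0/z - s_1/z^2 - ... be the expansion of m along the positive imaginary
    axis, so that b = - s_{-2} and c0 = - s_{-1}, and let r(z) = - z (m(z) - b z - c0).  The energy
    inequality for the Weyl solution f, normalised by f(0) = 1, bounds the integral of |f'|^2 by
    Re r(z), which tends to s_0.  Hence f stays away from zero on [0,c] when c s_0 < 1.  The energy
    of f then excludes mass of upsilon in (0,c], and testing the equation of f with h/f gives
    omega(h) = c0 h(0).  So upsilon and omega start with b delta_0 and c0 delta_0, followed by a gap
    which ends at 1/s_0, a point of (0,L) since m is not rational.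

    Cutting this piece off leaves a string on [1/s_0,L) with Weyl-Titchmarsh function m_1 given by
    -1/m_1(z) = z (1/r(z) - 1/s_0).  Its moments are obtained by inverting a power series twice, and
    Hankel determinants of reciprocal power series are complementary minors of a triangular
    Toeplitz matrix and its inverse.  The formulas follow by induction: a step uses up two moments,
    or four if s_1 = 0. *)

(** * Absolutely continuous real functions *)

(** The right-hand part of a cut string has to be treated by the same means as a whole string. The
    invariant is the record [state]: interval and measure stay the same, the base point moves, and
    only an energy inequality is kept. It survives the cut because the energy of the affine piece
    over the gap, bounded below by Cauchy-Schwarz, is exactly what Im m loses on passing to m_1. The
    same sharp estimate fixes the end of the gap, so [H1loc_increment] must not lose a constant.

    That b is the atom of upsilon at the base point a is the limit M(iy)/(iy) -> upsilon({a}); it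
    rests on the smallness of a functional in H^{-1} on functions that vanish beyond a + e. The same
    limit yields upsilon({x_N}) when the moments run out.

    Delta_{-2} need not be followed through a step: kappa grows by 1 or 2, the mass is accordingly 0
    or, by the Desnanot-Jacobi identity, a quotient of determinants Delta_{-1} and Delta_0.

    As [H1loc] is defined by epsilon-delta absolute continuity and pointwise derivatives, all of
    this presupposes the fundamental theorem of calculus for such functions. *)

Section interval_families.
Variable R : realType.
Implicit Types (p q : R * R) (l : seq (R * R)) (u : R -> R).

Definition nonoverlapping p q := (p.2 <= q.1) || (q.2 <= p.1).

(** A finite list in place of the indexed families of [abs_continuous]: merging, refining and
    concatenating intervals become list operations. Intervals may share endpoints and may be
    degenerate. *)
Definition interval_family l :=
  all (fun p => p.1 <= p.2) l && pairwise nonoverlapping l.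

Definition total_length l := \sum_(p <- l) (p.2 - p.1).

Definition total_increment u l := \sum_(p <- l) `|u p.2 - u p.1|.

Lemma nonoverlappingC p q : nonoverlapping p q = nonoverlapping q p.
Proof. by rewrite /nonoverlapping orbC. Qed.

Lemma nonoverlapping_sub p p' q : p.1 <= p'.1 -> p'.2 <= p.2 ->
  nonoverlapping p q -> nonoverlapping p' q.
Proof.
move=> h1 h2 /orP[h|h]; apply/orP; [left|right].
  exact: le_trans h.
exact: le_trans h1.
Qed.

(** If [p] overlaps some [q] in [l], both are replaced by their hull, which is no longer than the
    two together because they meet, and the hull is inserted into the shorter list [rem q l]. *)
Lemma interval_family_insert p l : p.1 <= p.2 -> interval_family l ->
  exists l', [/\ interval_family l',
    total_length l' <= (p.2 - p.1) + total_length l &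
    forall q, q \in p :: l -> exists2 q', q' \in l' & q'.1 <= q.1 /\ q.2 <= q'.2].
Proof.
have [n] := ubnP (size l); elim: n => // n IH in p l *; rewrite ltnS => sl pp gl.
have [|] := boolP (all (nonoverlapping p) l) => [al|/allPn[q ql npq]].
  exists (p :: l); split.
  - by case/andP: gl => h1 h2; rewrite /interval_family /= pp h1 al.
  - by rewrite /total_length big_cons.
  - by move=> q ql; exists q.
move: npq; rewrite /nonoverlapping negb_or -!ltNge => /andP[q1p2 p1q2].
have qq : q.1 <= q.2 by case/andP: gl => /allP/(_ _ ql).
pose r := (Num.min p.1 q.1, Num.max p.2 q.2).
have rr : r.1 <= r.2.
  by rewrite /= ge_min !le_max pp.
have gl' : interval_family (rem q l).
  case/andP: gl => /allP h1 h2; apply/andP; split.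
    by apply/allP => x /mem_rem; exact: h1.
  exact: subseq_pairwise (rem_subseq _ _) h2.
have sl' : (size (rem q l) < n)%N.
  by rewrite size_rem// prednK//; case: (l) ql.
have [l' [gl1 tl1 cov]] := IH r _ sl' rr gl'.
exists l'; split => //.
  apply: le_trans tl1 _; rewrite {2}/total_length (perm_big _ (perm_to_rem ql)) /=.
  rewrite big_cons /total_length addrA lerD2r /r /=.
  by case: (lerP p.1 q.1) => h; case: (lerP p.2 q.2) => h'; lra.
move=> x; rewrite inE => /orP[/eqP ->|xl].
  have [|q' q'l [h1 h2]] := cov r; first by rewrite mem_head.
  exists q' => //; split; first by apply: le_trans h1 _; rewrite /= ge_min lexx.
  by apply: le_trans h2; rewrite /= le_max lexx.
have [->|xq] := eqVneq x q.
  have [|q' q'l [h1 h2]] := cov r; first by rewrite mem_head.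
  exists q' => //; split; first by apply: le_trans h1 _; rewrite /= ge_min lexx orbT.
  by apply: le_trans h2; rewrite /= le_max lexx orbT.
have xr : x \in rem q l.
  by move: xl; rewrite (perm_mem (perm_to_rem ql)) inE (negbTE xq).
by apply: cov; rewrite inE xr orbT.
Qed.

(** The intervals of a cover that nearly attains the outer measure may overlap, whereas absolute
    continuity bounds increments over non-overlapping ones only. *)
Lemma interval_family_cover l : all (fun p => p.1 <= p.2) l ->
  exists l', [/\ interval_family l', total_length l' <= total_length l &
    forall q, q \in l -> exists2 q', q' \in l' & q'.1 <= q.1 /\ q.2 <= q'.2].
Proof.
elim: l => [_|p l IH /= /andP[pp al]]; first by exists [::].
have [l1 [g1 t1 c1]] := IH al.
have [l2 [g2 t2 c2]] := interval_family_insert pp g1.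
exists l2; split => //.
  by apply: le_trans t2 _; rewrite [in leRHS]/total_length big_cons lerD2l.
move=> q; rewrite inE => /orP[/eqP ->|/c1[q1 q1l [h1 h2]]].
  by apply: c2; rewrite mem_head.
have [|q2 q2l [h3 h4]] := c2 q1; first by rewrite inE q1l orbT.
by exists q2 => //; split; [exact: le_trans h1 | exact: le_trans h4].
Qed.

(** Absolute continuity uniform on the whole line; a function on [a,b] enters after being extended
    by constants through [clamp]. *)
Definition equi_ac u := forall e : R, 0 < e -> exists2 d : R, 0 < d &
  forall l, interval_family l -> total_length l < d -> total_increment u l <= e.

Lemma interval_family1 (x y : R) : x <= y -> interval_family [:: (x, y)].
Proof. by move=> xy; rewrite /interval_family /= xy. Qed.

Lemma interval_family_map (phi : R -> R) l : {homo phi : x y / x <= y} ->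
  interval_family l -> interval_family [seq (phi p.1, phi p.2) | p <- l].
Proof.
move=> phi_nd /andP[/allP al pl]; apply/andP; split.
  by apply/allP => _ /mapP[p /al pp ->] /=; exact: phi_nd.
rewrite pairwise_map; apply: sub_pairwise pl => p q; rewrite /nonoverlapping /=.
by move=> /orP[h|h]; rewrite (phi_nd _ _ h) ?orbT.
Qed.

Lemma equi_ac_dist u : equi_ac u -> forall e, 0 < e -> exists2 d, 0 < d &
  forall x y, `|y - x| < d -> `|u y - u x| <= e.
Proof.
move=> acu e e0; have [d d0 h] := acu e e0; exists d => // x y.
wlog xy : x y / x <= y.
  by move=> H; case: (leP x y) => [|/ltW] /H; last rewrite distrC (distrC (u x)).
rewrite ger0_norm ?subr_ge0// => yxd.
have := h _ (interval_family1 xy).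
by rewrite /total_length /total_increment !big_seq1; exact.
Qed.

Lemma equi_ac_continuous u : equi_ac u -> continuous u.
Proof.
move=> acu x; apply/cvgrPdist_le => e e0.
have [d d0 h] := equi_ac_dist acu e0.
near=> y; apply: h; near: y.
by apply: cvgr_dist_lt => //; exact: cvg_id.
Unshelve. all: by end_near. Qed.

Fixpoint consecutive (x : R) (s : seq R) : seq (R * R) :=
  if s is y :: s' then (x, y) :: consecutive y s' else [::].

Lemma variation_consecutive x y u s : variation x y u s = total_increment u (consecutive x s).
Proof.
rewrite /variation /total_increment; elim: s x => [|z s IH] x /=.
  by rewrite !big_nil.
rewrite big_cons big_nat_recl//=; congr (_ + _).
rewrite -IH; apply: eq_big_nat => i /andP[_ is_].
by [].
Qed.

Lemma consecutiveP x y s : itv_partition x y s ->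
  [/\ interval_family (consecutive x s), total_length (consecutive x s) = y - x &
      all (fun p => (x <= p.1) && (p.2 <= y)) (consecutive x s)].
Proof.
elim: s x => [|z s IH] x.
  move=> /itv_partition_nil ->; split => //.
  by rewrite /total_length big_nil subrr.
move=> [/= /andP[xz ps] ls].
have ip : itv_partition z y s by split.
have [/andP[h1 h2] h3 h4] := IH _ ip.
have zy := itv_partition_le ip.
split.
- rewrite /interval_family /= (ltW xz) h1 h2 !andbT /=.
  by apply/allP => p /(allP h4) /andP[zp _]; rewrite /nonoverlapping /= zp.
- by rewrite /total_length big_cons /= -/(total_length _) h3; lra.
- rewrite /= lexx zy /=; apply/allP => p /(allP h4) /andP[zp ->].
  by rewrite (le_trans (ltW xz) zp).
Qed.

Lemma interval_family_cons p l : interval_family (p :: l) =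
  [&& p.1 <= p.2, all (nonoverlapping p) l & interval_family l].
Proof. by rewrite /interval_family /= -!andbA; congr (_ && _); rewrite andbCA. Qed.

Lemma interval_family_cat l1 l2 : interval_family (l1 ++ l2) =
  [&& interval_family l1, interval_family l2 & allrel nonoverlapping l1 l2].
Proof.
rewrite /interval_family all_cat pairwise_cat.
by case: all; case: all; case: pairwise; case: pairwise; case: allrel.
Qed.

Lemma total_length_cat l1 l2 :
  total_length (l1 ++ l2) = total_length l1 + total_length l2.
Proof. by rewrite /total_length big_cat. Qed.

Lemma total_increment_cat u l1 l2 :
  total_increment u (l1 ++ l2) = total_increment u l1 + total_increment u l2.
Proof. by rewrite /total_increment big_cat. Qed.

Local Notation TV := (@total_variation R).

Lemma sum_total_variation_ge0 u l : interval_family l ->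
  (0 <= \sum_(p <- l) TV p.1 p.2 u)%E.
Proof.
move=> /andP[/allP al _]; rewrite big_seq; apply: sume_ge0 => p pl.
exact/total_variation_ge0/al.
Qed.

(** The intervals of [l2] are refined one at a time: the variation over the head is a supremum over
    its partitions, and each partition is moved into [l1]. The total length does not change, so the
    same [d] and [e] serve for the variation. *)
Lemma equi_ac_total_variation u (e d : R) :
  (forall l, interval_family l -> total_length l < d -> total_increment u l <= e) ->
  forall l2 l1, interval_family (l1 ++ l2) -> total_length (l1 ++ l2) < d ->
  ((total_increment u l1)%:E + \sum_(p <- l2) TV p.1 p.2 u <= e%:E)%E.
Proof.
move=> acu; elim => [|p l2 IH] l1 gl tl.
  by rewrite cats0 in gl tl; rewrite big_nil adde0 lee_fin; exact: acu.
move: (gl); rewrite interval_family_cat interval_family_cons.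
move=> /and3P[g1 /and3P[pp pl2 g2] al].
have gl12 : interval_family (l1 ++ l2).
  rewrite interval_family_cat g1 g2 /=; apply/allrelP => x y xl yl.
  by move/allrelP: al; apply => //; rewrite inE yl orbT.
move: tl; rewrite total_length_cat {2}/total_length big_cons -/(total_length l2) => tl.
have IH0 := IH _ gl12.
have l12 : total_length (l1 ++ l2) < d.
  by rewrite total_length_cat; apply: le_lt_trans tl; rewrite lerD2l lerDr subr_ge0.
have {}IH0 := IH0 l12.
have s0 := sum_total_variation_ge0 u g2.
have sfin : (\sum_(p <- l2) TV p.1 p.2 u)%E \is a fin_num.
  rewrite ge0_fin_numE//; apply: le_lt_trans (ltry (e - total_increment u l1)).
  by rewrite EFinB leeBrDr// addeC.
rewrite big_cons -(fineK sfin).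
set y := fine _; set X := total_increment u l1.
rewrite addeCA -EFinD -leeBrDr// -EFinB.
case: p pp gl tl pl2 al => a b /=; rewrite le_eqVlt => /orP[/eqP <-|ab] gl tl pl2 al.
  rewrite total_variationxx lee_fin subr_ge0.
  by move: IH0; rewrite -(fineK sfin) -EFinD lee_fin.
apply: ge_ereal_sup => _ [_ [s abs <-] <-]; rewrite lee_fin variation_consecutive.
have [cg cl call] := consecutiveP abs.
have := IH (l1 ++ consecutive a s).
rewrite -catA total_length_cat (total_length_cat (consecutive a s)) cl => /(_ _ tl).
rewrite total_increment_cat -(fineK sfin) -/y -EFinD lee_fin => H.
suff : interval_family (l1 ++ consecutive a s ++ l2).
  by move=> /H; rewrite -/X; lra.
rewrite !interval_family_cat g1 cg g2 /=; apply/andP; split.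
  apply/allrelP => q r /(allP call) /andP[h1 h2] rl.
  apply: (@nonoverlapping_sub (a, b)) => //.
  by move/allP : pl2; apply.
apply/allrelP => q r ql; rewrite mem_cat => /orP[/(allP call) /andP[h1 h2]|rl].
  rewrite nonoverlappingC; apply: (@nonoverlapping_sub (a, b)) => //.
  by rewrite nonoverlappingC; move/allrelP: al; apply => //; rewrite mem_head.
by move/allrelP: al; apply => //; rewrite inE rl orbT.
Qed.

(** With d the modulus belonging to 1, the variation over an interval of length at most d/2 is at
    most 1; a longer interval is cut into finitely many such pieces. *)
Lemma equi_ac_TV_fin u : equi_ac u -> forall x y, x <= y -> TV x y u \is a fin_num.
Proof.
move=> acu; have [d d0 h] := acu 1 ltr01.
suff H n x y : x <= y -> y - x <= n%:R * (d / 2) -> TV x y u \is a fin_num.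
  move=> x y xy.
  have [n hn] : exists n, (y - x) / (d / 2) <= n%:R.
    exists (Num.truncn `|(y - x) / (d / 2)|).+1.
    by apply: le_trans (ler_norm _) (ltW _); rewrite truncnS_gt.
  apply: (H n) => //; move: hn; rewrite ler_pdivrMr//; lra.
elim: n => [|n IH] in x y *.
  rewrite mul0r subr_le0 => xy yx; have -> : x = y by apply/eqP; rewrite eq_le xy yx.
  by rewrite total_variationxx.
move=> xy; rewrite -natr1 mulrDl mul1r => hxy.
have [hd|hd] := leP (y - x) (d / 2).
  rewrite ge0_fin_numE ?total_variation_ge0//.
  have := @equi_ac_total_variation u 1 d h [:: (x, y)] [::] (interval_family1 xy).
  rewrite cat0s {1}/total_length {1}/total_increment !big_seq1 !big_nil add0e /= => H.
  by apply: le_lt_trans (H _) (ltry _); lra.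
rewrite (@total_variationD _ x y (y - d / 2)); [|lra..].
rewrite fin_numD; apply/andP; split; first by apply: IH; lra.
rewrite ge0_fin_numE ?total_variation_ge0//; last lra.
have yd : y - d / 2 <= y by lra.
have := @equi_ac_total_variation u 1 d h [:: (y - d / 2, y)] [::] (interval_family1 yd).
rewrite cat0s {1}/total_length {1}/total_increment !big_seq1 !big_nil add0e /= => H.
by apply: le_lt_trans (H _) (ltry _); lra.
Qed.

End interval_families.

(** * Densities of monotone absolutely continuous functions *)

Section monotone_density.
Variables (R : realType) (V : R -> R).
Hypotheses (Vnd : {homo V : x y / x <= y}) (Vac : equi_ac V).
Variables (a b : R).
Hypotheses (Va : forall x, x <= a -> V x = V a) (Vb : forall x, b <= x -> V x = V b).
Local Notation leb := (@lebesgue_measure R).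

Let Vrc : right_continuous V.
Proof. exact: right_continuousW (equi_ac_continuous Vac). Qed.

Let F : R -> R := V.
HB.instance Definition _ := @isCumulative.Build R _ R F Vnd Vrc.

Let nu : set (measurableTypeR R) -> \bar R := lebesgue_stieltjes_measure F.
HB.instance Definition _ := Measure.on nu.

Let nu_oc x y : x <= y -> nu `]x, y]%classic = (V y - V x)%:E.
Proof.
move=> xy; rewrite /nu /lebesgue_stieltjes_measure /measure_extension/=.
rewrite measurable_mu_extE/=; last exact: is_ocitv.
by rewrite wlength_itv_bnd.
Qed.

(** V is constant to the left of a and to the right of b, so the whole line has mass at most V b - V
    a. *)
Let nu_fin : fin_num_fun nu.
Proof.
have nuT : (nu setT <= (V b - V a)%:E)%E.
  have e : [set: measurableTypeR R] = \bigcup_n `](- n%:R : R), n%:R]%classic.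
    apply/seteqP; split => // x _; exists (Num.truncn `|x|).+1 => //=.
    have : `|x| < (Num.truncn `|x|).+1%:R by rewrite truncnS_gt.
    by rewrite in_itv/= ltr_norml => /andP[-> /ltW ->].
  have c : nu `](- n%:R : R), n%:R]%classic @[n --> \oo] --> nu setT.
    rewrite e; apply: nondecreasing_cvg_mu.
    - by move=> n; exact: measurable_itv.
    - by apply: bigcup_measurable => n _; exact: measurable_itv.
    - move=> n m nm; apply/subsetPset => x /=; rewrite !in_itv/= => /andP[h1 h2].
      have nm' : n%:R <= m%:R :> R by rewrite ler_nat.
      by apply/andP; split; [apply: le_lt_trans h1; rewrite lerN2|exact: le_trans nm'].
  rewrite -(cvg_lim _ c)//; apply: lime_le; first by apply/cvg_ex; eexists; exact: c.
  apply: nearW => n; rewrite nu_oc ?lee_fin; last by rewrite ge0_cp.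
  apply: lerB.
    by case: (leP n%:R b) => [|/ltW /Vb ->//]; exact: Vnd.
  by case: (leP (- n%:R) a) => [/Va ->//|/ltW]; exact: Vnd.
move=> U mU; rewrite ge0_fin_numE//; apply: le_lt_trans (ltry (V b - V a)).
by apply: le_trans nuT; apply: le_measure; rewrite ?inE.
Qed.

HB.instance Definition _ := @Measure_isFinite.Build _ _ _ nu nu_fin.

(** A Lebesgue null set has a countable cover by half-open intervals of total length below the
    modulus d of e. Finitely many of them, made non-overlapping, have nu-measure at most e by
    absolute continuity; continuity from below extends this to the whole cover. *)
Let nu_dominated : nu `<< leb.
Proof.
apply/null_content_dominatesP => A mA lA.
apply/eqP; rewrite eq_le measure_ge0 andbT; apply/lee_addgt0Pr => e e0; rewrite add0e.
have [d d0 hd] := Vac e0.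
have : (leb A < d%:E)%E by rewrite lA lte_fin.
rewrite {1}/lebesgue_measure /= /lebesgue_stieltjes_measure /measure_extension/=.
move=> /ereal_inf_lt[_ [C [mC AC] <-] Cd].
have [p hp] : exists p : nat -> R * R, forall n, (p n).1 <= (p n).2 /\ C n = `](p n).1, (p n).2]%classic.
  have H n : exists x : R * R, x.1 <= x.2 /\ C n = `]x.1, x.2]%classic.
    have /ocitvP [->|[x x12 ->]] := mC n.
      by exists (0, 0); split => //=; rewrite set_itvoc0.
    by exists x; split => //; exact: ltW.
  by have [p hp] := choice H; exists p.
have AU : A `<=` \bigcup_n \big[setU/set0]_(i < n) C i.
  move=> x /AC [n _ Cx]; exists n.+1 => //; rewrite big_ord_recr/=; by right.
have mU n : measurable (\big[setU/set0]_(i < n) C i : set (measurableTypeR R)).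
  apply: bigsetU_measurable => i _; rewrite (hp i).2; exact: measurable_itv.
have c : nu (\big[setU/set0]_(i < n) C i) @[n --> \oo] --> nu (\bigcup_n \big[setU/set0]_(i < n) C i).
  apply: nondecreasing_cvg_mu => //; first exact: bigcup_measurable.
  move=> n m nm; apply/subsetPset; exact: subset_bigsetU.
apply: (@le_trans _ _ (nu (\bigcup_n \big[setU/set0]_(i < n) C i))).
  apply: le_measure => //; rewrite inE//; exact: bigcup_measurable.
rewrite -(cvg_lim _ c)//; apply: lime_le; first by apply/cvg_ex; eexists; exact: c.
apply: nearW => n.
pose l := [seq p i | i <- iota 0 n].
have [|l' [gl' tl' cov]] := @interval_family_cover _ l.
  by apply/allP => q /mapP[i _ ->]; exact: (hp i).1.
have tl : total_length l < d.
  rewrite -lte_fin; apply: le_lt_trans Cd.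
  rewrite /total_length big_map -sumEFin.
  apply: (@le_trans _ _ (\sum_(0 <= i < n) wlength idfun (C i))%E).
    rewrite /index_iota subn0; apply: lee_sum => i _.
    by rewrite (hp i).2 wlength_itv_bnd ?(hp i).1.
  by apply: nneseries_lim_ge => k _ _; exact: wlength_ge0.
have := hd _ gl' (le_lt_trans tl' tl).
rewrite -lee_fin; apply: le_trans.
apply: (@le_trans _ _ (nu (\big[setU/set0]_(q <- l') `]q.1, q.2]%classic))).
  apply: le_measure; rewrite ?inE//.
    by apply: bigsetU_measurable => i _; exact: measurable_itv.
  move=> x; rewrite -bigcup_mkord => -[i /= ni]; rewrite (hp i).2 /= in_itv/= => /andP[h1 h2].
  have [|q ql [q1 q2]] := cov (p i).
    by apply/mapP; exists i => //; rewrite mem_iota.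
  rewrite -bigcup_seq; exists q => //=.
  by rewrite in_itv/= (le_lt_trans q1 h1) (le_trans h2 q2).
have al : all (fun q => q.1 <= q.2) l' by case/andP: gl'.
elim: (l') al => [_|q s IH /= /andP[qq /IH ss]].
  by rewrite big_nil measure0 /total_increment big_nil.
rewrite big_cons /total_increment big_cons EFinD.
apply: le_trans (measureU2 _ _ _) _.
- exact: measurable_itv.
- by apply: bigsetU_measurable => i _; exact: measurable_itv.
- apply: leeD => //.
  apply: (@le_trans _ _ (V q.2 - V q.1)%:E); last by rewrite lee_fin ler_norm.
  by rewrite -(nu_oc qq); exact: lexx.
Qed.

(** Radon-Nikodym, applied to the Lebesgue-Stieltjes measure of V. *)
Lemma monotone_equi_ac_density : exists g : R -> R,
  leb.-integrable setT (EFin \o g) /\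
  forall x y, x <= y -> V y - V x = \int[leb]_(t in `]x, y]) g t.
Proof.
have [f [f0 ffin fint fE]] := @radon_nikodym_sigma_finite _ _ R leb nu nu_dominated.
exists (fine \o f); split.
  have -> // : EFin \o (fine \o f) = f by apply/funext => x /=; rewrite fineK.
move=> x y xy.
have e : nu `]x, y]%classic = (\int[leb]_(t in `]x, y]) f t)%E by apply: fE; exact: measurable_itv.
rewrite nu_oc// in e.
rewrite /Rintegral -[LHS]/(fine (V y - V x)%:E) e; congr fine.
by apply: eq_integral => t _ /=; rewrite fineK.
Qed.

End monotone_density.

(** * Measurability of the pointwise derivative *)

Section measurable_derivative.
Variable R : realType.
Implicit Types w : R -> R.

Let quot w (h x : R) := h^-1 * (w (h + x) - w x).

Let quot_continuous w h : continuous w -> continuous (quot w h).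
Proof.
move=> cw x; apply: cvgM; first exact: cvg_cst.
apply: cvgB; last exact: cw.
apply: (@continuous_comp _ _ _ (fun x => h + x) w); last exact: cw.
by apply: cvgD; [exact: cvg_cst|exact: cvg_id].
Qed.

Let quot_continuousl w x h : continuous w -> h != 0 ->
  {for h, continuous (fun h => quot w h x)}.
Proof.
move=> cw h0; apply: cvgM; first by apply: cvgV => //; exact: cvg_id.
apply: cvgB; last exact: cvg_cst.
apply: (@continuous_comp _ _ _ (fun h => h + x) w); last exact: cw.
by apply: cvgD; [exact: cvg_id|exact: cvg_cst].
Qed.

(** A measurable candidate for the derivative, with which it agrees wherever w is differentiable:
    only the increments 1/(n+1) are used. *)
Let slope w (x : R) : R := fine (limn_esup (fun n => (quot w n.+1%:R^-1 x)%:E)).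

Let measurable_slope w : continuous w -> measurable_fun setT (slope w).
Proof.
move=> cw; pose F : R -> \bar R := fun x => limn_esup (fun n => (quot w n.+1%:R^-1 x)%:E).
suff : measurable_fun setT F by exact: measurableT_comp.
apply: measurable_fun_limn_esup => n; apply/measurable_EFinP.
by apply: continuous_measurable_fun; exact: quot_continuous.
Qed.

Let nth_rat (n : nat) : R := ratr (odflt 0 (unpickle n : option rat)).

(** For continuous w, differentiability at x means that for every k there is m such that x is in
    this set for all n: a difference quotient depends continuously on its non-zero increment, so
    rational increments suffice. The points of differentiability thus form a Borel set. *)
Let good w k m n : set R := [set x | 0 < `|nth_rat n| < m.+1%:R^-1 ->
  `|quot w (nth_rat n) x - slope w x| <= k.+1%:R^-1].

Lemma derivable_quotP w x (l : R) :
  (derivable w x 1 /\ derive1 w x = l) <->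
  (forall e : R, 0 < e -> exists2 d : R, 0 < d &
     forall h, 0 < `|h| < d -> `|quot w h x - l| <= e).
Proof.
have E : (fun h : R => h^-1 *: ((w \o shift x) (h *: 1) - w x)) = (fun h => quot w h x).
  by apply/funext => h; rewrite /quot /= [h *: 1]mulr1.
split => [[dw <-] e e0|H].
  move: dw; rewrite /derivable E => dw.
  have : quot w h x @[h --> 0^'] --> derive1 w x by rewrite /derive1.
  move=> /cvgrPdist_le /(_ _ e0); rewrite near_withinE /= nearE.
  move=> /nbhs_ballP[d d0 H]; exists d => // h /andP[h0 hd].
  rewrite distrC; apply: H; last by rewrite -normr_gt0.
  by rewrite /ball /= sub0r normrN.
have c : quot w h x @[h --> 0^'] --> l.
  apply/cvgrPdist_le => e e0; have [d d0 Hd] := H _ e0.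
  rewrite near_withinE; apply/nbhs_ballP; exists d => // h /=.
  rewrite /ball /= sub0r normrN => hd h0; rewrite distrC; apply: Hd.
  by rewrite normr_gt0 h0.
split; first by rewrite /derivable E; apply/cvg_ex; exists l.
by rewrite /derive1; apply/cvg_lim.
Qed.

Let derivable_slope w x : derivable w x 1 -> derive1 w x = slope w x.
Proof.
move=> dw; have /derivable_quotP := conj dw (erefl (derive1 w x)).
move=> H; rewrite /slope.
have c : (quot w n.+1%:R^-1 x)%:E @[n --> \oo] --> (derive1 w x)%:E.
  apply/fine_cvgP; split; first exact: nearW.
  apply/cvgrPdist_le => e e0; have [d d0 Hd] := H _ e0.
  near=> n; rewrite /= distrC; apply: Hd; rewrite gtr0_norm ?invr_gt0//=; apply/andP; split => //.
  near: n; exact: near_infty_natSinv_lt (PosNum d0).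
by rewrite (cvg_limn_einf_sup c).
Unshelve. all: by end_near. Qed.

Lemma measurable_derive1 w : continuous w -> measurable_fun setT (derive1 w).
Proof.
move=> cw.
pose E := \bigcap_k \bigcup_m \bigcap_n good w k m n.
have mE : measurable E.
  apply: bigcap_measurable => // k _; apply: bigcup_measurable => m _.
  apply: bigcapT_measurable => n.
  rewrite /good; case: (boolP (0 < `|nth_rat n| < m.+1%:R^-1)) => hh; last first.
    by rewrite (_ : [set _ | _] = setT)//; apply/seteqP; split.
  rewrite (_ : [set _ | _] = (fun x => `|quot w (nth_rat n) x - slope w x|) @^-1` `]-oo, k.+1%:R^-1]).
    rewrite -[X in measurable X]setTI; apply: (_ : measurable_fun setT _) => //.
    apply: measurableT_comp => //; apply: measurable_funD; last by apply: measurableT_comp => //; exact: measurable_slope.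
    by apply: continuous_measurable_fun; exact: quot_continuous.
  by apply/seteqP; split => x /=; rewrite in_itv/=; [apply|].
have EP x : E x <-> derivable w x 1.
  split => [Ex|dw].
    have /derivable_quotP[] // : forall e : R, 0 < e -> exists2 d : R, 0 < d &
        forall h, 0 < `|h| < d -> `|quot w h x - slope w x| <= e.
    move=> e e0.
    have [k ke] : exists k, k.+1%:R^-1 < e.
      have [N _ HN] := near_infty_natSinv_lt (PosNum e0).
      by exists N; exact: (HN N (leqnn N)).
    have [m _ Hm] := Ex k Logic.I.
    exists m.+1%:R^-1; first by rewrite invr_gt0.
    move=> h /andP[h0 hm]; apply/ler_addgt0Pr => eta eta0.
    have hn0 : h != 0 by rewrite -normr_gt0.
    have /cvgrPdist_lt /(_ _ eta0) := quot_continuousl cw hn0 (x := x).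
    move=> /nbhs_ballP[r r0 Hr].
    (* A rational within this distance of h is non-zero, still below 1/(m+1) in absolute value, and
       changes the quotient by less than eta. *)
    pose r' := Num.min r (Num.min `|h| (m.+1%:R^-1 - `|h|)).
    have r'0 : 0 < r' by rewrite !lt_min r0 h0 subr_gt0.
    have [q qin] := @rat_in_itvoo _ h (h + r') ltac:(by rewrite ltrDl).
    move: qin; rewrite in_itv /= => /andP[q1 q2].
    have qh : `|h - ratr q| < r' by rewrite distrC gtr0_norm ?subr_gt0// ltrBlDl.
    have := qh; rewrite !lt_min => /and3P[qr qh1 qh2].
    have nq : nth_rat (pickle q) = ratr q by rewrite /nth_rat pickleK.
    have Q := Hm (pickle q) Logic.I; rewrite /good nq in Q.
    rewrite -(subrKA (quot w (ratr q) x)).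
    apply: le_trans (ler_normD _ _) _; rewrite addrC lerD//.
      apply: le_trans (Q _) (ltW ke); apply/andP; split.
        rewrite normr_gt0; apply/eqP => q0; move: qh1; rewrite q0 subr0 ltxx//.
      apply: (@le_lt_trans _ _ (`|h| + `|h - ratr q|)); last by rewrite -ltrBrDl.
      by rewrite -{1}(subKr h (ratr q)); exact: ler_normB.
    by apply: ltW; apply: Hr.
  move=> k _; have dE := derivable_slope dw.
  have /derivable_quotP := conj dw dE.
  move=> /(_ k.+1%:R^-1) []; first by rewrite invr_gt0.
  move=> d d0 Hd.
  have [m _ Hm] := near_infty_natSinv_lt (PosNum d0).
  exists m => // n _; rewrite /good /= => /andP[h0 hm]; apply: Hd.
  by rewrite h0 /= (lt_trans hm)//; exact: (Hm m (leqnn m)).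
(* Where w is not differentiable, derive1 takes the junk value [point]. *)
have -> : derive1 w = (fun x => slope w x * \1_E x + (point : R) * \1_(~` E) x).
  apply/funext => x; rewrite !indicE.
  have [xE|xE] := pselect (E x).
    rewrite mem_set// memNset; last by apply.
    by rewrite mulr1 mulr0 addr0; apply: derivable_slope; apply/EP.
  rewrite memNset// mem_set// mulr0 mulr1 add0r.
  rewrite derive1E /derive; apply: dvgP => dw; apply: xE; exact/EP.
apply: measurable_funD; apply: measurable_funM.
- exact: measurable_slope.
- exact: measurable_indic.
- exact: measurable_cst.
- by apply: measurable_indic; exact: measurableC.
Qed.

End measurable_derivative.

(** * The fundamental theorem of calculus for absolutely continuous functions *)

Section real_absolute_continuity.
Variable R : realType.
Implicit Types (a b c : R) (u v w : R -> R).
Local Notation leb := (@lebesgue_measure R).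

Definition acont a b u : Prop :=
  forall e : R, 0 < e -> exists2 d : R, 0 < d &
    forall (n : nat) (s t : 'I_n -> R),
      (forall i, [/\ a <= s i, s i <= t i & t i <= b]) ->
      trivIset setT (fun i => [set x | s i < x < t i]) ->
      \sum_(i < n) (t i - s i) < d ->
      \sum_(i < n) `|u (t i) - u (s i)| < e.

(** Composition with [clamp] extends a function on [a,b] to the line by its boundary values; test
    functions and solutions are truncated in the same way later. *)
Definition clamp a b x : R := Num.max a (Num.min x b).

Lemma clamp_nd a b : {homo clamp a b : x y / x <= y}.
Proof.
move=> x y xy; rewrite /clamp ge_max !le_max lexx /=.
by apply/orP; right; rewrite le_min !ge_min xy lexx !orbT.
Qed.

Lemma clamp_id a b x : a <= x <= b -> clamp a b x = x.
Proof. by move=> /andP[ax xb]; rewrite /clamp (min_l xb) (max_r ax). Qed.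

Lemma clamp_itv a b x : a <= b -> a <= clamp a b x <= b.
Proof. by move=> ab; rewrite /clamp le_max lexx /= ge_max ab ge_min lexx orbT. Qed.

Lemma clamp_low a b x : x <= a -> clamp a b x = a.
Proof. by move=> xa; rewrite /clamp max_l// ge_min xa. Qed.

Lemma clamp_high a b x : a <= b -> b <= x -> clamp a b x = b.
Proof. by move=> ab bx; rewrite /clamp (min_r bx) max_r. Qed.

Lemma clamp_lip a b x y : x <= y -> clamp a b y - clamp a b x <= y - x.
Proof. by move=> xy; rewrite /clamp /Num.max /Num.min; do !case: ifPn; rewrite -?leNgt; lra. Qed.

Lemma acontS a b a' b' u : a <= a' -> b' <= b -> acont a b u -> acont a' b' u.
Proof.
move=> aa bb acu e e0; have [d d0 H] := acu e e0; exists d => // n s t st.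
apply: H => i; have [h1 h2 h3] := st i; split => //; [exact: le_trans h1|exact: le_trans bb].
Qed.

(** Sums, products, reciprocals and Lipschitz functions all inherit absolute continuity through an
    increment bound of this shape. *)
Lemma acont_le a b u v w (B : R) :
  (forall x y, a <= x -> x <= y -> y <= b ->
     `|w y - w x| <= B * (`|u y - u x| + `|v y - v x|)) ->
  acont a b u -> acont a b v -> acont a b w.
Proof.
move=> wuv acu acv e e0.
pose B' := `|B| + 1; have B'0 : 0 < B' by rewrite ltr_wpDl.
have e20 : 0 < e / (2 * B') by rewrite divr_gt0// mulr_gt0.
have [d1 d10 H1] := acu _ e20; have [d2 d20 H2] := acv _ e20.
exists (Num.min d1 d2); first by rewrite lt_min d10.
move=> n s t st ts; rewrite lt_min => /andP[h1 h2].
have {}H1 := H1 n s t st ts h1; have {}H2 := H2 n s t st ts h2.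
apply: (@le_lt_trans _ _ (B' * (\sum_(i < n) `|u (t i) - u (s i)| + \sum_(i < n) `|v (t i) - v (s i)|))).
  rewrite -big_split/= mulr_sumr; apply: ler_sum => i _; have [? ? ?] := st i.
  apply: le_trans (wuv _ _ _ _ _) _ => //; apply: ler_wpM2r; first exact: addr_ge0.
  by apply: le_trans (ler_norm _) _; rewrite lerDl.
rewrite -ltr_pdivlMl//; apply: lt_le_trans (ltrD H1 H2) _.
by rewrite le_eqVlt; apply/orP; left; apply/eqP; field; rewrite gt_eqF.
Qed.

Lemma acont_id a b : acont a b id.
Proof.
move=> e e0; exists e => // n s t st _; apply: le_lt_trans.
by apply: ler_sum => i _; have [_ h _] := st i; rewrite ger0_norm// subr_ge0.
Qed.

Lemma acont_lipschitz a b w (B : R) :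
  (forall x y, a <= x -> x <= y -> y <= b -> `|w y - w x| <= B * (y - x)) ->
  acont a b w.
Proof.
move=> H; have B0 := normr_ge0 B.
apply: (@acont_le a b id id w `|B|); [|exact: acont_id|exact: acont_id].
move=> x y ax xy yb; apply: le_trans (H _ _ _ _ _) _ => //.
have yx : 0 <= y - x by rewrite subr_ge0.
rewrite (ger0_norm yx); have := ler_norm B; nra.
Qed.

Lemma acont_comp_clamp a b a' b' u : a <= a' -> a' <= b' -> b' <= b -> acont a b u ->
  acont a b (u \o clamp a' b').
Proof.
move=> aa ab bb acu e e0; have [d d0 H] := acu e e0; exists d => // n s t st ts sd.
apply: (H n (clamp a' b' \o s) (clamp a' b' \o t)).
- move=> i; have [h1 h2 h3] := st i; split; rewrite /=.
  + by have /andP[+ _] := clamp_itv (s i) ab; exact: le_trans.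
  + exact: clamp_nd.
  + by have /andP[_ h] := clamp_itv (t i) ab; exact: le_trans h bb.
- move=> i j _ _ [y [/= /andP[y1 y2] /andP[y3 y4]]].
  apply: ts => //.
  have st' x z : clamp a' b' x < clamp a' b' z -> x < z.
    by move=> h; rewrite ltNge; apply/negP => /(@clamp_nd a' b'); rewrite leNgt h.
  have h1 := st' _ _ (lt_trans y1 y2); have h2 := st' _ _ (lt_trans y1 y4).
  have h3 := st' _ _ (lt_trans y3 y2); have h4 := st' _ _ (lt_trans y3 y4).
  (* A common point of the original intervals: as the clamped ones overlap, the larger left end lies
     below the smaller right end. *)
  have [q qin] := @rat_in_itvoo _ (Num.max (s i) (s j)) (Num.min (t i) (t j))
    ltac:(by rewrite gt_max !lt_min h1 h2 h3 h4).
  move: qin; rewrite in_itv /= gt_max lt_min => /andP[/andP[q1 q2] /andP[q3 q4]].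
  by exists (ratr q); split; apply/andP.
- apply: le_lt_trans sd; apply: ler_sum => i _ /=; apply: clamp_lip.
  by have [] := st i.
Qed.

Lemma acont_equi_ac a b u : a <= b -> acont a b u -> equi_ac (u \o clamp a b).
Proof.
move=> ab acu e e0; have [d d0 H] := acu e e0; exists d => // l gl ld.
pose z : R * R := (0, 0).
pose s (i : 'I_(size l)) := clamp a b (nth z l i).1.
pose t (i : 'I_(size l)) := clamp a b (nth z l i).2.
have al (i : 'I_(size l)) : (nth z l i).1 <= (nth z l i).2.
  by case/andP: gl => /allP al _; apply: al; exact: mem_nth.
have := H (size l) s t _ _ _; rewrite /total_increment (big_nth z) big_mkord => {}H.
apply: ltW; apply: H.
- move=> i; split.
  + by have /andP[] := clamp_itv (nth z l i).1 ab.
  + exact/clamp_nd/al.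
  + by have /andP[] := clamp_itv (nth z l i).2 ab.
- move=> i j _ _ [y [/= /andP[y1 y2] /andP[y3 y4]]].
  have st' x z' : clamp a b x < clamp a b z' -> x < z'.
    by move=> h; rewrite ltNge; apply/negP => /(@clamp_nd a b); rewrite leNgt h.
  have h1 := st' _ _ (lt_trans y1 y4); have h2 := st' _ _ (lt_trans y3 y2).
  apply: val_inj; case: (ltngtP i j) => //= ij; exfalso.
  + have /andP[_ /(pairwiseP z) /(_ i j)] := gl.
    rewrite !inE => /(_ (ltn_ord i) (ltn_ord j) ij) /orP[]; rewrite leNgt ?h1 ?h2//.
  + have /andP[_ /(pairwiseP z) /(_ j i)] := gl.
    rewrite !inE => /(_ (ltn_ord j) (ltn_ord i) ij) /orP[]; rewrite leNgt ?h1 ?h2//.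
- apply: le_lt_trans ld; rewrite /total_length (big_nth z) big_mkord.
  by apply: ler_sum => i _; exact: clamp_lip.
Qed.

Lemma acont_bounded a b u : a <= b -> acont a b u ->
  exists2 B : R, 0 <= B & forall x, a <= x <= b -> `|u x| <= B.
Proof.
move=> ab acu; have cu := equi_ac_continuous (acont_equi_ac ab acu).
have cu' : {within `[a, b], continuous (fun x => `|(u \o clamp a b) x|)}.
  apply: continuous_subspaceT => x; apply: continuous_comp; first exact: cu.
  exact: norm_continuous.
have [c _ H] := EVT_max ab cu'.
exists (`|(u \o clamp a b) c|) => // x xab.
have := H x; rewrite /= in_itv /= (clamp_id xab) => H'; exact: H'.
Qed.

Lemma acontM a b u v : a <= b -> acont a b u -> acont a b v -> acont a b (u \* v).
Proof.
move=> ab acu acv.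
have [B1 B10 H1] := acont_bounded ab acu; have [B2 B20 H2] := acont_bounded ab acv.
apply: (acont_le (B := B1 + B2) _ acu acv) => x y ax xy yb /=.
have -> : u y * v y - u x * v x = u y * (v y - v x) + v x * (u y - u x) by ring.
apply: le_trans (ler_normD _ _) _; rewrite !normrM.
have {}H1 := H1 y; have {}H2 := H2 x.
have h1 : `|u y| <= B1 by apply: H1; rewrite (le_trans ax xy) yb.
have h2 : `|v x| <= B2 by apply: H2; rewrite ax (le_trans xy yb).
have := normr_ge0 (u y - u x); have := normr_ge0 (v y - v x); nra.
Qed.

Lemma acontV a b u (e : R) : 0 < e -> (forall x, a <= x <= b -> e <= `|u x|) ->
  acont a b u -> acont a b (fun x => (u x)^-1).
Proof.
move=> e0 ue acu.
apply: (acont_le (B := (e ^+ 2)^-1) _ acu acu) => x y ax xy yb.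
have hx : e <= `|u x| by apply: ue; rewrite ax (le_trans xy yb).
have hy : e <= `|u y| by apply: ue; rewrite (le_trans ax xy) yb.
have ux : u x != 0 by rewrite -normr_gt0 (lt_le_trans e0).
have uy : u y != 0 by rewrite -normr_gt0 (lt_le_trans e0).
have -> : (u y)^-1 - (u x)^-1 = - (u y - u x) * (u x * u y)^-1 by field; rewrite ux uy.
rewrite normrM normrN mulrC; apply: ler_pM => //; last by rewrite lerDl.
rewrite normfV normrM lef_pV2 ?posrE ?exprn_gt0 ?mulr_gt0 ?normr_gt0//.
by rewrite expr2; apply: ler_pM => //; exact: ltW.
Qed.

Section density.
Variables (a b : R) (u : R -> R).
Hypotheses (ab : a <= b) (acu : acont a b u).

Let w := u \o clamp a b.
Let acw : equi_ac w. Proof. exact: acont_equi_ac. Qed.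
(** The variation from a, equal to 0 to the left of a. Both V and V - w are monotone and absolutely
    continuous, and w is their difference: a Jordan decomposition within the class. *)
Let V x := fine (total_variation a (Num.max a x) w).

Let wa x : x <= a -> w x = u a.
Proof. by move=> xa; rewrite /w /= clamp_low. Qed.

Let wb x : b <= x -> w x = u b.
Proof. by move=> bx; rewrite /w /= clamp_high. Qed.

Let VB x y : x <= y ->
  V y - V x = fine (total_variation (Num.max a x) (Num.max a y) w).
Proof.
move=> xy; have h1 : a <= Num.max a x by rewrite le_max lexx.
have h2 : Num.max a x <= Num.max a y by rewrite ge_max !le_max lexx xy orbT.
rewrite /V (@total_variationD _ a _ (Num.max a x))// fineD; last 2 first.
- exact: equi_ac_TV_fin.
- exact: equi_ac_TV_fin.
by rewrite addrC addKr.
Qed.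

Let Vw x y : x <= y -> `|w y - w x| <= V y - V x.
Proof.
move=> xy; rewrite VB//.
have h2 : Num.max a x <= Num.max a y by rewrite ge_max !le_max lexx xy orbT.
have e z : w z = w (Num.max a z).
  by case: (leP z a) => [za|//]; rewrite !wa.
rewrite -lee_fin fineK; last exact: equi_ac_TV_fin.
by rewrite (e x) (e y); exact: total_variation_ge.
Qed.

Let Vnd : {homo V : x y / x <= y}.
Proof. by move=> x y xy; rewrite -subr_ge0; apply: le_trans (Vw xy). Qed.

Let Vac : equi_ac V.
Proof.
move=> e e0; have [d d0 H] := acw e0; exists d => // l gl ld.
pose l' := [seq (Num.max a p.1, Num.max a p.2) | p <- l].
have mnd : {homo Num.max a : x y / x <= y}.
  by move=> x y xy; rewrite ge_max !le_max lexx xy orbT.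
have gl' := interval_family_map mnd gl.
have ld' : total_length l' < d.
  apply: le_lt_trans ld; rewrite /total_length big_map big_seq [in leRHS]big_seq.
  apply: ler_sum => p pl /=.
  have pp : p.1 <= p.2 by case/andP: gl => /allP /(_ _ pl).
  by case: (leP a p.1); case: (leP a p.2); lra.
have := equi_ac_total_variation H (l1 := [::]) gl' ld'.
rewrite /total_increment big_nil add0e => {}H.
rewrite -lee_fin; apply: le_trans H.
rewrite big_map -sumEFin big_seq [in leRHS]big_seq; apply: lee_sum => p pl.
have pp : p.1 <= p.2 by case/andP: gl => /allP /(_ _ pl).
rewrite ger0_norm ?subr_ge0 ?Vnd// VB//= fineK//.
by apply: equi_ac_TV_fin => //; exact: mnd.
Qed.

Let Va x : x <= a -> V x = V a.
Proof. by move=> xa; rewrite /V max_l// maxxx. Qed.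

Let Vb x : b <= x -> V x = V b.
Proof.
move=> bx; apply/eqP; rewrite -subr_eq0 VB// !max_r ?(le_trans ab)//.
rewrite nondecreasing_total_variation//=; first by rewrite !wb// subrr.
by move=> y z; rewrite !in_itv/= => /andP[by_ _] /andP[bz _] _; rewrite !wb.
Qed.

Let W := V \- w.

Let Wnd : {homo W : x y / x <= y}.
Proof.
move=> x y xy; rewrite /W /=; have := Vw xy; have := ler_norm (w y - w x); lra.
Qed.

Let Wac : equi_ac W.
Proof.
move=> e e0; have e20 : 0 < e / 2 by lra.
have [d1 d10 H1] := acw e20; have [d2 d20 H2] := Vac e20.
exists (Num.min d1 d2); first by rewrite lt_min d10.
move=> l gl; rewrite lt_min => /andP[h1 h2].
have {}H1 := H1 l gl h1; have {}H2 := H2 l gl h2.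
apply: (@le_trans _ _ (total_increment V l + total_increment w l)); last lra.
rewrite /total_increment -big_split/=; apply: ler_sum => p _.
rewrite /W /=.
have -> : V p.2 - w p.2 - (V p.1 - w p.1) = (V p.2 - V p.1) - (w p.2 - w p.1) by ring.
exact: ler_normB.
Qed.

Lemma acont_density : exists g : R -> R, leb.-integrable setT (EFin \o g) /\
  forall x y, x <= y -> w y - w x = \int[leb]_(t in `]x, y]) g t.
Proof.
have [g1 [ig1 g1E]] := monotone_equi_ac_density Vnd Vac Va Vb.
have [||g2 [ig2 g2E]] := monotone_equi_ac_density (a := a) (b := b) Wnd Wac.
- by move=> x xa; rewrite /W /= Va// !wa.
- by move=> x bx; rewrite /W /= Vb// !wb.
exists (g1 \- g2); split.
  have -> : EFin \o (g1 \- g2) = ((EFin \o g1) \- (EFin \o g2))%E by apply/funext.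
  exact: integrableB.
move=> x y xy; rewrite RintegralB//; last 2 first.
- exact: integrableS ig1.
- exact: integrableS ig2.
by rewrite -g1E// -g2E// /W /=; ring.
Qed.

Lemma acont_derivable_ae_density : exists g : R -> R,
  [/\ leb.-integrable setT (EFin \o g),
      (forall x y, a <= x -> x <= y -> y <= b -> u y - u x = \int[leb]_(t in `[x, y]) g t) &
      {ae leb, forall x, a < x < b -> derivable u x 1 /\ derive1 u x = g x}].
Proof.
have [g [ig gE]] := acont_density; exists g; split => //.
  move=> x y ax xy yb; have := gE _ _ xy.
  rewrite /w /= !clamp_id ?ax ?yb ?(le_trans ax xy) ?(le_trans xy yb)// => ->.
  by rewrite Rintegral_itv_obnd_cbnd//; apply: integrableS ig.
have lg : locally_integrable setT g.
  by apply: open_integrable_locally => //; exact: openT.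
have ig' y : leb.-integrable `]-oo, y] (EFin \o g) by exact: integrableS ig.
(* The indefinite integral of g has derivative g almost everywhere; inside ]a, b[ it has the same
   increments as u, so the difference quotients agree. *)
have := FTC1Ny ig' lg; apply: filterS; first exact: (ae_filter_ringOfSetsType leb).
move=> x [dF Fg] /andP[ax xb].
have {dF Fg} [F [hF dF Fg]] : exists F : R -> R,
    [/\ forall y, a < y -> F y - F a = u y - u a \/ b < y, derivable F x 1 & derive1 F x = g x].
  exists (fun y => \int[leb]_(t in `]-oo, y]) g t); split => // y ay.
  have [yb|] := leP y b; last by right.
  left; have := Rintegral_itvB (ig' y) (x := a) isT; rewrite bnd_simp => /(_ (ltW ay)) ->.
  have := gE _ _ (ltW ay); rewrite /w /= !clamp_id ?lexx ?ab ?(ltW ay)//.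
apply/derivable_quotP => e e0; have /derivable_quotP/(_ e e0)[d d0 Hd] := conj dF Fg.
exists (Num.min d (Num.min (x - a) (b - x))); first by rewrite !lt_min d0 !subr_gt0 ax xb.
move=> h /andP[h0]; rewrite !lt_min => /and3P[hd ha hb].
suff -> : u (h + x) - u x = F (h + x) - F x by apply: Hd; rewrite h0.
move: ha hb; rewrite !ltr_norml => /andP[ha1 ha2] /andP[hb1 hb2].
have [|e1|] := hF (h + x); [lra| |lra].
have [e2|] := hF x ax; [lra|lra].
Qed.

(** The values of [derive1 u] at a and b depend on u outside [a,b], so the endpoints are treated as
    singletons and only the interior is compared with the extension w. *)
Lemma acont_measurable_derive1 : measurable_fun `[a, b] (derive1 u).
Proof.
have cw := equi_ac_continuous acw.
have m1 : measurable_fun `]a, b[ (derive1 u).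
  apply: (@eq_measurable_fun _ _ _ _ _ (derive1 w)).
    move=> x; rewrite inE/= in_itv/= => /andP[ax xb].
    rewrite !derive1E; apply: near_eq_derive; near=> y.
    have ay : a < y by near: y; exact: lt_nbhsr.
    have yb : y < b by near: y; exact: lt_nbhsl.
    by rewrite /w /= clamp_id// !ltW.
  by apply: measurable_funTS; exact: measurable_derive1.
have -> : `[a, b]%classic = [set a] `|` `]a, b[%classic `|` [set b] :> set R.
  apply/seteqP; split => x /=; rewrite !in_itv/=.
    move=> /andP[]; rewrite !le_eqVlt => /orP[/eqP ->|ax]; first by left; left.
    by move=> /orP[/eqP ->|xb]; [right|left; right; apply/andP].
  by case=> [[->|/andP[h1 h2]]|->]; rewrite ?lexx ?ab ?ltW.
apply/measurable_funU => //; first exact: measurableU.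
split; last exact: measurable_fun_set1.
by apply/measurable_funU => //; split => //; exact: measurable_fun_set1.
Unshelve. all: by end_near. Qed.

Lemma acont_derivable_ae : {ae leb, forall x, a < x < b -> derivable u x 1}.
Proof.
have [g [_ _]] := acont_derivable_ae_density.
by apply: filterS; [exact: (ae_filter_ringOfSetsType leb) | move=> x h /h []].
Qed.

Lemma acont_ae_eq : exists g : R -> R,
  [/\ leb.-integrable setT (EFin \o g),
      (forall x y, a <= x -> x <= y -> y <= b -> u y - u x = \int[leb]_(t in `[x, y]) g t) &
      ae_eq leb `[a, b]%classic (EFin \o derive1 u) (EFin \o g)].
Proof.
have [g [h1 h2 h3]] := acont_derivable_ae_density; exists g; split => //.
have na : {ae leb, forall x, x != a}.
  exists [set a]; split => //; first by rewrite lebesgue_measure_set1.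
  by move=> x /= /negP; rewrite negbK => /eqP.
have nb : {ae leb, forall x, x != b}.
  exists [set b]; split => //; first by rewrite lebesgue_measure_set1.
  by move=> x /= /negP; rewrite negbK => /eqP.
apply: filterS3 h3 na nb; first exact: (ae_filter_ringOfSetsType leb).
move=> x hx xa xb; rewrite /= in_itv/= => /andP[ax bx].
by have [|_ ->] := hx; rewrite // !lt_neqAle ax bx eq_sym xa xb.
Qed.

Lemma acont_integrable_derive1 : leb.-integrable `[a, b] (EFin \o derive1 u).
Proof.
have [g [ig gE ge]] := acont_ae_eq.
have mg : measurable_fun `[a, b] (EFin \o g).
  by apply: measurable_funTS; exact: measurable_int ig.
have mu : measurable_fun `[a, b] (EFin \o derive1 u).
  by apply/measurable_EFinP; exact: acont_measurable_derive1.
apply/integrableP; split => //.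
have /integrableP[_] : leb.-integrable `[a, b] (EFin \o g) by exact: integrableS ig.
rewrite (@ae_eq_integral _ _ _ leb `[a, b]%classic (abse \o (EFin \o derive1 u)) (abse \o (EFin \o g)))//.
- exact: measurableT_comp.
- exact: measurableT_comp.
- exact/ae_eq_abse/ae_eq_sym.
Qed.

Lemma acont_FTC x y : a <= x -> x <= y -> y <= b ->
  u y - u x = \int[leb]_(t in `[x, y]) derive1 u t.
Proof.
move=> ax xy yb; have [g [ig gE ge]] := acont_ae_eq.
have sub : `[x, y]%classic `<=` `[a, b]%classic.
  by move=> t /=; rewrite !in_itv/= => /andP[h1 h2]; rewrite (le_trans ax h1) (le_trans h2 yb).
rewrite gE//; rewrite /Rintegral; congr fine; apply: ae_eq_integral => //.
- by apply: measurable_funTS; exact: measurable_int ig.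
- apply/measurable_EFinP; apply: measurable_funS acont_measurable_derive1 => //.
- by apply: filterS ge => t h /sub /h /= ->.
Qed.

End density.

End real_absolute_continuity.

(** * Square integrable complex functions *)

Section complex_square_integrable.
Context d (T : measurableType d) (R : realType) (mu : {measure set T -> \bar R}).
Variables (D : set T) (mD : measurable D).
Local Notation C := R[i].
Local Notation normc := (@ComplexField.Normc.normc R).
Implicit Types (u v : T -> R) (F G : T -> C).

Lemma square_integrable_mul u v : measurable_fun D u -> measurable_fun D v ->
  mu.-integrable D (fun x => (u x ^+ 2)%:E) -> mu.-integrable D (fun x => (v x ^+ 2)%:E) ->
  mu.-integrable D (fun x => (u x * v x)%:E).
Proof.
move=> mu' mv iu iv; apply: (le_integrable mD _ _ (integrableD mD iu iv)).
  by apply/measurable_EFinP; exact: measurable_funM.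
move=> x _ /=; rewrite lee_fin normrM [leRHS]ger0_norm ?addr_ge0 ?sqr_ge0//.
rewrite -(real_normK (num_real (u x))) -(real_normK (num_real (v x))).
have := sqr_ge0 (`|u x| - `|v x|); have := sqr_ge0 (`|u x| + `|v x|); nra.
Qed.

Lemma square_integrable_CS u v : measurable_fun D u -> measurable_fun D v ->
  mu.-integrable D (fun x => (u x ^+ 2)%:E) -> mu.-integrable D (fun x => (v x ^+ 2)%:E) ->
  (\int[mu]_(x in D) (u x * v x)) ^+ 2 <=
  (\int[mu]_(x in D) (u x ^+ 2)) * \int[mu]_(x in D) (v x ^+ 2).
Proof.
move=> mu' mv iu iv; have iuv := square_integrable_mul mu' mv iu iv.
set A := \int[mu]_(x in D) (u x ^+ 2); set B := \int[mu]_(x in D) (u x * v x).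
set V := \int[mu]_(x in D) (v x ^+ 2).
have V0 : 0 <= V by apply: Rintegral_ge0 => x _; exact: sqr_ge0.
have A0 : 0 <= A by apply: Rintegral_ge0 => x _; exact: sqr_ge0.
have H t : 0 <= A - 2 * t * B + t ^+ 2 * V.
  have : 0 <= \int[mu]_(x in D) ((u x - t * v x) ^+ 2).
    by apply: Rintegral_ge0 => x _; exact: sqr_ge0.
  have -> : (fun x => (u x - t * v x) ^+ 2) =
      (fun x => u x ^+ 2 + (- 2 * t) * (u x * v x) + t ^+ 2 * v x ^+ 2).
    by apply/funext => x; ring.
  have i2 : mu.-integrable D (fun x => ((- 2 * t) * (u x * v x))%:E).
    exact: (integrableZl mD (- 2 * t) iuv).
  have i3 : mu.-integrable D (fun x => (t ^+ 2 * v x ^+ 2)%:E).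
    exact: (integrableZl mD (t ^+ 2) iv).
  rewrite RintegralD//; last exact: (integrableD mD iu i2).
  rewrite RintegralD// RintegralZl// RintegralZl//.
  by rewrite -/A -/B -/V; lra.
have [V00|V1] := eqVneq V 0.
  have B0 : B = 0.
    apply/eqP; apply/negPn/negP => B0.
    (* With V = 0 the quadratic expression is affine in t, and at this t it equals -1. *)
    have := H ((A + 1) / (2 * B)); rewrite V00 mulr0 addr0.
    have -> : 2 * ((A + 1) / (2 * B)) * B = A + 1 by field.
    lra.
  by rewrite B0 expr0n /= V00 mulr0.
have Vp : 0 < V by rewrite lt_neqAle eq_sym V1.
have := H (B / V).
have -> : A - 2 * (B / V) * B + (B / V) ^+ 2 * V = (A * V - B ^+ 2) / V by field.
by rewrite pmulr_lge0 ?invr_gt0// subr_ge0.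
Qed.

Lemma normc_sqr (z : C) : normc z ^+ 2 = complex.Re z ^+ 2 + complex.Im z ^+ 2.
Proof. by case: z => x y /=; rewrite sqr_sqrtr// addr_ge0// sqr_ge0. Qed.

Lemma normc_ge0 (z : C) : 0 <= normc z.
Proof. by case: z => x y /=; exact: sqrtr_ge0. Qed.

Lemma Re_le_normc (z : C) : `|complex.Re z| <= normc z.
Proof.
rewrite -(@ler_pXn2r _ 2) ?nnegrE ?normc_ge0// normc_sqr real_normK ?num_real//.
by rewrite lerDl sqr_ge0.
Qed.

Lemma Im_le_normc (z : C) : `|complex.Im z| <= normc z.
Proof.
rewrite -(@ler_pXn2r _ 2) ?nnegrE ?normc_ge0// normc_sqr real_normK ?num_real//.
by rewrite lerDr sqr_ge0.
Qed.

Lemma normc_le_ReIm (z : C) : normc z <= `|complex.Re z| + `|complex.Im z|.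
Proof.
rewrite -(@ler_pXn2r _ 2) ?nnegrE ?normc_ge0 ?addr_ge0// normc_sqr.
rewrite -(real_normK (num_real (complex.Re z))) -(real_normK (num_real (complex.Im z))).
have := normr_ge0 (complex.Re z); have := normr_ge0 (complex.Im z); nra.
Qed.

Definition cmeasurable F :=
  measurable_fun D (fun x => complex.Re (F x)) /\ measurable_fun D (fun x => complex.Im (F x)).

Definition cintegrable F :=
  mu.-integrable D (fun x => (complex.Re (F x))%:E) /\
  mu.-integrable D (fun x => (complex.Im (F x))%:E).

Definition L2 F := cmeasurable F /\ (\int[mu]_(x in D) (normc (F x) ^+ 2)%:E < +oo)%E.

Definition sqnorm F := \int[mu]_(x in D) (normc (F x) ^+ 2).

Lemma cmeasurable_normc F : cmeasurable F -> measurable_fun D (fun x => normc (F x)).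
Proof.
move=> [m1 m2].
have -> : (fun x => normc (F x)) = (fun x => Num.sqrt (complex.Re (F x) ^+ 2 + complex.Im (F x) ^+ 2)).
  by apply/funext => x; case: (F x).
apply: (@measurableT_comp _ _ _ _ _ _ (@Num.sqrt R)).
  by apply: continuous_measurable_fun; exact: sqrt_continuous.
by apply: measurable_funD; apply: measurable_funX.
Qed.

Lemma cmeasurableD F G : cmeasurable F -> cmeasurable G -> cmeasurable (fun x => F x + G x).
Proof.
move=> [m1 m2] [m3 m4]; split.
  rewrite (_ : (fun x => _) = (fun x => complex.Re (F x) + complex.Re (G x))); first exact: measurable_funD.
  by apply/funext => x; case: (F x); case: (G x).
rewrite (_ : (fun x => _) = (fun x => complex.Im (F x) + complex.Im (G x))); first exact: measurable_funD.
by apply/funext => x; case: (F x); case: (G x).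
Qed.

Lemma cmeasurableM F G : cmeasurable F -> cmeasurable G -> cmeasurable (fun x => F x * G x).
Proof.
move=> [m1 m2] [m3 m4]; split.
  rewrite (_ : (fun x => _) = (fun x => complex.Re (F x) * complex.Re (G x) - complex.Im (F x) * complex.Im (G x))).
    apply: measurable_funB; exact: measurable_funM.
  by apply/funext => x; case: (F x); case: (G x).
rewrite (_ : (fun x => _) = (fun x => complex.Re (F x) * complex.Im (G x) + complex.Im (F x) * complex.Re (G x))).
  apply: measurable_funD; exact: measurable_funM.
by apply/funext => x; case: (F x); case: (G x).
Qed.

Lemma cmeasurable_cst (z : C) : cmeasurable (fun _ => z).
Proof. by split; exact: measurable_cst. Qed.

Lemma cmeasurable_conj F : cmeasurable F -> cmeasurable (fun x => (F x)^*%C).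
Proof.
move=> [m1 m2]; split.
  by rewrite (_ : (fun x => _) = (fun x => complex.Re (F x)))//; apply/funext => x; case: (F x).
rewrite (_ : (fun x => _) = (fun x => - complex.Im (F x))); first exact: measurableT_comp.
by apply/funext => x; case: (F x).
Qed.

Lemma normcM (x y : C) : normc (x * y) = normc x * normc y.
Proof. exact: ComplexField.Normc.normcM. Qed.

Lemma normcD (x y : C) : normc (x + y) <= normc x + normc y.
Proof. exact: le_normcD. Qed.

Lemma normcD_sqr (x y : C) : normc (x + y) ^+ 2 <= 2 * (normc x ^+ 2 + normc y ^+ 2).
Proof.
have := normcD x y; have := normc_ge0 (x + y); have := normc_ge0 x; have := normc_ge0 y.
have := sqr_ge0 (normc x - normc y); nra.
Qed.

Lemma L2_sqr_integrable F : L2 F -> mu.-integrable D (fun x => (normc (F x) ^+ 2)%:E).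
Proof.
move=> [mF iF]; apply/integrableP; split.
  by apply/measurable_EFinP; apply: measurable_funX; exact: cmeasurable_normc.
under eq_integral do rewrite gee0_abs ?lee_fin ?sqr_ge0//.
exact: iF.
Qed.

Lemma L2_Re F : L2 F -> mu.-integrable D (fun x => (complex.Re (F x) ^+ 2)%:E).
Proof.
move=> LF; apply: (le_integrable mD _ _ (L2_sqr_integrable LF)).
  by apply/measurable_EFinP; apply: measurable_funX; exact: LF.1.1.
move=> x _ /=; rewrite lee_fin normc_sqr !ger0_norm ?addr_ge0 ?sqr_ge0//.
by rewrite lerDl sqr_ge0.
Qed.

Lemma L2_Im F : L2 F -> mu.-integrable D (fun x => (complex.Im (F x) ^+ 2)%:E).
Proof.
move=> LF; apply: (le_integrable mD _ _ (L2_sqr_integrable LF)).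
  by apply/measurable_EFinP; apply: measurable_funX; exact: LF.1.2.
move=> x _ /=; rewrite lee_fin normc_sqr !ger0_norm ?addr_ge0 ?sqr_ge0//.
by rewrite lerDr sqr_ge0.
Qed.

Lemma sqnorm_ge0 F : 0 <= sqnorm F.
Proof. by apply: Rintegral_ge0 => x _; exact: sqr_ge0. Qed.

Lemma sqnormE F : L2 F -> sqnorm F =
  \int[mu]_(x in D) (complex.Re (F x) ^+ 2) + \int[mu]_(x in D) (complex.Im (F x) ^+ 2).
Proof.
move=> LF; rewrite -RintegralD//; [|exact: L2_Re|exact: L2_Im].
by apply: eq_Rintegral => x _; rewrite normc_sqr.
Qed.

Lemma L2_le F G (B : R) : cmeasurable F -> L2 G ->
  (forall x, D x -> normc (F x) ^+ 2 <= B * normc (G x) ^+ 2) ->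
  L2 F /\ sqnorm F <= B * sqnorm G.
Proof.
move=> mF LG FG; have iG := L2_sqr_integrable LG.
have iBG : mu.-integrable D (fun x => (B * normc (G x) ^+ 2)%:E).
  exact: (integrableZl mD B iG).
have iF : mu.-integrable D (fun x => (normc (F x) ^+ 2)%:E).
  apply: (le_integrable mD _ _ iBG).
    by apply/measurable_EFinP; apply: measurable_funX; exact: cmeasurable_normc.
  move=> x Dx /=; rewrite lee_fin (ger0_norm (sqr_ge0 _)).
  by apply: le_trans (FG x Dx) _; exact: ler_norm.
split.
  split => //; move/integrableP: iF => [_].
  by under eq_integral do rewrite gee0_abs ?lee_fin ?sqr_ge0//.
by rewrite /sqnorm -RintegralZl//; apply: le_Rintegral.
Qed.

Lemma L2D F G : L2 F -> L2 G -> L2 (fun x => F x + G x).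
Proof.
move=> LF LG; have mFG := cmeasurableD LF.1 LG.1; split => //.
have iF := L2_sqr_integrable LF; have iG := L2_sqr_integrable LG.
have i : mu.-integrable D (fun x => (2 * (normc (F x) ^+ 2 + normc (G x) ^+ 2))%:E).
  exact: (integrableZl mD 2 (integrableD mD iF iG)).
have : mu.-integrable D (fun x => (normc (F x + G x) ^+ 2)%:E).
  apply: (le_integrable mD _ _ i).
    by apply/measurable_EFinP; apply: measurable_funX; exact: cmeasurable_normc.
  move=> x Dx /=; rewrite lee_fin (ger0_norm (sqr_ge0 _)).
  by apply: le_trans (normcD_sqr _ _) _; exact: ler_norm.
move/integrableP => [_].
by under eq_integral do rewrite gee0_abs ?lee_fin ?sqr_ge0//.
Qed.

Lemma sqnormD F G : L2 F -> L2 G ->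
  sqnorm (fun x => F x + G x) <= 2 * (sqnorm F + sqnorm G).
Proof.
move=> LF LG; have iF := L2_sqr_integrable LF; have iG := L2_sqr_integrable LG.
have iFG := L2_sqr_integrable (L2D LF LG).
have i : mu.-integrable D (fun x => (normc (F x) ^+ 2 + normc (G x) ^+ 2)%:E).
  exact: (integrableD mD iF iG).
have i2 : mu.-integrable D (fun x => (2 * (normc (F x) ^+ 2 + normc (G x) ^+ 2))%:E).
  exact: (integrableZl mD 2 i).
rewrite /sqnorm -RintegralD// -RintegralZl//.
by apply: le_Rintegral => // x _; exact: normcD_sqr.
Qed.

Lemma L2_bounded_mul F G (B : R) : cmeasurable F -> (forall x, D x -> normc (F x) <= B) ->
  L2 G -> L2 (fun x => F x * G x) /\ sqnorm (fun x => F x * G x) <= B ^+ 2 * sqnorm G.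
Proof.
move=> mF FB LG; apply: L2_le => //; first exact: cmeasurableM LG.1.
move=> x Dx; rewrite normcM exprMn; apply: ler_wpM2r; first exact: sqr_ge0.
by have := FB x Dx; have := normc_ge0 (F x); nra.
Qed.

Lemma L2Z (z : C) F : L2 F -> L2 (fun x => z * F x).
Proof.
move=> LF; by have [] := @L2_bounded_mul (fun=> z) F (normc z) (cmeasurable_cst z) _ LF.
Qed.

Lemma sqnormZ (z : C) F : L2 F -> sqnorm (fun x => z * F x) = normc z ^+ 2 * sqnorm F.
Proof.
move=> LF; rewrite /sqnorm -RintegralZl//; last exact: L2_sqr_integrable.
by apply: eq_Rintegral => x _; rewrite normcM exprMn.
Qed.

Lemma normcJ (z : C) : normc (z^*%C) = normc z.
Proof. by case: z => x y /=; rewrite sqrrN. Qed.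

Lemma L2_conj F : L2 F -> L2 (fun x => (F x)^*%C).
Proof.
move=> [mF iF]; split; first exact: cmeasurable_conj.
by under eq_integral do rewrite normcJ.
Qed.

Lemma L2_mul F G : L2 F -> L2 G -> cintegrable (fun x => F x * G x).
Proof.
move=> LF LG.
have i1 := square_integrable_mul LF.1.1 LG.1.1 (L2_Re LF) (L2_Re LG).
have i2 := square_integrable_mul LF.1.2 LG.1.2 (L2_Im LF) (L2_Im LG).
have i3 := square_integrable_mul LF.1.1 LG.1.2 (L2_Re LF) (L2_Im LG).
have i4 := square_integrable_mul LF.1.2 LG.1.1 (L2_Im LF) (L2_Re LG).
split.
  have := integrableB mD i1 i2; congr (integrable _ _).
  by apply/funext => x; case: (F x); case: (G x).
have := integrableD mD i3 i4; congr (integrable _ _).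
by apply/funext => x; case: (F x); case: (G x).
Qed.

(** The factor 2 comes from bounding real and imaginary part separately. It is used only where
    constants do not matter; the sharp estimate is [H1loc_increment]. *)
Lemma L2_CS F G : L2 F -> L2 G ->
  normc (cintegral mu D (fun x => F x * G x)) <=
  2 * (Num.sqrt (sqnorm F) * Num.sqrt (sqnorm G)).
Proof.
move=> LF LG; have [i1 i2] := L2_mul LF LG.
have mF := cmeasurable_normc LF.1; have mG := cmeasurable_normc LG.1.
have iF := L2_sqr_integrable LF; have iG := L2_sqr_integrable LG.
have iFG := square_integrable_mul mF mG iF iG.
have K : \int[mu]_(x in D) (normc (F x) * normc (G x)) <= Num.sqrt (sqnorm F) * Num.sqrt (sqnorm G).
  rewrite -sqrtrM ?sqnorm_ge0//.
  apply: le_trans (ler_norm _) _; rewrite -sqrtr_sqr; apply: ler_wsqrtr.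
  exact: square_integrable_CS.
apply: le_trans (normc_le_ReIm _) _ => /=.
rewrite mulr2n mulrDl mul1r; apply: lerD; apply: le_trans K.
- apply: le_trans (le_normr_Rintegral _ _) _ => //.
  apply: le_Rintegral => //; first exact: (integrable_norm i1).
  by move=> x _ /=; rewrite -normcM; exact: Re_le_normc.
- apply: le_trans (le_normr_Rintegral _ _) _ => //.
  apply: le_Rintegral => //; first exact: (integrable_norm i2).
  by move=> x _ /=; rewrite -normcM; exact: Im_le_normc.
Qed.

Lemma eq_cintegral F G : (forall x, D x -> F x = G x) -> cintegral mu D F = cintegral mu D G.
Proof.
by move=> FG; rewrite /cintegral; congr (_ +i* _); apply: eq_Rintegral => x; rewrite inE => /FG ->.
Qed.

Lemma cintegralZ (z : C) F : cintegrable F ->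
  cintegral mu D (fun x => z * F x) = z * cintegral mu D F.
Proof.
move=> [f1 f2]; case: z => a b; rewrite /cintegral /=.
apply/eqP; rewrite eq_complex /=; apply/andP; split; apply/eqP.
  rewrite -RintegralZl// -RintegralZl// -RintegralB//.
  - by apply: eq_Rintegral => x _; case: (F x).
  - exact: (integrableZl mD a f1).
  - exact: (integrableZl mD b f2).
rewrite -RintegralZl// -RintegralZl// -RintegralD//.
- by apply: eq_Rintegral => x _; case: (F x).
- exact: (integrableZl mD a f2).
- exact: (integrableZl mD b f1).
Qed.

End complex_square_integrable.

(** * The spaces H^1 *)

Section H1_functions.
Variable R : realType.
Local Notation C := R[i].
Local Notation normc := (@ComplexField.Normc.normc R).
Local Notation leb := (@lebesgue_measure R).
Local Notation Re := (@complex.Re R).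
Local Notation Im := (@complex.Im R).
Implicit Types (f g h : R -> C) (L : \bar R) (a b c x y : R) (z : C).

Definition cacont a b f := acont a b (fun x => Re (f x)) /\ acont a b (fun x => Im (f x)).

Lemma abs_continuousP a b f : abs_continuous a b f <-> cacont a b f.
Proof.
split=> [H|[H1 H2]].
  split => e e0; have [d d0 Hd] := H e e0; exists d => // n s t st ts sd;
    apply: le_lt_trans (Hd n s t st ts sd); apply: ler_sum => i _.
    by case: (f (t i)) => ? ?; case: (f (s i)) => ? ?; exact: (Re_le_normc (_ +i* _)).
  by case: (f (t i)) => ? ?; case: (f (s i)) => ? ?; exact: (Im_le_normc (_ +i* _)).
move=> e e0; have e20 : 0 < e / 2 by rewrite divr_gt0.
have [d1 d10 Hd1] := H1 _ e20; have [d2 d20 Hd2] := H2 _ e20.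
exists (Num.min d1 d2); first by rewrite lt_min d10.
move=> n s t st ts; rewrite lt_min => /andP[sd1 sd2].
have := ltrD (Hd1 n s t st ts sd1) (Hd2 n s t st ts sd2).
rewrite -splitr; apply: le_lt_trans; rewrite -big_split/=; apply: ler_sum => i _.
by case: (f (t i)) => ? ?; case: (f (s i)) => ? ?; exact: (normc_le_ReIm (_ +i* _)).
Qed.

Definition cdiff f x := derivable (fun t => Re (f t)) x 1 /\ derivable (fun t => Im (f t)) x 1.

Lemma derive1D' (u v : R -> R) x : derivable u x 1 -> derivable v x 1 ->
  derive1 (fun t => u t + v t) x = derive1 u x + derive1 v x.
Proof. by move=> du dv; rewrite !derive1E; exact: (deriveD du dv). Qed.

Lemma derive1M' (u v : R -> R) x : derivable u x 1 -> derivable v x 1 ->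
  derive1 (fun t => u t * v t) x = derive1 u x * v x + u x * derive1 v x.
Proof.
move=> du dv; rewrite !derive1E [LHS](deriveM du dv) addrC; congr (_ + _).
exact: mulrC.
Qed.

Lemma derivableM' (u v : R -> R) x : derivable u x 1 -> derivable v x 1 ->
  derivable (fun t => u t * v t) x 1.
Proof. exact: derivableM. Qed.

Lemma derivableN' (u : R -> R) x : derivable u x 1 -> derivable (fun t => - u t) x 1.
Proof. exact: derivableN. Qed.

Lemma ae_leb_imp (P Q : R -> Prop) : (forall x, P x -> Q x) ->
  {ae leb, forall x, P x} -> {ae leb, forall x, Q x}.
Proof. by move=> PQ; apply: filterS; [exact: (ae_filter_ringOfSetsType leb) | exact: PQ]. Qed.

Lemma ae_leb_imp2 (P1 P2 Q : R -> Prop) : (forall x, P1 x -> P2 x -> Q x) ->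
  {ae leb, forall x, P1 x} -> {ae leb, forall x, P2 x} -> {ae leb, forall x, Q x}.
Proof. by move=> PQ; apply: filterS2; [exact: (ae_filter_ringOfSetsType leb) | exact: PQ]. Qed.

Lemma ae_leb_neq a : {ae leb, forall x, x != a}.
Proof.
exists [set a]; split => //; first by rewrite lebesgue_measure_set1.
by move=> x /= /negP; rewrite negbK => /eqP.
Qed.

Lemma derive1N' (u : R -> R) x : derivable u x 1 ->
  derive1 (fun t => - u t) x = - derive1 u x.
Proof. by move=> du; rewrite !derive1E; exact: (deriveN du). Qed.

Lemma cderiv_near f g x : (\near x, f x = g x) -> cderiv f x = cderiv g x.
Proof.
by move=> fg; rewrite /cderiv !derive1E; congr (_ +i* _); apply: near_eq_derive;
  apply: filterS fg => t ->.
Qed.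

Lemma cderiv_eq_oo f g a b x : (forall t, a < t < b -> f t = g t) -> a < x < b ->
  cderiv f x = cderiv g x.
Proof.
move=> fg /andP[ax xb]; apply: cderiv_near; near=> t; apply: fg; apply/andP; split.
  by near: t; exact: lt_nbhsr.
by near: t; exact: lt_nbhsl.
Unshelve. all: by end_near. Qed.

Lemma cderiv_cst z x : cderiv (fun=> z) x = 0.
Proof. by rewrite /cderiv !derive1E !derive_cst. Qed.

Lemma cdiff_cst z x : cdiff (fun=> z) x.
Proof. by split; exact: derivable_cst. Qed.

Lemma cderivD f g x : cdiff f x -> cdiff g x ->
  cderiv (fun t => f t + g t) x = cderiv f x + cderiv g x.
Proof.
move=> [f1 f2] [g1 g2]; rewrite /cderiv.
have -> : (fun t => Re (f t + g t)) = (fun t => Re (f t) + Re (g t)).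
  by apply/funext => t; case: (f t); case: (g t).
have -> : (fun t => Im (f t + g t)) = (fun t => Im (f t) + Im (g t)).
  by apply/funext => t; case: (f t); case: (g t).
by rewrite (derive1D' f1 g1) (derive1D' f2 g2).
Qed.

Lemma cderivM f g x : cdiff f x -> cdiff g x ->
  cderiv (fun t => f t * g t) x = cderiv f x * g x + f x * cderiv g x.
Proof.
move=> [f1 f2] [g1 g2]; rewrite /cderiv.
have -> : (fun t => Re (f t * g t)) = (fun t => Re (f t) * Re (g t) + - (Im (f t) * Im (g t))).
  by apply/funext => t; case: (f t); case: (g t).
have -> : (fun t => Im (f t * g t)) = (fun t => Re (f t) * Im (g t) + Im (f t) * Re (g t)).
  by apply/funext => t; case: (f t); case: (g t).
rewrite (derive1D' (derivableM' f1 g1) (derivableN' (derivableM' f2 g2))).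
rewrite (derive1N' (derivableM' f2 g2)) (derive1D' (derivableM' f1 g2) (derivableM' f2 g1)).
rewrite (derive1M' f1 g1) (derive1M' f1 g2) (derive1M' f2 g1) (derive1M' f2 g2).
move: (derive1 _ x) (derive1 _ x) (derive1 _ x) (derive1 _ x) => p q r s.
case: (f x) => f1' f2'; case: (g x) => g1' g2' /=.
by apply/eqP; rewrite eq_complex /=; apply/andP; split; apply/eqP; ring.
Qed.

Lemma cderivJ f x : cdiff f x -> cderiv (fun t => (f t)^*%C) x = (cderiv f x)^*%C.
Proof.
move=> [f1 f2]; rewrite /cderiv.
have -> : (fun t => Re ((f t)^*%C)) = (fun t => Re (f t)).
  by apply/funext => t; case: (f t).
have -> : (fun t => Im ((f t)^*%C)) = (fun t => - Im (f t)).
  by apply/funext => t; case: (f t).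
by rewrite (derive1N' f2).
Qed.

Lemma cnormN z : normc (- z) = normc z.
Proof. by case: z => x y /=; rewrite !sqrrN. Qed.

Lemma leb_itvcc a b : a <= b -> leb `[a, b]%classic = (b - a)%:E.
Proof.
by move=> ab; rewrite lebesgue_measure_itv/= lte_fin; case: ltgtP ab => // ->; rewrite subrr.
Qed.

Lemma ae_open_closed (P : R -> Prop) a b :
  {ae leb, forall x, a < x < b -> P x} -> {ae leb, forall x, `[a, b]%classic x -> P x}.
Proof.
move=> h; apply: (ae_leb_imp2 _ h (ae_leb_imp2 _ (ae_leb_neq a) (ae_leb_neq b))); last first.
  by move=> x xa xb; exact: (conj xa xb).
move=> x hx [xa xb]; rewrite /= in_itv/= => /andP[ax bx].
by apply: hx; rewrite // !lt_neqAle ax bx eq_sym xa xb.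
Qed.

Section local_theory.
Variables (L : \bar R).
Local Notation dom := (halfopen L).

Lemma dom0 c : dom c -> 0 <= c. Proof. by case. Qed.

Lemma domS a c : dom c -> 0 <= a -> a <= c -> dom a.
Proof. by move=> [c0 cL] a0 ac; split => //; apply: le_lt_trans cL; rewrite lee_fin. Qed.

Lemma H1loc_acont f c : H1loc L f -> dom c -> cacont 0 c f.
Proof. by move=> Hf cL; apply/abs_continuousP; have [] := Hf c (mem_set cL). Qed.

Lemma cacont_cmeasurable_cderiv f c : 0 <= c -> cacont 0 c f ->
  cmeasurable `[0, c]%classic (cderiv f).
Proof. by move=> c0 [a1 a2]; split; exact: acont_measurable_derive1. Qed.

Lemma cacont_ae_cdiff f c : 0 <= c -> cacont 0 c f ->
  {ae leb, forall x, 0 < x < c -> cdiff f x}.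
Proof.
move=> c0 [a1 a2]; have h1 := acont_derivable_ae c0 a1; have h2 := acont_derivable_ae c0 a2.
apply: (ae_leb_imp2 _ h1 h2).
by move=> x {}h1 {}h2 xc; split; [exact: h1|exact: h2].
Qed.

Lemma H1loc_L2 f c : H1loc L f -> dom c -> L2 leb `[0, c]%classic (cderiv f).
Proof.
move=> Hf cL; split; last by have [] := Hf c (mem_set cL).
by apply: cacont_cmeasurable_cderiv; [exact: dom0|exact: H1loc_acont].
Qed.

Lemma H1loc_cdiff f c : H1loc L f -> dom c -> {ae leb, forall x, 0 < x < c -> cdiff f x}.
Proof. by move=> Hf cL; apply: cacont_ae_cdiff; [exact: dom0|exact: H1loc_acont]. Qed.

Lemma L2_ae_eq (D : set R) (F G : R -> C) : measurable D -> cmeasurable D F -> L2 leb D G ->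
  {ae leb, forall x, D x -> F x = G x} -> L2 leb D F /\ sqnorm leb D F = sqnorm leb D G.
Proof.
move=> mD mF [mG iG] FG.
have e : (\int[leb]_(x in D) (normc (F x) ^+ 2)%:E = \int[leb]_(x in D) (normc (G x) ^+ 2)%:E)%E.
  apply: ae_eq_integral => //.
  - by apply/measurable_EFinP; apply: measurable_funX; exact: cmeasurable_normc.
  - by apply/measurable_EFinP; apply: measurable_funX; exact: cmeasurable_normc.
  - by apply: ae_leb_imp FG => x h Dx; rewrite h.
by split; [split; rewrite ?e | rewrite /sqnorm /Rintegral e].
Qed.

(** The closure properties of [H1loc] reduce to naming an L^2 function that the derivative equals
    almost everywhere. Differentiability may be assumed in that comparison, as absolute continuity
    supplies it almost everywhere. *)
Lemma H1loc_intro f :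
  (forall c, dom c -> cacont 0 c f /\ exists G : R -> C, L2 leb `[0, c]%classic G /\
     {ae leb, forall x, 0 < x < c -> cdiff f x -> cderiv f x = G x}) -> H1loc L f.
Proof.
move=> H c; rewrite inE => cL; have [ac [G [LG fG]]] := H c cL.
split; first exact/abs_continuousP.
have c0 := dom0 cL.
suff [[_ //]] : L2 leb `[0, c]%classic (cderiv f) /\ sqnorm leb `[0, c]%classic (cderiv f) = sqnorm leb `[0, c]%classic G.
apply: L2_ae_eq => //; first exact: cacont_cmeasurable_cderiv.
apply: ae_open_closed; have h := cacont_ae_cdiff c0 ac.
apply: (ae_leb_imp2 _ fG h).
by move=> x h1 h2 xc; apply: h1 => //; exact: h2.
Qed.

Opaque H1loc.

Lemma cacont_bounded a b f : a <= b -> cacont a b f ->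
  exists2 B : R, 0 <= B & forall x, a <= x <= b -> normc (f x) <= B.
Proof.
move=> ab [a1 a2]; have [B1 B10 H1] := acont_bounded ab a1; have [B2 B20 H2] := acont_bounded ab a2.
exists (B1 + B2) => [|x xab]; first exact: addr_ge0.
by apply: le_trans (normc_le_ReIm _) _; apply: lerD; [exact: H1|exact: H2].
Qed.

Lemma cacont_cmeasurable c f : 0 <= c -> cacont 0 c f ->
  cmeasurable (`[0, c]%classic : set (measurableTypeR R)) f.
Proof.
have H (u : R -> R) : 0 <= c -> acont 0 c u -> measurable_fun `[0, c]%classic u.
  move=> c0 ac; have cw := equi_ac_continuous (acont_equi_ac c0 ac).
  apply: (@eq_measurable_fun _ _ _ _ _ (u \o clamp 0 c)).
    by move=> x; rewrite inE/= in_itv/= => xc; rewrite clamp_id.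
  by apply: measurable_funTS; exact: continuous_measurable_fun.
by move=> c0 [a1 a2]; split; exact: H.
Qed.

Lemma H1loc_bounded f c : H1loc L f -> dom c ->
  exists2 B : R, 0 <= B & forall x, 0 <= x <= c -> normc (f x) <= B.
Proof. by move=> Hf cL; apply: cacont_bounded; [exact: dom0|exact: H1loc_acont]. Qed.

Lemma H1loc_cmeasurable f c : H1loc L f -> dom c ->
  cmeasurable (`[0, c]%classic : set (measurableTypeR R)) f.
Proof. by move=> Hf cL; apply: cacont_cmeasurable; [exact: dom0|exact: H1loc_acont]. Qed.

Lemma acont_cst a b (r : R) : acont a b (fun=> r).
Proof.
apply: (@acont_lipschitz _ _ _ _ 0) => x y _ _ _; by rewrite subrr normr0 mul0r.
Qed.

Lemma acontD a b (u v : R -> R) : acont a b u -> acont a b v -> acont a b (fun x => u x + v x).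
Proof.
move=> au av; apply: (acont_le (B := 1) _ au av) => x y _ _ _; rewrite mul1r.
by rewrite opprD addrACA; exact: ler_normD.
Qed.

Lemma acontN a b (u : R -> R) : acont a b u -> acont a b (fun x => - u x).
Proof.
move=> au; apply: (acont_le (B := 1) _ au au) => x y _ _ _; rewrite mul1r.
by rewrite -opprD normrN lerDl.
Qed.

Lemma cacontD a b f g : cacont a b f -> cacont a b g -> cacont a b (fun x => f x + g x).
Proof.
move=> [f1 f2] [g1 g2]; split.
  have := acontD f1 g1; congr (acont _ _); apply/funext => t /=; by case: (f t); case: (g t).
have := acontD f2 g2; congr (acont _ _); apply/funext => t /=; by case: (f t); case: (g t).
Qed.

Lemma cacontM a b f g : a <= b -> cacont a b f -> cacont a b g -> cacont a b (fun x => f x * g x).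
Proof.
move=> ab [f1 f2] [g1 g2]; split.
  have := acontD (acontM ab f1 g1) (acontN (acontM ab f2 g2)).
  congr (acont _ _); apply/funext => t /=; by case: (f t); case: (g t).
have := acontD (acontM ab f1 g2) (acontM ab f2 g1).
by congr (acont _ _); apply/funext => t /=; case: (f t); case: (g t).
Qed.

Lemma cacont_cst a b z : cacont a b (fun=> z).
Proof. by split; exact: acont_cst. Qed.

Lemma L2_zero (D : set R) : measurable D -> L2 leb D (fun=> 0 : C).
Proof.
move=> mD; split; first exact: cmeasurable_cst.
under eq_integral do rewrite ComplexField.Normc.normc0 expr0n /=.
by rewrite integral0 ltry.
Qed.

Lemma H1loc_cst z : H1loc L (fun=> z).
Proof.
apply: H1loc_intro => c cL; split; first exact: cacont_cst.
exists (fun=> 0); split; first exact: L2_zero.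
by apply: aeW => x _ _; rewrite cderiv_cst.
Qed.

Lemma H1loc_id : H1loc L (fun x => x%:C).
Proof.
apply: H1loc_intro => c cL; split.
  by split; [exact: acont_id|exact: acont_cst].
exists (fun=> 1); split.
  split; first exact: cmeasurable_cst.
  under eq_integral do rewrite ComplexField.Normc.normc1 expr1n.
  have h : (leb `[0%R, c]%classic < +oo)%E by rewrite lebesgue_measure_itv/=; case: ifP; rewrite ?ltry.
  by rewrite integral_cst// mul1e.
by apply: aeW => x _ _; rewrite /cderiv !derive1E derive_cst derive_id.
Qed.

Lemma H1locD f g : H1loc L f -> H1loc L g -> H1loc L (fun x => f x + g x).
Proof.
move=> Hf Hg; apply: H1loc_intro => c cL; split.
  by apply: cacontD; exact: H1loc_acont.
exists (fun x => cderiv f x + cderiv g x); split.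
  by apply: L2D => //; exact: H1loc_L2.
apply: (ae_leb_imp2 _ (H1loc_cdiff Hf cL) (H1loc_cdiff Hg cL)).
by move=> x df dg xc _; rewrite cderivD//; [exact: df|exact: dg].
Qed.

Lemma H1locM f g : H1loc L f -> H1loc L g -> H1loc L (fun x => f x * g x).
Proof.
move=> Hf Hg; apply: H1loc_intro => c cL; split.
  by apply: cacontM; [exact: dom0|exact: H1loc_acont..].
have [Bf _ fB] := H1loc_bounded Hf cL; have [Bg _ gB] := H1loc_bounded Hg cL.
exists (fun x => g x * cderiv f x + f x * cderiv g x); split.
  apply: L2D => //.
    have [] // := @L2_bounded_mul _ _ _ leb `[0, c]%classic _ g (cderiv f) Bg.
    - exact: H1loc_cmeasurable.
    - exact: H1loc_L2.
  have [] // := @L2_bounded_mul _ _ _ leb `[0, c]%classic _ f (cderiv g) Bf.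
  - exact: H1loc_cmeasurable.
  - exact: H1loc_L2.
apply: (ae_leb_imp2 _ (H1loc_cdiff Hf cL) (H1loc_cdiff Hg cL)).
by move=> x df dg xc _; rewrite cderivM; [rewrite mulrC|exact: df|exact: dg].
Qed.

Lemma H1locZ z f : H1loc L f -> H1loc L (fun x => z * f x).
Proof. exact: H1locM (H1loc_cst z). Qed.

Lemma H1locJ f : H1loc L f -> H1loc L (fun x => (f x)^*%C).
Proof.
move=> Hf; apply: H1loc_intro => c cL; have [a1 a2] := H1loc_acont Hf cL; split.
  split.
    by move: a1; congr (acont _ _); apply/funext => t; case: (f t).
  by move: (acontN a2); congr (acont _ _); apply/funext => t; case: (f t).
exists (fun x => (cderiv f x)^*%C); split; first by apply: L2_conj => //; exact: H1loc_L2.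
apply: ae_leb_imp (H1loc_cdiff Hf cL).
by move=> x df xc _; rewrite cderivJ//; exact: df.
Qed.

(** Real and imaginary part of 1/f are those of the conjugate of f divided by |f|^2, which is
    absolutely continuous and at least e^2. The derivative -f'/f^2 is read off by differentiating f
    times 1/f. *)
Lemma H1locV f : H1loc L f ->
  (forall c, dom c -> exists2 e : R, 0 < e & forall x, 0 <= x <= c -> e <= normc (f x)) ->
  H1loc L (fun x => (f x)^-1).
Proof.
move=> Hf lb; apply: H1loc_intro => c cL; have [e e0 fe] := lb c cL.
have c0 := dom0 cL.
have acf := H1loc_acont Hf cL; have [a1 a2] := acf.
pose q x := Re (f x) ^+ 2 + Im (f x) ^+ 2.
have aq : acont 0 c q.
  by apply: acontD; [move: (acontM c0 a1 a1)|move: (acontM c0 a2 a2)];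
    congr (acont _ _); apply/funext => x /=; rewrite expr2.
have aqV : acont 0 c (fun x => (q x)^-1).
  apply: (@acontV _ 0 c q (e ^+ 2)) => //; first exact: exprn_gt0.
  move=> x xc; rewrite /q -normc_sqr ger0_norm ?sqr_ge0//.
  by rewrite ler_pXn2r ?nnegrE ?normc_ge0 ?(ltW e0)//; exact: fe.
have acV : cacont 0 c (fun x => (f x)^-1).
  split.
    move: (acontM c0 a1 aqV); congr (acont _ _); apply/funext => t.
    by rewrite /q /=; case: (f t).
  move: (acontN (acontM c0 a2 aqV)); congr (acont _ _); apply/funext => t.
  by rewrite /q /=; case: (f t) => x y /=; rewrite ?mulNr.
split => //.
exists (fun x => (-1 * ((f x)^-1 * (f x)^-1)) * cderiv f x); split.
  have mV := cacont_cmeasurable c0 acV.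
  have [] // := @L2_bounded_mul _ _ _ leb `[0, c]%classic _ (fun x => -1 * ((f x)^-1 * (f x)^-1)) (cderiv f) (e^-1 ^+ 2).
  - apply: cmeasurableM; first exact: cmeasurable_cst.
    exact: cmeasurableM.
  - move=> x /=; rewrite in_itv/= => xc; rewrite mulN1r cnormN normcM.
    rewrite ComplexField.Normc.normcV expr2.
    have h : (normc (f x))^-1 <= e^-1.
      have hx := fe x xc.
      by rewrite lef_pV2 ?posrE// (lt_le_trans e0).
    by apply: ler_pM => //; rewrite invr_ge0 normc_ge0.
  - exact: H1loc_L2.
apply: ae_leb_imp (H1loc_cdiff Hf cL).
move=> x df xc dV.
have fn0 t : 0 <= t <= c -> f t != 0.
  move=> tc; apply/eqP => f0; have := fe t tc.
  by rewrite f0 ComplexField.Normc.normc0 leNgt e0.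
have e1 : cderiv (fun t => f t * (f t)^-1) x = 0.
  rewrite -(cderiv_cst 1 x); apply: (@cderiv_eq_oo _ _ 0 c) => // t /andP[t1 t2].
  by rewrite mulfV// fn0// !ltW.
rewrite (cderivM (df xc) dV) in e1.
 have fx : f x != 0 by apply: fn0; case/andP: xc => h1 h2; rewrite !ltW.
apply: (mulfI fx); move: e1 => /eqP; rewrite addrC addr_eq0 => /eqP ->.
by rewrite mulN1r !mulNr mulrN !mulrA mulfV// mul1r mulrC.
Qed.

Lemma cderiv_clamp f p q x : p < x < q -> cderiv (f \o clamp p q) x = cderiv f x.
Proof.
move=> xpq; apply: (@cderiv_eq_oo _ _ p q) => // t /andP[t1 t2].
by rewrite /= clamp_id// !ltW.
Qed.

Lemma cderiv_clamp_low f p q x : x < p -> cderiv (f \o clamp p q) x = 0.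
Proof.
move=> xp; rewrite -(cderiv_cst (f p) x).
apply: (@cderiv_eq_oo _ _ (x - 1) p); last by rewrite xp andbT ltrBlDr ltrDl.
by move=> t /andP[t1 t2]; rewrite /= clamp_low// ltW.
Qed.

Lemma cderiv_clamp_high f p q x : p <= q -> q < x -> cderiv (f \o clamp p q) x = 0.
Proof.
move=> pq qx; rewrite -(cderiv_cst (f q) x).
apply: (@cderiv_eq_oo _ _ q (x + 1)); last by rewrite qx ltrDl ltr01.
by move=> t /andP[t1 t2]; rewrite /= clamp_high// ltW.
Qed.

(** The derivative is that of f times the indicator of [p,q]; the two corners form a null set. *)
Lemma H1loc_clamp f p q : H1loc L f -> 0 <= p -> p <= q -> dom q -> H1loc L (f \o clamp p q).
Proof.
move=> Hf p0 pq qL; apply: H1loc_intro => c cL; have c0 := dom0 cL; split.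
  have mL : dom (Num.max c q) by case: (leP c q).
  have [a1 a2] := H1loc_acont Hf mL.
  have cm : c <= Num.max c q by rewrite le_max lexx.
  have qm : q <= Num.max c q by rewrite le_max lexx orbT.
  by split; apply: (acontS (lexx 0) cm);
    [exact: (acont_comp_clamp p0 pq qm a1)|exact: (acont_comp_clamp p0 pq qm a2)].
exists (fun x => (\1_(`[p, q]%classic : set R) x)%:C * cderiv f x); split.
  have [] // := @L2_bounded_mul _ _ _ leb `[0, c]%classic _ (fun x => (\1_(`[p, q]%classic : set R) x)%:C) (cderiv f) 1.
  - by split => /=; [exact: measurable_indic|exact: measurable_cst].
  - move=> x _; rewrite /= expr0n /= addr0 sqrtr_sqr indicE.
    by case: (x \in _); rewrite ?normr1 ?normr0.
  - exact: H1loc_L2.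
apply: (ae_leb_imp2 _ (ae_leb_neq p) (ae_leb_neq q)).
move=> x xp xq xc _; rewrite indicE; case: (ltgtP x p) xp => // xp _.
  rewrite cderiv_clamp_low// memNset ?mul0r//= in_itv/=.
  by move=> /andP[]; rewrite leNgt xp.
case: (ltgtP x q) xq => // xq _.
  by rewrite cderiv_clamp ?xp// mem_set ?mul1r//= in_itv/= !ltW.
rewrite cderiv_clamp_high// memNset ?mul0r//= in_itv/=.
by move=> /andP[_]; rewrite leNgt xq.
Qed.

Definition cenergy f a c := sqnorm leb `[a, c]%classic (cderiv f).

(** Bilinear, without conjugation, as in the weak form of the differential equation; the energy
    appears when h is the conjugate of f. *)
Definition cdot f h a c := cintegral leb `[a, c]%classic (fun x => cderiv f x * cderiv h x).

Lemma L2S d (T : measurableType d) (mu : {measure set T -> \bar R}) (A B : set T) (F : T -> C) :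
  measurable A -> measurable B -> A `<=` B -> L2 mu B F -> L2 mu A F.
Proof.
move=> mA mB AB [[m1 m2] iF]; split.
  by split; [exact: measurable_funS m1|exact: measurable_funS m2].
apply: le_lt_trans iF; apply: ge0_subset_integral => //.
  by apply/measurable_EFinP; apply: measurable_funX; exact: cmeasurable_normc.
by move=> x _; rewrite lee_fin sqr_ge0.
Qed.

Lemma itvccS a b a' b' : a <= a' -> b' <= b -> `[a', b']%classic `<=` `[a, b]%classic.
Proof.
by move=> aa bb x /=; rewrite !in_itv/= => /andP[h1 h2]; rewrite (le_trans aa) ?(le_trans h2).
Qed.

Lemma H1loc_L2_itv f a c : H1loc L f -> 0 <= a -> dom c -> L2 leb `[a, c]%classic (cderiv f).
Proof.
by move=> Hf a0 cL; apply: (L2S _ _ _ (H1loc_L2 Hf cL)) => //; exact: itvccS.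
Qed.

Lemma H1loc_cdiff_itv f a c : H1loc L f -> 0 <= a -> dom c ->
  {ae leb, forall x, `[a, c]%classic x -> cdiff f x}.
Proof.
move=> Hf a0 cL; apply: ae_open_closed; apply: ae_leb_imp (H1loc_cdiff Hf cL).
by move=> x h /andP[ax xc]; apply: h; rewrite (le_lt_trans a0 ax) xc.
Qed.

Lemma cenergy_ge0 f a c : 0 <= cenergy f a c.
Proof. exact: sqnorm_ge0. Qed.

Lemma Rintegral_itvU (u : R -> R) a b c : a <= b -> b <= c ->
  leb.-integrable `[a, c] (EFin \o u) ->
  \int[leb]_(x in `[a, c]) u x = \int[leb]_(x in `[a, b]) u x + \int[leb]_(x in `[b, c]) u x.
Proof.
move=> ab bc iu.
have := Rintegral_itvB iu (x := b); rewrite !bnd_simp => /(_ ab bc).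
rewrite (@Rintegral_itv_obnd_cbnd _ b)//; last first.
  apply: integrableS iu => // t /=; rewrite !in_itv/= => /andP[h1 ->].
  by rewrite (le_trans ab (ltW h1)).
by move=> <-; rewrite addrC subrK.
Qed.

Lemma cenergy_split f a b c : H1loc L f -> 0 <= a -> a <= b -> b <= c -> dom c ->
  cenergy f a c = cenergy f a b + cenergy f b c.
Proof.
move=> Hf a0 ab bc cL; apply: Rintegral_itvU => //.
by apply: L2_sqr_integrable => //; exact: H1loc_L2_itv.
Qed.

Lemma cenergy_le f a b c e : H1loc L f -> 0 <= a -> a <= b -> b <= c -> c <= e -> dom e ->
  cenergy f b c <= cenergy f a e.
Proof.
move=> Hf a0 ab bc ce eL.
rewrite (cenergy_split Hf a0 (le_trans ab bc) ce eL).
rewrite (cenergy_split Hf a0 ab bc); last exact: (domS eL (le_trans a0 (le_trans ab bc))).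
by have := cenergy_ge0 f a b; have := cenergy_ge0 f c e; lra.
Qed.

Lemma cdot_integrable f h a c : H1loc L f -> H1loc L h -> 0 <= a -> dom c ->
  cintegrable leb `[a, c]%classic (fun x => cderiv f x * cderiv h x).
Proof. by move=> Hf Hh a0 cL; apply: L2_mul => //; exact: H1loc_L2_itv. Qed.

Lemma cdot_split f h a b c : H1loc L f -> H1loc L h -> 0 <= a -> a <= b -> b <= c -> dom c ->
  cdot f h a c = cdot f h a b + cdot f h b c.
Proof.
move=> Hf Hh a0 ab bc cL; have [i1 i2] := cdot_integrable Hf Hh a0 cL.
rewrite /cdot /cintegral (Rintegral_itvU ab bc i1) (Rintegral_itvU ab bc i2).
by [].
Qed.

Lemma cdot_CS f h a c : H1loc L f -> H1loc L h -> 0 <= a -> dom c ->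
  normc (cdot f h a c) <= 2 * (Num.sqrt (cenergy f a c) * Num.sqrt (cenergy h a c)).
Proof. by move=> Hf Hh a0 cL; apply: L2_CS => //; exact: H1loc_L2_itv. Qed.

Lemma eq_Rintegral_oo (u v : R -> R) a c : a <= c ->
  measurable_fun `[a, c] u -> measurable_fun `[a, c] v ->
  {ae leb, forall x, `[a, c]%classic x -> u x = v x} ->
  \int[leb]_(x in `[a, c]) u x = \int[leb]_(x in `[a, c]) v x.
Proof.
move=> ac mu mv uv; rewrite /Rintegral; congr fine; apply: ae_eq_integral => //.
- exact/measurable_EFinP.
- exact/measurable_EFinP.
- by apply: ae_leb_imp uv => x h /h ->.
Qed.

Lemma ae_eq_cintegral (F G : R -> C) a c : a <= c ->
  cmeasurable `[a, c]%classic F -> cmeasurable `[a, c]%classic G ->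
  {ae leb, forall x, `[a, c]%classic x -> F x = G x} ->
  cintegral leb `[a, c]%classic F = cintegral leb `[a, c]%classic G.
Proof.
move=> ac [m1 m2] [m3 m4] FG; rewrite /cintegral; congr (_ +i* _);
  apply: eq_Rintegral_oo => //; by apply: ae_leb_imp FG => x h /h ->.
Qed.

Lemma H1loc_cmeasurable_cderiv f a c : H1loc L f -> 0 <= a -> dom c ->
  cmeasurable `[a, c]%classic (cderiv f).
Proof. by move=> Hf a0 cL; have [] := H1loc_L2_itv Hf a0 cL. Qed.

Lemma cderivZ z f x : cdiff f x -> cderiv (fun t => z * f t) x = z * cderiv f x.
Proof. by move=> df; rewrite (cderivM (cdiff_cst z x) df) cderiv_cst mul0r add0r. Qed.

Lemma cdotZ z f h a c : H1loc L f -> H1loc L h -> 0 <= a -> a <= c -> dom c ->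
  cdot f (fun x => z * h x) a c = z * cdot f h a c.
Proof.
move=> Hf Hh a0 ac cL; rewrite -cintegralZ//; last exact: cdot_integrable.
have mf := H1loc_cmeasurable_cderiv Hf a0 cL; have mh := H1loc_cmeasurable_cderiv Hh a0 cL.
apply: ae_eq_cintegral => //.
- apply: cmeasurableM => //; exact: (H1loc_cmeasurable_cderiv (H1locZ z Hh) a0 cL).
- by apply: cmeasurableM; [exact: cmeasurable_cst|exact: cmeasurableM].
- apply: ae_leb_imp (H1loc_cdiff_itv Hh a0 cL).
  by move=> x dh xc; rewrite (cderivZ z (dh xc)) mulrCA.
Qed.

Lemma cdotC f h a c : cdot f h a c = cdot h f a c.
Proof. by apply: eq_cintegral => x _; rewrite mulrC. Qed.

Lemma cenergyE f (G : R -> C) a c : H1loc L f -> 0 <= a -> dom c -> L2 leb `[a, c]%classic G ->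
  {ae leb, forall x, `[a, c]%classic x -> cderiv f x = G x} ->
  cenergy f a c = sqnorm leb `[a, c]%classic G.
Proof.
move=> Hf a0 cL LG fG.
by have [] := L2_ae_eq _ (H1loc_cmeasurable_cderiv Hf a0 cL) LG fG.
Qed.

Lemma cenergyZ z f a c : H1loc L f -> 0 <= a -> a <= c -> dom c ->
  cenergy (fun x => z * f x) a c = normc z ^+ 2 * cenergy f a c.
Proof.
move=> Hf a0 ac cL; have Lf := H1loc_L2_itv Hf a0 cL.
rewrite -sqnormZ//; apply: (cenergyE (H1locZ z Hf) a0 cL); first exact: L2Z.
by apply: ae_leb_imp (H1loc_cdiff_itv Hf a0 cL) => x h xc; rewrite (cderivZ z (h xc)).
Qed.

Lemma cenergyM f g a c (Bf Bg : R) : H1loc L f -> H1loc L g -> 0 <= a -> a <= c -> dom c ->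
  (forall x, a <= x <= c -> normc (f x) <= Bf) -> (forall x, a <= x <= c -> normc (g x) <= Bg) ->
  cenergy (fun x => f x * g x) a c <= 2 * (Bg ^+ 2 * cenergy f a c + Bf ^+ 2 * cenergy g a c).
Proof.
move=> Hf Hg a0 ac cL fB gB.
have Lf := H1loc_L2_itv Hf a0 cL; have Lg := H1loc_L2_itv Hg a0 cL.
have mS (h : R -> C) : H1loc L h -> cmeasurable `[a, c]%classic h.
  move=> Hh; have [m1 m2] := H1loc_cmeasurable Hh cL.
  split; [apply: measurable_funS m1 => //|apply: measurable_funS m2 => //];
  exact: itvccS.
have itvB (h : R -> C) (B : R) : (forall x, a <= x <= c -> normc (h x) <= B) ->
    forall x, `[a, c]%classic x -> normc (h x) <= B.
  by move=> hB x /=; rewrite in_itv/=; exact: hB.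
have mac : measurable (`[a, c]%classic : set (measurableTypeR R)) by exact: measurable_itv.
have [L1 e1] := L2_bounded_mul mac (mS _ Hg) (itvB _ _ gB) Lf.
have [L2' e2] := L2_bounded_mul mac (mS _ Hf) (itvB _ _ fB) Lg.
apply: (@le_trans _ _ (2 * (sqnorm leb `[a, c]%classic (fun x => g x * cderiv f x) +
    sqnorm leb `[a, c]%classic (fun x => f x * cderiv g x)))); last first.
  by apply: ler_wpM2l => //; exact: (lerD e1 e2).
apply: le_trans (sqnormD mac L1 L2').
rewrite le_eqVlt; apply/orP; left; apply/eqP.
apply: (cenergyE (H1locM Hf Hg) a0 cL (L2D mac L1 L2')).
 apply: (ae_leb_imp2 _ (H1loc_cdiff_itv Hf a0 cL) (H1loc_cdiff_itv Hg a0 cL)).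
  by move=> x df dg xc; rewrite cderivM; [rewrite mulrC|exact: df|exact: dg].
Qed.

Lemma eq_cenergy f g a c : H1loc L f -> H1loc L g -> 0 <= a -> a <= c -> dom c ->
  (forall x, a < x < c -> cderiv f x = cderiv g x) -> cenergy f a c = cenergy g a c.
Proof.
move=> Hf Hg a0 ac cL fg.
apply: (cenergyE Hf a0 cL); first exact: H1loc_L2_itv.
by apply: ae_open_closed; exact: aeW.
Qed.

Lemma cenergy0 f a c : H1loc L f -> 0 <= a -> a <= c -> dom c ->
  (forall x, a < x < c -> cderiv f x = 0) -> cenergy f a c = 0.
Proof.
move=> Hf a0 ac cL f0; rewrite (eq_cenergy Hf (H1loc_cst 0) a0 ac cL).
  rewrite /cenergy /sqnorm; under eq_Rintegral do
    rewrite cderiv_cst ComplexField.Normc.normc0 expr0n /=.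
  by rewrite /Rintegral integral0.
by move=> x xc; rewrite f0// cderiv_cst.
Qed.

Lemma eq_cdot f h1 h2 a c : H1loc L f -> H1loc L h1 -> H1loc L h2 -> 0 <= a -> a <= c -> dom c ->
  (forall x, a < x < c -> cderiv h1 x = cderiv h2 x) -> cdot f h1 a c = cdot f h2 a c.
Proof.
move=> Hf H1 H2 a0 ac cL hh; apply: ae_eq_cintegral => //.
- by apply: cmeasurableM; exact: H1loc_cmeasurable_cderiv.
- by apply: cmeasurableM; exact: H1loc_cmeasurable_cderiv.
- by apply: ae_open_closed; apply: aeW => x /hh ->.
Qed.

Lemma cdot_affine f h s a c : H1loc L f -> H1loc L h -> 0 <= a -> a <= c -> dom c ->
  (forall x, a < x < c -> cderiv h x = s) -> cdot f h a c = s * (f c - f a).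
Proof.
move=> Hf Hh a0 ac cL hs.
have [f1 f2] := H1loc_acont Hf cL.
have c0 := dom0 cL.
have i1 : cintegrable leb `[a, c]%classic (cderiv f).
  have sub : `[a, c]%classic `<=` `[0, c]%classic by exact: itvccS.
  by split; [apply: integrableS (acont_integrable_derive1 c0 f1)
            |apply: integrableS (acont_integrable_derive1 c0 f2)].
have -> : cdot f h a c = cintegral leb `[a, c]%classic (fun x => s * cderiv f x).
  apply: ae_eq_cintegral => //.
  - by apply: cmeasurableM; exact: H1loc_cmeasurable_cderiv.
  - apply: cmeasurableM; [exact: cmeasurable_cst|exact: H1loc_cmeasurable_cderiv].
  - by apply: ae_open_closed; apply: aeW => x /hs ->; rewrite mulrC.
rewrite cintegralZ//; congr (_ * _); rewrite /cintegral /=.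
have := acont_FTC c0 f1 a0 ac (lexx c); have := acont_FTC c0 f2 a0 ac (lexx c).
by move=> <- <-; case: (f c) => ? ?; case: (f a).
Qed.

Lemma cdot0 f h a c : H1loc L f -> H1loc L h -> 0 <= a -> a <= c -> dom c ->
  (forall x, a < x < c -> cderiv h x = 0) -> cdot f h a c = 0.
Proof. by move=> Hf Hh a0 ac cL h0; rewrite (cdot_affine Hf Hh a0 ac cL h0) mul0r. Qed.

(** Cauchy-Schwarz against the constant 1. Real and imaginary part are estimated as squares and then
    added, so that no constant is lost: equality holds for affine f, and this sharpness makes the
    first gap end exactly at distance 1/s_0. *)
Lemma H1loc_increment f x y : H1loc L f -> 0 <= x -> x <= y -> dom y ->
  normc (f y - f x) ^+ 2 <= (y - x) * cenergy f x y.
Proof.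
move=> Hf x0 xy yL; have Lf := H1loc_L2_itv Hf x0 yL.
have [f1 f2] := H1loc_acont Hf yL; have y0 := dom0 yL.
have m1 : leb.-integrable `[x, y] (fun t => (1 ^+ 2 : R)%:E).
  apply/integrableP; split; first exact: measurable_cst.
  under eq_integral do rewrite /= expr1n normr1.
  rewrite integral_cst// mul1e.
  suff : (leb `[x, y]%classic < +oo)%E by [].
  by rewrite leb_itvcc// ltry.
have e1 : \int[leb]_(t in `[x, y]) (1 ^+ 2 : R) = y - x.
  by rewrite Rintegral_cst// expr1n mul1r -[RHS]/(fine (y - x)%:E) -leb_itvcc.
have key (w : R -> R) : acont 0 y w -> measurable_fun `[x, y] (derive1 w) ->
    leb.-integrable `[x, y] (fun t => (derive1 w t ^+ 2)%:E) ->
    (w y - w x) ^+ 2 <= (y - x) * \int[leb]_(t in `[x, y]) (derive1 w t ^+ 2).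
  move=> aw mw iw; rewrite (acont_FTC y0 aw x0 xy (lexx y)) -e1.
  have CS := @square_integrable_CS _ _ _ leb `[x, y]%classic (measurable_itv _) (fun=> 1) (derive1 w).
  have := CS (measurable_cst _) mw m1 iw.
  under eq_Rintegral do rewrite mul1r.
  exact.
have -> : normc (f y - f x) ^+ 2 = (Re (f y) - Re (f x)) ^+ 2 + (Im (f y) - Im (f x)) ^+ 2.
  by rewrite normc_sqr; case: (f y) => ? ?; case: (f x).
rewrite /cenergy sqnormE// mulrDr; apply: lerD.
  by apply: key f1 Lf.1.1 (L2_Re _ Lf).
by apply: key f2 Lf.1.2 (L2_Im _ Lf).
Qed.

Lemma cenergy_continuous f b : H1loc L f -> dom b ->
  forall e, 0 < e -> exists2 d : R, 0 < d & forall x y, 0 <= x -> x <= y -> y <= b -> y - x < d ->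
  cenergy f x y < e.
Proof.
move=> Hf bL e e0; have b0 := dom0 bL.
have i1 := L2_sqr_integrable (H1loc_L2 Hf bL).
have /integral_normr_continuous : leb.-integrable setT (EFin \o ((fun x => normc (cderiv f x) ^+ 2) \_ `[0, b])).
  by rewrite -restrict_EFin; apply/integrable_restrict => //=; rewrite setTI; exact: i1.
move=> /(_ _ e0)[d [d0 H]]; exists d => // x y x0 xy yb xyd.
have h : (leb `[x, y]%classic < d%:E)%E by rewrite leb_itvcc// lte_fin.
have := H _ (measurable_itv _) h; apply: le_lt_trans; rewrite le_eqVlt; apply/orP; left; apply/eqP.
apply: eq_Rintegral => t; rewrite inE/= in_itv/= => /andP[xt ty].
rewrite patchE mem_set/= ?in_itv/= ?(le_trans x0 xt) ?(le_trans ty yb)//.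
by rewrite ger0_norm ?sqr_ge0.
Qed.

End local_theory.

End H1_functions.

(** * Cut-off functions and integrals over compact intervals *)

Section string_toolkit.
Variables (R : realType) (L : \bar R) (ups : {measure set (measurableTypeR R) -> \bar R}).
Hypothesis ups_fin : forall c, halfopen L c -> (ups `[0%R, c]%classic < +oo)%E.
Local Notation C := R[i].
Local Notation normc := (@ComplexField.Normc.normc R).
Local Notation leb := (@lebesgue_measure R).
Local Notation Re := (@complex.Re R).
Local Notation Im := (@complex.Im R).
Local Notation dom := (halfopen L).
Local Notation H1 := (@H1loc R L).
Implicit Types (f g h : R -> C) (a b c x y : R) (z : C).

Definition vanishes_from c h := forall x, c <= x -> dom x -> h x = 0.

Lemma vanishes_fromS c c' h : c <= c' -> vanishes_from c h -> vanishes_from c' h.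
Proof. by move=> cc hc x cx; apply: hc; exact: le_trans cx. Qed.

Lemma cenergy_vanish h a c c' : H1 h -> vanishes_from c h -> 0 <= a -> a <= c -> c <= c' -> dom c' ->
  cenergy h a c' = cenergy h a c.
Proof.
move=> Hh hc a0 ac cc cL; rewrite (cenergy_split Hh a0 ac cc cL).
rewrite [X in _ + X](cenergy0 Hh _ cc cL) ?addr0//; first exact: le_trans ac.
move=> x xcc; rewrite -(cderiv_cst 0 x); apply: (cderiv_eq_oo (a := c) (b := c')) => // t /andP[t1 t2].
apply: hc; first exact: ltW.
by apply: (domS cL); [apply: le_trans (ltW t1); exact: le_trans ac|exact: ltW].
Qed.

Lemma normc_le_cenergy h x c : H1 h -> vanishes_from c h -> 0 <= x -> x <= c -> dom c ->
  normc (h x) ^+ 2 <= c * cenergy h 0 c.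
Proof.
move=> Hh hc x0 xc cL; have := H1loc_increment Hh x0 xc cL.
rewrite (hc c (lexx c) cL) sub0r cnormN => /le_trans; apply.
apply: ler_pM; rewrite ?subr_ge0 ?cenergy_ge0//; first by rewrite gerBl.
exact: (cenergy_le Hh (lexx 0) x0 xc (lexx c) cL).
Qed.

(** The piecewise linear cut-off that is 1 up to a and 0 from b on; its energy 1/(b - a) sets the
    constants of the estimates below. *)
Definition descent a b x : C := ((b - clamp a b x) / (b - a))%:C.

Definition ascent a b x : C := ((clamp a b x - a) / (b - a))%:C.

Lemma H1_descent a b : 0 <= a -> a < b -> dom b -> H1 (descent a b).
Proof.
move=> a0 ab bL.
have := H1loc_clamp (H1locD (@H1loc_cst R L (b / (b - a))%:C)
  (H1locZ (- (b - a)^-1)%:C (@H1loc_id R L))) a0 (ltW ab) bL.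
congr (H1loc _ _); apply/funext => x; rewrite /descent /=.
by rewrite -rmorphM -rmorphD /=; congr (_%:C); field; rewrite subr_eq0 gt_eqF.
Qed.

Lemma H1_ascent a b : 0 <= a -> a < b -> dom b -> H1 (ascent a b).
Proof.
move=> a0 ab bL.
have := H1loc_clamp (H1locD (@H1loc_cst R L (- a / (b - a))%:C)
  (H1locZ ((b - a)^-1)%:C (@H1loc_id R L))) a0 (ltW ab) bL.
congr (H1loc _ _); apply/funext => x; rewrite /ascent /=.
by rewrite -rmorphM -rmorphD /=; congr (_%:C); field; rewrite subr_eq0 gt_eqF.
Qed.

Lemma descent_low a b x : a < b -> x <= a -> descent a b x = 1.
Proof.
by move=> ab xa; rewrite /descent clamp_low// mulfV// subr_eq0 gt_eqF.
Qed.

Lemma descent_high a b x : a < b -> b <= x -> descent a b x = 0.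
Proof. by move=> ab bx; rewrite /descent clamp_high ?(ltW ab)// subrr mul0r. Qed.

Lemma ascent_low a b x : x <= a -> ascent a b x = 0.
Proof. by move=> xa; rewrite /ascent clamp_low// subrr mul0r. Qed.

Lemma ascent_high a b x : a < b -> b <= x -> ascent a b x = 1.
Proof.
by move=> ab bx; rewrite /ascent clamp_high ?(ltW ab)// mulfV// subr_eq0 gt_eqF.
Qed.

Lemma descent_bound a b x : a < b -> 0 <= Re (descent a b x) <= 1.
Proof.
move=> ab; have /andP[h1 h2] := clamp_itv x (ltW ab).
have ba : 0 < b - a by rewrite subr_gt0.
rewrite /descent /=; apply/andP; split; first by rewrite divr_ge0 ?subr_ge0// ltW.
by rewrite ler_pdivrMr// mul1r lerD2l lerN2.
Qed.

Lemma normc_real (r : R) : normc (r%:C) = `|r|.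
Proof. by rewrite /= expr0n /= addr0 sqrtr_sqr. Qed.

Lemma cderiv_affine (p q : R) x : cderiv (fun t => (p + q * t)%:C) x = q%:C.
Proof.
rewrite /cderiv; congr (_ +i* _); last by rewrite derive1E derive_cst.
have := @derive1D' R (cst p) (fun t => q * t) x; rewrite /cst /= => ->.
- have := @derive1M' R (cst q) id x; rewrite /cst /= => ->; last exact: derivable_id.
    by rewrite !derive1E derive_cst derive_id derive_cst mul0r !add0r mulr1.
  exact: derivable_cst.
- exact: derivable_cst.
- by apply: derivableM'; [exact: derivable_cst|exact: derivable_id].
Qed.

Lemma cderiv_descent a b x : a < x < b -> cderiv (descent a b) x = (- (b - a)^-1)%:C.
Proof.
move=> xab; rewrite -(cderiv_affine (b / (b - a)) (- (b - a)^-1) x).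
apply: (cderiv_eq_oo (a := a) (b := b)) => // t /andP[t1 t2].
rewrite /descent clamp_id ?ltW//; congr (_%:C); field.
by rewrite subr_eq0 gt_eqF// (lt_trans t1).
Qed.

Lemma cenergy_descent a b : 0 <= a -> a < b -> dom b -> cenergy (descent a b) a b = (b - a)^-1.
Proof.
move=> a0 ab bL; have ba : 0 < b - a by rewrite subr_gt0.
have m1 : measurable (`[a, b]%classic : set (measurableTypeR R)) by exact: measurable_itv.
have LG : L2 leb `[a, b]%classic (fun=> (- (b - a)^-1)%:C : C).
  split; first exact: cmeasurable_cst.
  rewrite integral_cst//; apply: lte_mul_pinfty; rewrite ?lee_fin ?sqr_ge0//.
  suff : (leb `[a, b]%classic < +oo)%E by [].
  by rewrite leb_itvcc ?ltry// ltW.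
rewrite (cenergyE (H1_descent a0 ab bL) a0 bL LG); last first.
  by apply: ae_open_closed; apply: aeW => x; exact: cderiv_descent.
rewrite /sqnorm Rintegral_cst// normc_real normrN ger0_norm; last by rewrite invr_ge0 ltW.
rewrite -[fine _]/(fine (leb `[a, b]%classic)) leb_itvcc ?ltW//= expr2 -mulrA mulVf ?mulr1//.
by rewrite gt_eqF.
Qed.

(** From |(1/f)'| = |f'| / |f|^2 with |f| at least e. *)
Lemma cenergyV f a c (e : R) : H1 f -> H1 (fun x => (f x)^-1) -> 0 <= a -> a <= c -> dom c -> 0 < e ->
  (forall x, a <= x <= c -> e <= normc (f x)) ->
  cenergy (fun x => (f x)^-1) a c <= (e^-1 ^+ 2) ^+ 2 * cenergy f a c.
Proof.
move=> Hf HV a0 ac cL e0 fe.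
have mac : measurable (`[a, c]%classic : set (measurableTypeR R)) by exact: measurable_itv.
pose K x := -1 * ((f x)^-1 * (f x)^-1).
have fn0 t : a <= t <= c -> f t != 0.
  move=> tc; apply/eqP => f0; have := fe t tc.
  by rewrite f0 ComplexField.Normc.normc0 leNgt e0.
have mV : cmeasurable `[a, c]%classic (fun x => (f x)^-1).
  have [m1 m2] := H1loc_cmeasurable HV cL.
  by split; [apply: measurable_funS m1|apply: measurable_funS m2] => //; exact: itvccS.
have mK : cmeasurable `[a, c]%classic K.
  by apply: cmeasurableM; [exact: cmeasurable_cst|exact: cmeasurableM].
have Kb x : `[a, c]%classic x -> normc (K x) <= e^-1 ^+ 2.
  rewrite /= in_itv/= => xc; rewrite /K mulN1r cnormN normcM.
  rewrite ComplexField.Normc.normcV expr2.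
  have h : (normc (f x))^-1 <= e^-1.
    have hx := fe x xc.
    by rewrite lef_pV2 ?posrE// (lt_le_trans e0).
  by apply: ler_pM => //; rewrite invr_ge0 normc_ge0.
have [L1 e1] := L2_bounded_mul mac mK Kb (H1loc_L2_itv Hf a0 cL).
apply: le_trans e1; rewrite le_eqVlt; apply/orP; left; apply/eqP.
apply: (cenergyE HV a0 cL L1).
have := H1loc_cdiff_itv HV a0 cL; have := H1loc_cdiff_itv Hf a0 cL.
move=> d1 d2.
have d12 : {ae leb, forall x, `[a, c]%classic x -> cdiff f x /\ cdiff (fun x => (f x)^-1) x}.
  by apply: (ae_leb_imp2 _ d1 d2) => x p1 p2 hx; split; [exact: p1|exact: p2].
apply: ae_open_closed; apply: ae_leb_imp d12 => x H /andP[ax xc].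
have [|df dV] := H; first by rewrite /= in_itv/= !ltW.
have e1 : cderiv (fun t => f t * (f t)^-1) x = 0.
  rewrite -(cderiv_cst 1 x); apply: (cderiv_eq_oo (a := a) (b := c)) => //; last by rewrite ax.
  by move=> t /andP[t1 t2]; rewrite mulfV// fn0// !ltW.
rewrite (cderivM df dV) in e1.
have fx : f x != 0 by apply: fn0; rewrite !ltW.
apply: (mulfI fx); move: e1 => /eqP; rewrite addrC addr_eq0 => /eqP ->.
by rewrite /K mulN1r !mulNr mulrN !mulrA mulfV// mul1r mulrC.
Qed.

Lemma ups_itv_fin (A : set (measurableTypeR R)) c : dom c -> measurable A ->
  A `<=` `[0, c]%classic -> (ups A < +oo)%E.
Proof.
by move=> cL mA Ac; apply: le_lt_trans (ups_fin cL); apply: le_measure; rewrite ?inE.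
Qed.

Lemma L2_ups f (A : set (measurableTypeR R)) c : H1 f -> dom c -> measurable A ->
  A `<=` `[0, c]%classic -> L2 ups A f.
Proof.
move=> Hf cL mA Ac; have [m1 m2] := H1loc_cmeasurable Hf cL.
have mf : cmeasurable A f by split; [apply: measurable_funS m1|apply: measurable_funS m2].
have [B B0 fB] := H1loc_bounded Hf cL.
split => //; apply: (@le_lt_trans _ _ (\int[ups]_(x in A) (B ^+ 2)%:E)%E).
  apply: ge0_le_integral => //.
  - by move=> x _; rewrite lee_fin sqr_ge0.
  - by apply/measurable_EFinP; apply: measurable_funX; exact: cmeasurable_normc.
  - move=> x /Ac; rewrite /= in_itv/= => /fB h.
    by rewrite lee_fin ler_pXn2r ?nnegrE ?normc_ge0.
rewrite integral_cst//; apply: lte_mul_pinfty; rewrite ?lee_fin ?sqr_ge0//.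
exact: (ups_itv_fin cL).
Qed.

Lemma sqnorm_setU f (A B : set (measurableTypeR R)) c : H1 f -> dom c ->
  measurable A -> measurable B -> A `|` B `<=` `[0, c]%classic -> [disjoint A & B] ->
  sqnorm ups (A `|` B) f = sqnorm ups A f + sqnorm ups B f.
Proof.
move=> Hf cL mA mB ABc dAB; apply: Rintegral_setU => //.
by apply: L2_sqr_integrable; apply: (L2_ups Hf cL) => //; exact: measurableU.
Qed.

Lemma cintegral_setU (F : R -> C) (A B : set (measurableTypeR R)) :
  measurable A -> measurable B -> [disjoint A & B] -> cintegrable ups (A `|` B) F ->
  cintegral ups (A `|` B) F = cintegral ups A F + cintegral ups B F.
Proof.
move=> mA mB dAB [i1 i2]; rewrite /cintegral Rintegral_setU// Rintegral_setU//.
Qed.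

Lemma itvcc_split1 a c : a <= c -> `[a, c]%classic = [set a] `|` `]a, c]%classic :> set R.
Proof.
move=> ac; apply/seteqP; split => x /=; rewrite !in_itv/=.
  by rewrite le_eqVlt => /andP[/orP[/eqP ->|h] h2]; [left|right; rewrite h].
by case=> [->|/andP[h1 ->]]; rewrite ?lexx// ltW.
Qed.

Lemma itvcc_disj1 a c : [disjoint [set a] & `]a, c]%classic].
Proof.
by apply/disj_setPS => x [/= ->]; rewrite in_itv/= ltxx.
Qed.

Lemma cintegral_set1 (F : R -> C) a : (ups [set a] < +oo)%E ->
  cintegral ups [set a] F = (fine (ups [set a]))%:C * F a.
Proof.
move=> fa.
have H (u : R -> R) : \int[ups]_(x in [set a]) u x = fine (ups [set a]) * u a.
  rewrite (@eq_Rintegral _ _ _ ups [set a] (cst (u a))); last by move=> x; rewrite inE/= => ->.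
  by rewrite Rintegral_cst// mulrC.
rewrite /cintegral !H; case: (F a) => x y /=.
by apply/eqP; rewrite eq_complex /=; apply/andP; split; apply/eqP; ring.
Qed.

Lemma cintegral_null (F : R -> C) (A : set (measurableTypeR R)) : measurable A ->
  cmeasurable A F -> ups A = 0%E -> cintegral ups A F = 0.
Proof.
move=> mA [m1 m2] A0; rewrite /cintegral /Rintegral.
have := @null_set_integral _ (measurableTypeR R) R ups A.
move=> H; rewrite !H//.
- exact/measurable_EFinP.
- exact/measurable_EFinP.
Qed.

Lemma cintegral_ups_point f h a c : H1 f -> H1 h -> 0 <= a -> a <= c -> dom c ->
  cintegral ups `[a, c]%classic (fun x => f x * h x) =
  (fine (ups [set a]))%:C * (f a * h a) + cintegral ups `]a, c]%classic (fun x => f x * h x).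
Proof.
move=> Hf Hh a0 ac cL; rewrite itvcc_split1//.
have sub : [set a] `|` `]a, c]%classic `<=` `[0, c]%classic.
  by rewrite -itvcc_split1//; exact: itvccS.
rewrite cintegral_setU//.
- rewrite cintegral_set1//; apply: (ups_itv_fin cL) => // x xa; apply: sub; by left.
- exact: itvcc_disj1.
- by apply: L2_mul; [exact: measurableU|apply: (L2_ups Hf cL) => //; exact: measurableU
    |apply: (L2_ups Hh cL) => //; exact: measurableU].
Qed.

Lemma sqnorm_ups_point f a c : H1 f -> 0 <= a -> a <= c -> dom c ->
  sqnorm ups `[a, c]%classic f =
  fine (ups [set a]) * normc (f a) ^+ 2 + sqnorm ups `]a, c]%classic f.
Proof.
move=> Hf a0 ac cL; rewrite itvcc_split1//.
have sub : [set a] `|` `]a, c]%classic `<=` `[0, c]%classic.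
  by rewrite -itvcc_split1//; exact: itvccS.
rewrite (sqnorm_setU Hf cL)//; last exact: itvcc_disj1.
congr (_ + _); rewrite /sqnorm (@eq_Rintegral _ _ _ ups [set a] (cst (normc (f a) ^+ 2))).
  by rewrite Rintegral_cst// mulrC.
by move=> x; rewrite inE/= => ->.
Qed.

Lemma sqnorm_ups_le f (A B : set (measurableTypeR R)) c : H1 f -> dom c ->
  measurable A -> measurable B -> A `<=` B -> B `<=` `[0, c]%classic ->
  sqnorm ups A f <= sqnorm ups B f.
Proof.
move=> Hf cL mA mB AB Bc; rewrite /sqnorm /Rintegral; apply: fine_le.
- apply: integrable_fin_num => //; apply: L2_sqr_integrable.
  by apply: (L2_ups Hf cL) => //; exact: subset_trans Bc.
- apply: integrable_fin_num => //; apply: L2_sqr_integrable.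
  exact: (L2_ups Hf cL).
- apply: ge0_subset_integral => //.
    by apply/measurable_EFinP; apply: measurable_funX; apply: cmeasurable_normc;
       have [] := L2_ups Hf cL mB Bc.
  by move=> x _; rewrite lee_fin sqr_ge0.
Qed.

Lemma sqnorm_ups_cst (r : R) (A : set (measurableTypeR R)) c : dom c -> measurable A ->
  A `<=` `[0, c]%classic -> sqnorm ups A (fun=> r%:C) = r ^+ 2 * fine (ups A).
Proof.
move=> cL mA Ac; have fA := ups_itv_fin cL mA Ac.
by rewrite /sqnorm Rintegral_cst// normc_real real_normK// num_real.
Qed.

Lemma sqnorm_ups_mono f g (A : set (measurableTypeR R)) c : H1 f -> H1 g -> dom c -> measurable A ->
  A `<=` `[0, c]%classic -> (forall x, A x -> normc (f x) <= normc (g x)) ->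
  sqnorm ups A f <= sqnorm ups A g.
Proof.
move=> Hf Hg cL mA Ac fg; have [mf _] := L2_ups Hf cL mA Ac.
rewrite -[leRHS]mul1r; apply: (L2_le mA mf (L2_ups Hg cL mA Ac) _).2 => x Ax.
by rewrite mul1r ler_pXn2r// ?nnegrE ?normc_ge0// fg.
Qed.

End string_toolkit.

(** * The part of a string to the right of a point *)

Opaque H1loc cenergy cdot sqnorm cintegral.

Section states.
Variables (R : realType) (L : \bar R) (ups : {measure set (measurableTypeR R) -> \bar R}).
Hypothesis ups_fin : forall c, halfopen L c -> (ups `[0%R, c]%classic < +oo)%E.
Local Notation C := R[i].
Local Notation normc := (@ComplexField.Normc.normc R).
Local Notation Re := (@complex.Re R).
Local Notation Im := (@complex.Im R).
Local Notation dom := (halfopen L).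
Local Notation H1 := (@H1loc R L).
Implicit Types (f g h : R -> C) (a b c x y e eta : R) (z : C).

(** Vanishing from c on is easier to carry along than compact support: it passes to products with
    H^1 functions and to sums with the same c. [test_H1c] and [H1c_test] translate between the two
    notions. *)
Definition test c h := [/\ dom c, H1 h & vanishes_from L c h].

(* The string restricted to [a,L), with the part of omega to the left of a
   removed: Om is the remaining distribution, f z the Weyl solution normalised
   at a and M its Weyl-Titchmarsh function. *)
Record state (a : R) (Om : (R -> C) -> C) (M : C -> C) (f : C -> R -> C) : Prop := State {
  st_dom : dom a;
  st_lin : forall z g h c, test c g -> test c h ->
    Om (fun x => z * g x + h x) = z * Om g + Om h;
  st_bounded : forall c, dom c -> exists2 B : R, 0 <= B &
    forall h, test c h -> normc (Om h) ^+ 2 <= B * cenergy h 0 c;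
  st_supp : forall c h, test c h -> (forall x, a <= x -> dom x -> h x = 0) -> Om h = 0;
  st_H1 : forall z, nonreal z -> H1 (f z);
  st_norm : forall z, nonreal z -> f z a = 1;
  st_eq : forall z h c, nonreal z -> test c h -> a <= c ->
    z * M z * h a + cdot (f z) h a c =
    z * Om (fun x => f z x * h x) + z ^+ 2 * cintegral ups `[a, c]%classic (fun x => f z x * h x);
  st_energy : forall z c, nonreal z -> a <= c -> dom c ->
    cenergy (f z) a c / normc z ^+ 2 + sqnorm ups `[a, c]%classic (f z) <= Im (M z) / Im z;
  st_end : forall z l, nonreal z -> L = l%:E -> forall e, 0 < e ->
    exists2 x0, dom x0 & forall x, x0 <= x -> dom x -> normc (f z x) <= e }.

Lemma testS c c' h : c <= c' -> dom c' -> test c h -> test c' h.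
Proof. by move=> cc dc [_ Hh hc]; split => //; exact: vanishes_fromS hc. Qed.

Lemma testM f c h : H1 f -> test c h -> test c (fun x => f x * h x).
Proof. move=> Hf [dc Hh hc]; split; [exact: dc|exact: H1locM Hf Hh|].
by move=> x cx dx; rewrite (hc x cx dx) mulr0. Qed.

Lemma testD c g h : test c g -> test c h -> test c (fun x => g x + h x).
Proof.
move=> [dc Hg gc] [_ Hh hc]; split; [exact: dc|exact: H1locD Hg Hh|].
by move=> x cx dx; rewrite (gc x cx dx) (hc x cx dx) addr0.
Qed.

Lemma testZ c z h : test c h -> test c (fun x => z * h x).
Proof. move=> [dc Hh hc]; split; [exact: dc|exact: (H1locZ z Hh)|].
by move=> x cx dx; rewrite (hc x cx dx) mulr0. Qed.

Lemma test0 c : dom c -> test c (fun=> 0).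
Proof. by move=> dc; split => //; exact: H1loc_cst. Qed.

Lemma test_descent a c : 0 <= a -> a < c -> dom c -> test c (descent a c).
Proof.
by move=> a0 ac dc; split => // [|x cx _]; [exact: H1_descent|rewrite descent_high].
Qed.

Lemma cderiv_shift g z x : cderiv (fun t => g t + z) x = cderiv g x.
Proof.
have H (u : R -> R) k : derive1 (fun t => u t + k) x = derive1 u x.
  rewrite /derive1; suff -> : (fun t : R => t^-1 *: (u (t + x) + k - (u x + k))) = (fun t => t^-1 *: (u (t + x) - u x)) by [].
  by apply/funext => t; congr (_ *: _); rewrite opprD addrACA subrr addr0.
have hr : (fun t => Re (g t + z)) = (fun t => Re (g t) + Re z).
  by apply/funext => t; case: (g t) => p q; case: (z).
have hi : (fun t => Im (g t + z)) = (fun t => Im (g t) + Im z).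
  by apply/funext => t; case: (g t) => p q; case: (z).
by rewrite /cderiv hr hi !H.
Qed.

Section state_theory.
Variables (a : R) (Om : (R -> C) -> C) (M : C -> C) (f : C -> R -> C).
Hypothesis S : state a Om M f.

Let da : dom a. Proof. exact: st_dom S. Qed.
Let a0 : 0 <= a. Proof. exact: dom0 da. Qed.

Lemma state_zero c : dom c -> Om (fun=> 0) = 0.
Proof. by move=> dc; apply: (st_supp S (test0 dc)). Qed.

Lemma stateZ z c h : test c h -> Om (fun x => z * h x) = z * Om h.
Proof.
move=> th; have [dc _ _] := th.
rewrite -[RHS]addr0 -(state_zero dc) -(st_lin S z th (test0 dc)).
by congr Om; apply/funext => x; rewrite addr0.
Qed.

Lemma stateD c g h : test c g -> test c h -> Om (fun x => g x + h x) = Om g + Om h.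
Proof.
move=> tg th; rewrite -[Om g]mul1r -(st_lin S 1 tg th).
by congr Om; apply/funext => x; rewrite mul1r.
Qed.

Lemma state_eq_on c g h : test c g -> test c h ->
  (forall x, a <= x -> dom x -> g x = h x) -> Om g = Om h.
Proof.
move=> tg th gh; have := st_lin S (-1) tg th.
rewrite (st_supp S (testD (testZ (-1) tg) th)); last first.
  by move=> x ax dx; rewrite gh// mulN1r addNr.
by rewrite mulN1r addrC => /eqP; rewrite eq_sym subr_eq0 => /eqP.
Qed.

Lemma test_clamp c h : a <= c -> test c h -> test c (h \o clamp a c).
Proof.
move=> ac [dc Hh hc]; split; [exact: dc|exact: (H1loc_clamp Hh a0 ac dc)|].
by move=> x cx _; rewrite /comp (clamp_high ac cx) (hc c (lexx c) dc).
Qed.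

(** Om does not see the values to the left of a, so h may be replaced by its clamp, which is
    constant there and has no energy on [0,a]. *)
Lemma state_bounded c : a <= c -> dom c -> exists2 B : R, 0 <= B &
  forall h, test c h -> normc (Om h) ^+ 2 <= B * cenergy h a c.
Proof.
move=> ac dc; have [B B0 HB] := st_bounded S dc; exists B => // h th.
have [_ Hh hc] := th; have tk := test_clamp ac th; have [_ Hk kc] := tk.
rewrite -(state_eq_on tk th); last first.
  move=> x ax dx /=; have [xc|cx] := leP x c; first by rewrite clamp_id// ax.
  by rewrite clamp_high ?(ltW cx)// !hc// ltW.
apply: le_trans (HB _ tk) _; rewrite (cenergy_split Hk (lexx 0) a0 ac dc).
rewrite (cenergy0 Hk (lexx 0) a0 da) ?add0r; last first.
  by move=> x /andP[_ xa]; exact: cderiv_clamp_low.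
suff -> : cenergy (h \o clamp a c) a c = cenergy h a c by exact: lexx.
by apply: (eq_cenergy Hk Hh a0 ac dc) => x xac; exact: cderiv_clamp.
Qed.

Lemma exists_dom_right : exists2 c, a < c & dom c.
Proof.
case: da => _; case: L => [l| |] //= al.
  rewrite lte_fin in al; exists ((a + l) / 2); first by lra.
  by split; rewrite ?lte_fin; have := a0; lra.
by have := a0; exists (a + 1); [lra|split; [lra|rewrite ltry]].
Qed.

Let truncation_energy g c eta : H1 g -> 0 < eta -> a + eta <= c -> dom c ->
  cenergy (fun x => g x + -1 * (g \o clamp (a + eta) c) x) a (a + eta) = cenergy g a (a + eta).
Proof.
have a0' := a0; move=> Hg e0 ec dc; have de : dom (a + eta) by apply: (domS dc) => //; lra.
have ae : a <= a + eta by lra.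
have Hk : H1 (g \o clamp (a + eta) c) by apply: H1loc_clamp => //; lra.
apply: (eq_cenergy (H1locD Hg (H1locZ (-1) Hk)) Hg a0 ae de) => x /andP[ax xe].
rewrite -(cderiv_shift g (-1 * g (a + eta))); apply: (cderiv_eq_oo (a := a) (b := a + eta)).
  by move=> t /andP[_ te]; rewrite /comp clamp_low// ltW.
by rewrite ax xe.
Qed.

Lemma normc_conj_mul (w : C) : w^*%C * w = (normc w ^+ 2)%:C.
Proof.
rewrite normc_sqr; case: w => x y; apply/eqP; rewrite eq_complex /=.
by apply/andP; split; apply/eqP; ring.
Qed.

Let normalised_test (d B c e : R) h : 0 < d -> 0 < e -> a + e <= c -> dom c ->
  (forall h, test c h -> normc (Om h) ^+ 2 <= B * cenergy h a c) ->
  test (a + e) h -> d * cenergy h a (a + e) < normc (Om h) ^+ 2 ->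
  exists g, [/\ test (a + e) g, cenergy g a (a + e) = 1 & Num.sqrt d < Re (Om g)].
Proof.
have a0' := a0; move=> d0 e0 ec dc HB th lh.
have sdd : Num.sqrt d ^+ 2 = d by rewrite sqr_sqrtr// ltW.
have de : dom (a + e) by apply: (domS dc) => //; lra.
have ae : a <= a + e by lra.
have [_ Hh hc] := th; have th' := testS ec dc th.
set E0 := cenergy h a (a + e) in lh; set w := Om h in lh.
have w0 : 0 < normc w ^+ 2 by apply: le_lt_trans lh; rewrite mulr_ge0 ?cenergy_ge0// ltW.
have E00 : 0 < E0.
  rewrite lt_neqAle cenergy_ge0 andbT; apply/negP => /eqP E0z.
  have := HB _ th'; rewrite (cenergy_vanish Hh hc a0 ae ec dc) -/E0 -E0z mulr0.
  by rewrite leNgt w0.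
have nw : 0 < normc w.
  by rewrite lt_neqAle normc_ge0 andbT; apply: contraTneq w0 => <-; rewrite expr0n ltxx.
have sE : 0 < Num.sqrt E0 by rewrite sqrtr_gt0.
(* The factor rotates Om h onto the positive half-axis and normalises the energy. *)
pose q : C := (normc w * Num.sqrt E0)%:C^-1 * w^*%C.
exists (fun x => q * h x); split; first exact: testZ.
  rewrite (cenergyZ _ Hh a0 ae de) -/E0.
  rewrite /q normcM normcJ ComplexField.Normc.normcV normc_real ger0_norm; last by rewrite mulr_ge0 ?ltW.
  rewrite -{2}[E0](sqr_sqrtr (ltW E00)); field.
  by rewrite !gt_eqF.
rewrite (stateZ q th') -/w /q -mulrA normc_conj_mul -fmorphV -rmorphM /=.
have -> : (normc w * Num.sqrt E0)^-1 * normc w ^+ 2 = normc w / Num.sqrt E0.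
  by field; rewrite !gt_eqF.
rewrite ltr_pdivlMr// -(ltr_pXn2r (n := 2))// ?nnegrE ?normc_ge0 ?mulr_ge0 ?sqrtr_ge0//.
by rewrite exprMn sdd sqr_sqrtr ?(ltW E00).
Qed.

(** g is made constant up to a + eta. The removed part has the energy of g on [a, a + eta], which is
    small, so Om changes by little; [dl] is chosen such that the loss stays within the slack Re (Om
    g) - s. The interval [a, a + eta] is then free for the next function of the pile. *)
Let truncated_test (B c e s : R) g : 0 <= B -> 0 < e -> a + e <= c -> dom c ->
  (forall h, test c h -> normc (Om h) ^+ 2 <= B * cenergy h a c) ->
  test (a + e) g -> cenergy g a (a + e) = 1 -> s < Re (Om g) ->
  exists eta k, [/\ 0 < eta <= e, test c k, (forall x, a + e <= x -> dom x -> k x = 0),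
    (forall x, x <= a + eta -> k x = k a) & cenergy k a (a + e) <= 1 /\ s <= Re (Om k)].
Proof.
have a0' := a0; move=> B0 e0 ec dc HB tg Eg Omg.
have ae : a <= a + e by lra.
have de : dom (a + e) by exact: (domS dc (le_trans a0 ae) ec).
have [_ Hg gz] := tg; have tg' := testS ec dc tg.
have B1 : 0 < B + 1 by lra.
pose dl := ((Re (Om g) - s) ^+ 2) / (B + 1).
have dl0 : 0 < dl by rewrite divr_gt0// exprn_gt0// subr_gt0.
have [e1 e10 He1] := cenergy_continuous Hg dc dl0.
have [eta [eta0 etae etae1]] : exists eta, [/\ 0 < eta, eta <= e & eta < e1].
  exists (Num.min (e1 / 2) e); split.
  - by rewrite lt_min e0 andbT divr_gt0.
  - by rewrite ge_min lexx orbT.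
  - by apply: (@le_lt_trans _ _ (e1 / 2)); [rewrite ge_min lexx|lra].
have etac : a + eta <= c by lra.
have aee : a <= a + eta by lra.
have ee : a + eta <= a + e by lra.
have ae0 : 0 <= a + eta by lra.
have deta : dom (a + eta) by exact: (domS dc ae0 etac).
pose k := g \o clamp (a + eta) c.
have Hk : H1 k by exact: (H1loc_clamp Hg ae0 etac dc).
have kz x : a + e <= x -> dom x -> k x = 0.
  move=> ex dx; rewrite /k /comp.
  have [xc|cx] := leP x c; first by rewrite clamp_id ?gz// xc andbT; exact: le_trans ex.
  by rewrite clamp_high// ?(ltW cx)// gz.
have tk : test c k.
  by split; [exact: dc|exact: Hk|move=> x cx dx; apply: kz => //; exact: le_trans cx].
exists eta, k; split.
- by rewrite eta0.
- exact: tk.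
- exact: kz.
- by move=> x xa; rewrite /k /comp !clamp_low.
split.
  rewrite -Eg (cenergy_split Hk a0 aee ee de) (cenergy_split Hg a0 aee ee de).
  rewrite (cenergy0 Hk a0 aee deta); last first.
    by move=> x /andP[_ xe]; exact: cderiv_clamp_low.
  rewrite add0r.
  have <- : cenergy k (a + eta) (a + e) = cenergy g (a + eta) (a + e).
    apply: (eq_cenergy Hk Hg ae0 ee de) => x /andP[h1 h2]; apply: cderiv_clamp.
    by rewrite h1; exact: lt_le_trans ec.
  by rewrite lerDr cenergy_ge0.
pose u x := g x + -1 * k x.
have tu : test (a + eta) u.
  split; [exact: deta|exact: (H1locD Hg (H1locZ (-1) Hk))|move=> x ex dx].
  rewrite /u /k /comp; have [xc|cx] := leP x c.
    by rewrite clamp_id ?mulN1r ?subrr// ex xc.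
  by rewrite clamp_high ?(ltW cx)// !gz ?mulr0 ?addr0//; exact: le_trans (ltW cx).
have h1 : normc (Om u) ^+ 2 <= B * dl.
  have [_ Hu uc] := tu.
  apply: le_trans (HB _ (testS etac dc tu)) _; apply: ler_wpM2l => //.
  rewrite (cenergy_vanish Hu uc a0 aee etac dc) (truncation_energy Hg eta0 etac dc).
  by apply/ltW/He1 => //; lra.
have h2 : B * dl <= (Re (Om g) - s) ^+ 2.
  rewrite /dl mulrA ler_pdivrMr// mulrC ler_wpM2l ?sqr_ge0//.
  by rewrite lerDl.
have h3 : normc (Om u) <= Re (Om g) - s.
  rewrite -(ler_pXn2r (n := 2))// ?nnegrE ?normc_ge0 ?(le_trans h1)//.
  by rewrite subr_ge0 ltW.
have h4 : Re (Om u) = Re (Om g) - Re (Om k).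
  rewrite /u (stateD tg' (testZ (-1) tk)) (stateZ (-1) tk) mulN1r.
  by case: (Om g) (Om k) => ? ? [].
have h5 : Re (Om u) <= Re (Om g) - s.
  by apply: le_trans h3; apply: le_trans (Re_le_normc _); exact: ler_norm.
by move: h5; rewrite h4 lerD2l lerN2.
Qed.

(** In terms of h', Om is a bounded functional on L^2, and such functionals have small norm on
    functions carried by a short interval. This keeps Om from contributing to the leading growth of
    M along the imaginary axis. *)
Lemma st_small (d : R) : 0 < d -> exists2 e : R, 0 < e & dom (a + e) /\
  forall h, test (a + e) h -> normc (Om h) ^+ 2 <= d * cenergy h a (a + e).
Proof.
have a0' := a0.
move=> d0; apply: contrapT => Hno.
have bad e : 0 < e -> dom (a + e) -> exists2 h, test (a + e) h &
    d * cenergy h a (a + e) < normc (Om h) ^+ 2.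
  move=> e0 de; apply: contrapT => H; apply: Hno; exists e => //; split => // h th.
  by rewrite leNgt; apply/negP => lt; apply: H; exists h.
have [c0 ac0 dc0] := exists_dom_right.
have [B B0 HB] := state_bounded (ltW ac0) dc0.
have sd0 : 0 < Num.sqrt d by rewrite sqrtr_gt0.
(* Test functions with almost disjoint derivatives: the energies add up while
   the values of Om grow linearly. *)
have pile n : exists (e : R) G, [/\ 0 < e, a + e <= c0, test c0 G, (forall x, a <= x <= a + e -> G x = G a) &
    n%:R * Num.sqrt d <= Re (Om G) /\ cenergy G a c0 <= n%:R].
  elim: n => [|n [e [G [e0 ec tG Gc [OmG EG]]]]].
    exists (c0 - a), (fun=> 0); split; [lra|lra|exact: test0|by []|].
    rewrite (state_zero dc0) mul0r lexx; split => //.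
    rewrite (cenergy0 (@H1loc_cst R L 0) a0 (ltW ac0) dc0)//.
    by move=> x _; exact: cderiv_cst.
  have ae : a <= a + e by lra.
  have ae0 : 0 <= a + e by lra.
  have de : dom (a + e) by exact: (domS dc0 ae0 ec).
  have [g0 tg0 lg0] := bad e e0 de.
  have [g [tg Eg Omg]] := normalised_test d0 e0 ec dc0 HB tg0 lg0.
  have [eta [k [/andP[eta0 etae] tk kz kc [Ek Omk]]]] := truncated_test B0 e0 ec dc0 HB tg Eg Omg.
  clear g0 tg0 lg0 g tg Eg Omg.
  have aee : a + eta <= a + e by rewrite lerD2l.
  have [_ HG _] := tG; have [_ Hk _] := tk; have HGk := H1locD HG Hk.
  exists eta, (fun x => G x + k x); split.
  - exact: eta0.
  - exact: le_trans ec.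
  - exact: testD.
  - move=> x /andP[h1 h2]; rewrite Gc; last by rewrite h1 (le_trans h2).
    by rewrite (kc x h2).
  - rewrite (stateD tG tk); split.
      rewrite -natr1 mulrDl mul1r.
      have -> : Re (Om G + Om k) = Re (Om G) + Re (Om k) by case: (Om G) (Om k) => ? ? [].
      exact: lerD.
    rewrite (cenergy_split HGk a0 ae ec dc0).
    have -> : cenergy (fun x => G x + k x) a (a + e) = cenergy k a (a + e).
      apply: (eq_cenergy HGk Hk a0 ae de) => x xae; rewrite -(cderiv_shift k (G a)).
      apply: (cderiv_eq_oo (a := a) (b := a + e)) => // t /andP[t1 t2].
      by rewrite [RHS]addrC (Gc t)// !ltW.
    have -> : cenergy (fun x => G x + k x) (a + e) c0 = cenergy G (a + e) c0.
      apply: (eq_cenergy HGk HG ae0 ec dc0) => x xae.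
      apply: (cderiv_eq_oo (a := a + e) (b := c0)) => // t /andP[t1 t2].
      rewrite (kz t) ?addr0 ?(ltW t1)//; apply: (domS dc0); last exact: ltW.
      by apply: le_trans (ltW t1).
    rewrite -natr1 addrC; apply: lerD => //; apply: le_trans EG.
    exact: (cenergy_le HG a0 ae ec (lexx c0) dc0).
have sdd : Num.sqrt d ^+ 2 = d by rewrite sqr_sqrtr// ltW.
(* The pile has value at least n sqrt(d) and energy at most n, so boundedness forces n d <= B; this
   n violates it. *)
pose n := (Num.truncn (B / d)).+1.
have nB : B / d < n%:R by exact: truncnS_gt.
have [e [G [_ _ tG _ [h1 h2]]]] := pile n.
have n0 : 0 < n%:R :> R by rewrite ltr0n.
have h3 : (n%:R * Num.sqrt d) ^+ 2 <= B * n%:R.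
  apply: (@le_trans _ _ (normc (Om G) ^+ 2)).
    rewrite ler_pXn2r ?nnegrE ?normc_ge0 ?mulr_ge0 ?sqrtr_ge0//.
    apply: (le_trans h1); apply: le_trans (Re_le_normc _); exact: ler_norm.
  by apply: le_trans (HB _ tG) _; apply: ler_wpM2l.
rewrite exprMn sdd expr2 -mulrA [B * _]mulrC (ler_pM2l n0) in h3.
by move: nB; rewrite ltr_pdivrMr// ltNge h3.
Qed.

Lemma st_ups_point z c : nonreal z -> a <= c -> dom c ->
  cenergy (f z) a c / normc z ^+ 2 + sqnorm ups `]a, c]%classic (f z) <=
  Im (M z) / Im z - fine (ups [set a]).
Proof.
move=> nz ac dc; have := st_energy S nz ac dc.
rewrite (sqnorm_ups_point ups_fin (st_H1 S nz) a0 ac dc) (st_norm S nz).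
by rewrite ComplexField.Normc.normc1 expr1n mulr1; lra.
Qed.

(** The intervals shrink to the empty set because a itself is excluded: continuity of the measure
    from above. *)
Lemma ups_right_small d : 0 < d -> exists2 e : R, 0 < e & dom (a + e) /\
  fine (ups `]a, (a + e)%R]%classic) <= d.
Proof.
have a0' := a0; move=> d0; have [c ac dc] := exists_dom_right.
pose r n := (c - a) / n.+1%:R.
have r0 n : 0 < r n by rewrite divr_gt0 ?subr_gt0.
have rn n m : (n <= m)%N -> r m <= r n.
  by move=> nm; rewrite ler_wpM2l ?subr_ge0 ?(ltW ac)// lef_pV2 ?posrE// ler_nat ltnS.
have rc n : a + r n <= c.
  have := rn 0%N n isT; rewrite {1}/r => h.
  have -> : c = a + r 0%N by rewrite /r divr1 addrC subrK.
  by rewrite lerD2l.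
pose F n : set (measurableTypeR R) := `]a, (a + r n)%R]%classic.
have mF n : measurable (F n) by exact: measurable_itv.
have Fc n : F n `<=` `[0, c]%classic.
  move=> x; rewrite /F /= !in_itv/= => /andP[h1 h2]; apply/andP; split.
    by apply: le_trans (ltW h1).
  exact: le_trans (rc n).
have Fi : \bigcap_n F n = set0.
  apply/seteqP; split => // x Fx /=; have := Fx 0%N I; rewrite /F /= in_itv/= => /andP[ax _].
  pose n := Num.truncn ((c - a) / (x - a)).
  have := Fx n I; rewrite /F /= in_itv/= => /andP[_]; rewrite -lerBlDl leNgt => /negP; apply.
  rewrite /r ltr_pdivrMr// mulrC -ltr_pdivrMr ?subr_gt0//; exact: truncnS_gt.
have Fni : nonincreasing_seq F.
  move=> n m nm; apply/subsetPset => x; rewrite /F /= !in_itv/= => /andP[-> h] /=.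
  by apply: (le_trans h); rewrite lerD2l rn.
have := nonincreasing_cvg_mu (ups_itv_fin ups_fin dc (mF 0%N) (Fc 0%N)) mF
  (bigcapT_measurable mF) Fni.
rewrite Fi measure0 => /fine_cvgP[_ cv].
have [n _ Hn] : \forall n \near \oo, (fine \o (ups \o F)) n < d := cvgr_lt _ cv d d0.
exists (r n); [exact: r0|split; last by have := Hn n (leqnn n); rewrite /= => /ltW].
apply: (domS dc); last exact: rc.
by rewrite addr_ge0// ltW.
Qed.

Lemma imaginary_nonreal (y : R) : y != 0 -> nonreal (0 +i* y : C).
Proof. by []. Qed.

Lemma normc_imaginary (y : R) : 0 <= y -> normc (0 +i* y : C) = y.
Proof. by move=> y0; rewrite /= expr0n /= add0r sqrtr_sqr ger0_norm. Qed.

(** The equation is tested with the cut-off [descent a (a + e)]. All terms other than those at a are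
    bounded through the energy, hence through T, and T is at most y^2 X: this closes up to a
    quadratic inequality for X. In 18 = 3 * 6 and 12 = 3 * 4 the factor 3 comes from squaring a sum
    of three terms, the others from [Ob], [Db] and [Ib]. *)
Lemma M_over_z_bound (d u e y : R) : 0 < d -> 0 < e -> 0 < y -> dom (a + e) ->
  (forall h, test (a + e) h -> normc (Om h) ^+ 2 <= d * cenergy h a (a + e)) ->
  fine (ups `]a, (a + e)%R]%classic) <= u ->
  forall z X, z = 0 +i* y -> X = normc (M z - z * (fine (ups [set a]))%:C) / y ->
  X ^+ 2 <= X * (18 * d + 12 * u + 12 / (e * y ^+ 2)) + 12 * d / (e * y ^+ 2).
Proof.
have a0' := a0; move=> d0 e0 y0 de Hd Hu z X zE XE.
have ae : a < a + e by lra.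
have nz : nonreal z by rewrite zE; apply: imaginary_nonreal; rewrite gt_eqF.
have Hf := st_H1 S nz.
have nzy : normc z = y by rewrite zE normc_imaginary// ltW.
set v := fine (ups [set a]) in XE *.
(* This is |z|^2 times the right side of the energy inequality after the atom at a has been
   subtracted. *)
pose T := y * Im (M z - z * v%:C).
have ImT : Im (M z - z * v%:C) = Im (M z) - y * v.
  by rewrite zE; case: (M _) => p q /=; ring.
have TX : T <= y ^+ 2 * X.
  rewrite /T XE expr2 -mulrA ler_pM2l// mulrCA mulfV ?gt_eqF// mulr1.
  exact: le_trans (ler_norm _) (Im_le_normc _).
have := st_ups_point nz (ltW ae) de; rewrite nzy -/v.
set E := cenergy _ _ _; set s := sqnorm _ _ _ => ET.
have E0 : 0 <= E by exact: cenergy_ge0.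
have s0 : 0 <= s by exact: sqnorm_ge0.
have y20 : 0 < y ^+ 2 by rewrite exprn_gt0.
have ETs : E + y ^+ 2 * s <= T.
  rewrite /T ImT; have -> : y * (Im (M z) - y * v) = y ^+ 2 * (Im (M z) / y - v).
    by field; rewrite gt_eqF.
  have -> : E + y ^+ 2 * s = y ^+ 2 * (E / y ^+ 2 + s) by field; rewrite gt_eqF.
  by rewrite ler_pM2l//; move: ET; have -> : Im z = y by rewrite zE.
have [_ Hchi chiv] := test_descent a0 ae de.
pose h := descent a (a + e).
have th : test (a + e) h := test_descent a0 ae de.
have chi1 : h a = 1 by exact: descent_low.
have eq := st_eq S nz th (ltW ae).
rewrite (cintegral_ups_point ups_fin Hf Hchi a0 (ltW ae) de) -/h chi1 (st_norm S nz) mulr1 -/v in eq.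
rewrite mulr1 in eq.
set O := Om _ in eq; set I := cintegral ups _ _ in eq; set D := cdot _ _ _ _ in eq.
have eq' : z * (M z - z * v%:C) = z * O + (z ^+ 2 * I - D).
  have -> : z * (M z - z * v%:C) = z * M z + D - D - z ^+ 2 * v%:C by ring.
  by rewrite eq; ring.
have X0 : 0 <= X by rewrite XE divr_ge0 ?normc_ge0// ltW.
have Eh : cenergy h a (a + e) = e^-1.
  by rewrite (cenergy_descent a0 ae de); congr (_^-1); ring.
have u0 : 0 <= u by apply: le_trans Hu; rewrite fine_ge0.
have ET' : E <= T by apply: le_trans ETs; rewrite lerDl mulr_ge0// ltW.
have sT : y ^+ 2 * s <= T by apply: le_trans ETs; rewrite lerDr.
have Ob : normc O ^+ 2 <= d * (6 * T + 4 / e).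
  apply: le_trans (Hd _ (testM Hf th)) _; apply: ler_wpM2l; first exact: ltW.
  have hb x : a <= x <= a + e -> normc (h x) <= 1.
    move=> _; have /andP[h1 h2] := descent_bound x ae.
    by rewrite /h /descent normc_real ger0_norm.
  have fb x : a <= x <= a + e -> normc (f z x) <= 1 + Num.sqrt (e * E).
    move=> /andP[ax xe]; rewrite -{1}[f z x](subrK 1) addrC.
    apply: le_trans (normcD _ _) _; rewrite ComplexField.Normc.normc1 lerD2l.
    rewrite -(ler_pXn2r (n := 2))// ?nnegrE ?normc_ge0 ?sqrtr_ge0//.
    rewrite sqr_sqrtr; last by rewrite mulr_ge0// ltW.
    rewrite -(st_norm S nz); have dx : dom x by apply: (domS de) => //; exact: le_trans ax.
    apply: le_trans (H1loc_increment Hf a0 ax dx) _; apply: ler_pM.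
    - by rewrite subr_ge0.
    - exact: cenergy_ge0.
    - by rewrite lerBlDl.
    - exact: (cenergy_le Hf a0 (lexx a) ax xe de).
  apply: le_trans (cenergyM Hf Hchi a0 (ltW ae) de fb hb) _.
  rewrite -/h Eh -/E expr1n mul1r.
  have eE0 : 0 <= e * E by rewrite mulr_ge0// ltW.
  have q2 : (1 + Num.sqrt (e * E)) ^+ 2 <= 2 + 2 * (e * E).
    have := sqr_ge0 (1 - Num.sqrt (e * E)); have := sqr_sqrtr eE0.
    by move: (Num.sqrt _) => q; rewrite !expr2 => qq; rewrite -qq; lra.
  have : (1 + Num.sqrt (e * E)) ^+ 2 / e <= (2 + 2 * (e * E)) / e by rewrite ler_pM2r// invr_gt0.
  have -> : (2 + 2 * (e * E)) / e = 2 / e + 2 * E by field; rewrite gt_eqF.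
  by move: ET'; lra.
have sE (r : R) : 0 <= r -> Num.sqrt r ^+ 2 = r by exact: sqr_sqrtr.
have Db : normc D ^+ 2 <= 4 * T / e.
  have h1 : normc D ^+ 2 <= (2 * (Num.sqrt E * Num.sqrt e^-1)) ^+ 2.
    rewrite ler_pXn2r// ?nnegrE ?normc_ge0 ?mulr_ge0 ?sqrtr_ge0//.
    by rewrite -Eh; exact: (cdot_CS Hf Hchi a0 de).
  apply: (le_trans h1); rewrite !exprMn !sE ?invr_ge0 ?(ltW e0)// mulrA.
  rewrite ler_pM2r ?invr_gt0// expr2; have -> : 2 * 2 = 4 :> R by ring.
  by rewrite ler_pM2l.
have Ib : y ^+ 2 * normc I ^+ 2 <= 4 * T * u.
  have sub : `]a, (a + e)%R]%classic `<=` `[0, (a + e)%R]%classic.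
    by move=> x; rewrite /= !in_itv/= => /andP[h1 ->]; rewrite (le_trans a0 (ltW h1)).
  have mI : measurable (`]a, (a + e)%R]%classic : set (measurableTypeR R)) by exact: measurable_itv.
  have hu : sqnorm ups `]a, (a + e)%R]%classic h <= u.
    apply: le_trans Hu; rewrite -[leRHS]mul1r -[1 in leRHS](expr1n _ 2).
    rewrite -(sqnorm_ups_cst ups_fin 1 de mI sub).
    apply: (sqnorm_ups_mono ups_fin Hchi (@H1loc_cst R L 1%:C) de mI sub) => x _.
    have /andP[h1 h2] := descent_bound x ae.
    by rewrite /h /descent !normc_real normr1 ger0_norm.
  have h1 : normc I ^+ 2 <= (2 * (Num.sqrt s * Num.sqrt u)) ^+ 2.
    rewrite ler_pXn2r// ?nnegrE ?normc_ge0 ?mulr_ge0 ?sqrtr_ge0//.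
    apply: le_trans (L2_CS mI (L2_ups ups_fin Hf de mI sub) (L2_ups ups_fin Hchi de mI sub)) _.
    by rewrite ler_pM2l// ler_wpM2l ?sqrtr_ge0// ler_sqrt.
  have e4 : (2 * (Num.sqrt s * Num.sqrt u)) ^+ 2 = 4 * (s * u).
    by rewrite !exprMn !sE//; ring.
  rewrite e4 in h1; apply: le_trans (ler_wpM2l (ltW y20) h1) _.
  have -> : y ^+ 2 * (4 * (s * u)) = 4 * (y ^+ 2 * s * u) by ring.
  by rewrite -[leRHS]mulrA ler_pM2l// ler_wpM2r.
have main : (y ^+ 2 * X) ^+ 2 <= T * (y ^+ 2 * (18 * d + 12 * u) + 12 / e) + 12 * d * y ^+ 2 / e.
  have -> : y ^+ 2 * X = normc (z * O + (z ^+ 2 * I - D)).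
    by rewrite -eq' normcM nzy XE; field; rewrite gt_eqF.
  have n1 := normcD (z * O) (z ^+ 2 * I - D); have n2 := normcD (z ^+ 2 * I) (- D).
  rewrite cnormN in n2; rewrite !normcM !nzy -/(normc D) in n1 n2.
  rewrite -expr2 in n2.
  have n3 : normc (z * O + (z ^+ 2 * I - D)) <= y * normc O + y ^+ 2 * normc I + normc D.
    by rewrite -addrA; apply: (le_trans n1); rewrite lerD2l.
  have n4 : normc (z * O + (z ^+ 2 * I - D)) ^+ 2 <=
      3 * (y ^+ 2 * normc O ^+ 2 + y ^+ 2 * (y ^+ 2 * normc I ^+ 2) + normc D ^+ 2).
    have h5 : normc (z * O + (z ^+ 2 * I - D)) ^+ 2 <= (y * normc O + y ^+ 2 * normc I + normc D) ^+ 2.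
      rewrite ler_pXn2r// ?nnegrE ?normc_ge0 ?addr_ge0 ?mulr_ge0 ?normc_ge0 ?(ltW y0) ?(ltW y20)//.
    apply: (le_trans h5); rewrite -[y ^+ 2 * normc O ^+ 2]exprMn.
    have -> : y ^+ 2 * (y ^+ 2 * normc I ^+ 2) = (y ^+ 2 * normc I) ^+ 2 by ring.
    move: (y * normc O) (y ^+ 2 * normc I) (normc D) => p q r.
    have := sqr_ge0 (p - q); have := sqr_ge0 (q - r); have := sqr_ge0 (p - r).
    by rewrite !expr2; lra.
  apply: (le_trans n4).
  have m1 := ler_wpM2l (ltW y20) Ob; have m2 := ler_wpM2l (ltW y20) Ib.
  move: m1 m2 Db; set A := _ * normc O ^+ 2; set B := y ^+ 2 * (_ * _ ^+ 2); set G := normc D ^+ 2.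
  by lra.
have P0 : 0 <= y ^+ 2 * (18 * d + 12 * u) + 12 / e.
  by rewrite addr_ge0 ?divr_ge0 ?mulr_ge0 ?addr_ge0 ?mulr_ge0// ?ltW.
have y40 : 0 < (y ^+ 2) ^+ 2 by rewrite exprn_gt0.
rewrite -(ler_pM2l y40).
rewrite exprMn in main; apply: (le_trans main).
have -> : (y ^+ 2) ^+ 2 * (X * (18 * d + 12 * u + 12 / (e * y ^+ 2)) + 12 * d / (e * y ^+ 2)) =
  y ^+ 2 * X * (y ^+ 2 * (18 * d + 12 * u) + 12 / e) + 12 * d * y ^+ 2 / e.
  by field; rewrite !gt_eqF.
by rewrite lerD2r ler_wpM2r.
Qed.

(** That is, M(iy)/(iy) tends to the mass of upsilon at a. This determines b in every step and the
    last mass at the end. *)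
Lemma M_over_z_limit (e : R) : 0 < e -> exists Y : R, forall y, Y <= y -> 0 < y ->
  normc (M (0 +i* y) - (0 +i* y) * (fine (ups [set a]))%:C) / y <= e.
Proof.
(* With d = e/144 and u = e/96 the coefficient of X is e/8 + e/8 plus a term that is at most e/4 for
   large y, and the constant term is at most e^2/576; then X > e is impossible. *)
have a0' := a0; move=> e0; have [e1 e10 [de1 He1]] := @st_small (e / 144) ltac:(lra).
have [e2 e20 [de2 He2]] := @ups_right_small (e / 96) ltac:(lra).
pose e3 := Num.min e1 e2.
have e30 : 0 < e3 by rewrite lt_min e10.
have [h1 h2] : e3 <= e1 /\ e3 <= e2 by rewrite !ge_min !lexx orbT.
have de3 : dom (a + e3) by apply: (domS de1); rewrite ?lerD2l ?addr_ge0// ltW.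
exists (48 / (e3 * e) + 1) => y Yy y0.
have ae3 : a <= a + e3 by rewrite lerDl ltW.
have sub : `]a, (a + e2)%R]%classic `<=` `[0, (a + e2)%R]%classic.
  by move=> x; rewrite /= !in_itv/= => /andP[p ->]; rewrite (le_trans a0 (ltW p)).
have m2 : measurable (`]a, (a + e2)%R]%classic : set (measurableTypeR R)) by exact: measurable_itv.
have m3 : measurable (`]a, (a + e3)%R]%classic : set (measurableTypeR R)) by exact: measurable_itv.
have sub' : `]a, (a + e3)%R]%classic `<=` `]a, (a + e2)%R]%classic.
  move=> x; rewrite /= !in_itv/= => /andP[-> p] /=.
  by apply: (le_trans p); rewrite lerD2l.
have P1 h : test (a + e3) h -> normc (Om h) ^+ 2 <= e / 144 * cenergy h a (a + e3).
  move=> th; have [_ Hh hc] := th.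
  have e31 : a + e3 <= a + e1 by rewrite lerD2l.
  by have := He1 _ (testS e31 de1 th); rewrite (cenergy_vanish Hh hc a0 ae3 e31 de1).
have P2 : fine (ups `]a, (a + e3)%R]%classic) <= e / 96.
  apply: le_trans He2; apply: fine_le.
  - rewrite ge0_fin_numE//; exact: (ups_itv_fin ups_fin de2 m3 (subset_trans sub' sub)).
  - rewrite ge0_fin_numE//; exact: (ups_itv_fin ups_fin de2 m2 sub).
  - by apply: le_measure; rewrite ?inE.
have e144 : 0 < e / 144 by rewrite divr_gt0.
have := M_over_z_bound e144 e30 y0 de3 P1 P2 erefl erefl.
set X := _ / y.
have X0 : 0 <= X by rewrite divr_ge0 ?normc_ge0// ltW.
have ee : 0 < e3 * e by rewrite mulr_gt0.
have K1 : 12 / (e3 * y ^+ 2) <= e / 4.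
  rewrite ler_pdivrMr; last by rewrite mulr_gt0// exprn_gt0.
  have yy : 48 / (e3 * e) <= y ^+ 2.
    have k0 : 0 <= 48 / (e3 * e) by rewrite divr_ge0// ltW.
    have y1 : 1 <= y by apply: le_trans Yy; rewrite lerDr.
    rewrite expr2; apply: (@le_trans _ _ (1 * y)); last by rewrite ler_pM2r.
    by rewrite mul1r; apply: le_trans Yy; rewrite lerDl.
  rewrite ler_pdivrMr// in yy.
  have -> : e / 4 * (e3 * y ^+ 2) = y ^+ 2 * (e3 * e) / 4 by ring.
  by rewrite ler_pdivlMr//; apply: le_trans yy; lra.
have K2 : 12 * (e / 144) / (e3 * y ^+ 2) <= e ^+ 2 / 576.
  have -> : 12 * (e / 144) / (e3 * y ^+ 2) = e / 144 * (12 / (e3 * y ^+ 2)) by ring.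
  have -> : e ^+ 2 / 576 = e / 144 * (e / 4) by field.
  by rewrite ler_pM2l//; lra.
move=> XX; rewrite leNgt; apply/negP => eX.
have X1 : 0 < X := lt_trans e0 eX.
have h : X * (18 * (e / 144) + 12 * (e / 96) + 12 / (e3 * y ^+ 2)) <= X * (e / 2).
  by rewrite ler_pM2l//; lra.
have h' : e ^+ 2 < X * e by rewrite expr2 ltr_pM2r.
have h'' : X * e < X ^+ 2 by rewrite expr2 ltr_pM2l.
have e20' : 0 < e ^+ 2 by rewrite exprn_gt0.
have hh : X * (e / 2) = (X * e) / 2 by ring.
move: (lerD h K2) XX => /[swap] /le_trans /[apply]; rewrite hh.
by move: (X ^+ 2) (X * e) (e ^+ 2) h' h'' e20' => p q r; lra.
Qed.

End state_theory.
End states.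

(** * The leftmost gap of a string *)

Section complex_sequences.
Variable R : realType.
Local Notation C := R[i].
Local Notation normc := (@ComplexField.Normc.normc R).
Local Notation Re := (@complex.Re R).
Local Notation Im := (@complex.Im R).
Implicit Types (F G : nat -> C) (l m : C) (e : R).

Definition ctends F l := forall e, 0 < e ->
  exists N, forall n, (N <= n)%N -> normc (F n - l) <= e.

Lemma normc0_eq l : (forall e, 0 < e -> normc l <= e) -> l = 0.
Proof.
move=> H; apply: ComplexField.Normc.eq0_normc; apply/eqP; rewrite eq_le normc_ge0 andbT.
by apply/ler_addgt0Pr => e e0; rewrite add0r H.
Qed.

Lemma ctends_unique F l m : ctends F l -> ctends F m -> l = m.
Proof.
move=> Fl Fm; apply/eqP; rewrite -subr_eq0; apply/eqP/normc0_eq => e e0.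
have [N HN] := Fl (e / 2) ltac:(lra); have [N' HN'] := Fm (e / 2) ltac:(lra).
have h1 := HN (maxn N N') (leq_maxl _ _); have h2 := HN' (maxn N N') (leq_maxr _ _).
have -> : l - m = (F (maxn N N') - m) - (F (maxn N N') - l) by ring.
by apply: le_trans (normcD _ _) _; rewrite cnormN; lra.
Qed.

Lemma eq_ctends F G l : (forall n, F n = G n) -> ctends F l -> ctends G l.
Proof. by move=> FG; have -> : G = F by apply/funext => n; rewrite FG. Qed.

Lemma ctends_cst l : ctends (fun=> l) l.
Proof. by move=> e e0; exists 0%N => n _; rewrite subrr ComplexField.Normc.normc0 ltW. Qed.

Lemma ctendsD F G l m : ctends F l -> ctends G m -> ctends (fun n => F n + G n) (l + m).
Proof.
move=> Fl Gm e e0.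
have [N HN] := Fl (e / 2) ltac:(lra); have [N' HN'] := Gm (e / 2) ltac:(lra).
exists (maxn N N') => n; rewrite geq_max => /andP[h1 h2].
have := HN n h1; have := HN' n h2.
have -> : F n + G n - (l + m) = (F n - l) + (G n - m) by ring.
by have := normcD (F n - l) (G n - m); lra.
Qed.

Lemma ctends_bounded F l : ctends F l -> exists2 B : R, 0 < B &
  exists N, forall n, (N <= n)%N -> normc (F n) <= B.
Proof.
move=> Fl; exists (normc l + 1); first by rewrite ltr_wpDl ?normc_ge0.
have [N HN] := Fl 1 ltr01; exists N => n Nn; rewrite -[F n](subrK l).
by apply: le_trans (normcD _ _) _; rewrite addrC lerD2l HN.
Qed.

Lemma ctendsM F G l m : ctends F l -> ctends G m -> ctends (fun n => F n * G n) (l * m).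
Proof.
move=> Fl Gm e e0.
have [B B0 [N0 HB]] := ctends_bounded Fl.
have m1 : 0 < normc m + 1 by rewrite ltr_wpDl ?normc_ge0.
have [N HN] := Fl (e / 2 / (normc m + 1)) ltac:(by rewrite !divr_gt0).
have [N' HN'] := Gm (e / 2 / B) ltac:(by rewrite !divr_gt0).
exists (maxn N0 (maxn N N')) => n; rewrite !geq_max => /and3P[h0 h1 h2].
have -> : F n * G n - l * m = F n * (G n - m) + m * (F n - l) by ring.
apply: le_trans (normcD _ _) _; rewrite !normcM.
have -> : e = B * (e / 2 / B) + (normc m + 1) * (e / 2 / (normc m + 1)).
  by field; rewrite !gt_eqF.
apply: lerD; apply: ler_pM; rewrite ?normc_ge0 ?HB ?HN ?HN'//.
by rewrite lerDl.
Qed.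

Lemma ctendsZ a F l : ctends F l -> ctends (fun n => a * F n) (a * l).
Proof. exact: ctendsM (ctends_cst a). Qed.

Lemma ctendsN F l : ctends F l -> ctends (fun n => - F n) (- l).
Proof.
by move=> /(ctendsZ (-1)); rewrite mulN1r; apply: eq_ctends => n; rewrite mulN1r.
Qed.

Lemma ctendsB F G l m : ctends F l -> ctends G m -> ctends (fun n => F n - G n) (l - m).
Proof. by move=> Fl /ctendsN; exact: ctendsD. Qed.

Lemma ctendsV F l : l != 0 -> ctends F l -> ctends (fun n => (F n)^-1) l^-1.
Proof.
move=> l0 Fl e e0.
have nl : 0 < normc l.
  by rewrite lt_neqAle normc_ge0 andbT; apply: contra l0 => /eqP/esym/ComplexField.Normc.eq0_normc ->.
pose d := Num.min (normc l / 2) (e * (normc l ^+ 2 / 2)).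
have d0 : 0 < d by rewrite lt_min !(divr_gt0, mulr_gt0, exprn_gt0).
have [N HN] := Fl d d0; exists N => n /HN h.
have [h1 h2] : normc (F n - l) <= normc l / 2 /\ normc (F n - l) <= e * (normc l ^+ 2 / 2).
  by split; apply: (le_trans h); rewrite ge_min lexx ?orbT.
have Fn : normc l / 2 <= normc (F n).
  have := normcD (F n) (l - F n); rewrite addrC subrK => h3.
  by move: h1; rewrite -cnormN opprB; lra.
have Fn0 : 0 < normc (F n) by apply: lt_le_trans Fn; rewrite divr_gt0.
have F0 : F n != 0 by apply: contraTneq Fn0 => ->; rewrite ComplexField.Normc.normc0 ltxx.
have -> : (F n)^-1 - l^-1 = - (F n - l) * ((F n)^-1 * l^-1) by field; rewrite F0 l0.
rewrite !normcM !ComplexField.Normc.normcV cnormN -invfM ler_pdivrMr ?mulr_gt0//.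
apply: (le_trans h2); rewrite ler_pM2l//; rewrite expr2 mulrAC ler_wpM2r//.
exact: ltW.
Qed.

(** All limits at infinity are taken along this sequence on the imaginary axis; the successor keeps
    it off the real line. *)
Definition iz n : C := 0 +i* n.+1%:R.

Lemma iz_nonreal n : nonreal (iz n).
Proof. by rewrite /nonreal /= pnatr_eq0. Qed.

Lemma iz_neq0 n : iz n != 0.
Proof. by apply/eqP => /(congr1 Im)/eqP; rewrite (negbTE (iz_nonreal n)). Qed.

Lemma normc_iz n : normc (iz n) = n.+1%:R.
Proof. by rewrite /= expr0n /= add0r sqrtr_sqr ger0_norm. Qed.

Lemma ctends_izV : ctends (fun n => (iz n)^-1) 0.
Proof.
move=> e e0; exists (Num.truncn e^-1) => n Nn.
rewrite subr0 ComplexField.Normc.normcV normc_iz -[e]invrK lef_pV2 ?posrE ?invr_gt0//.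
apply: ltW; apply: lt_le_trans (truncnS_gt _) _; by rewrite ler_nat ltnS.
Qed.

Lemma linear_bound_zero (p K : R) N : 0 <= p -> (forall n, (N <= n)%N -> p * n.+1%:R <= K) -> p = 0.
Proof.
move=> p0 H; apply/eqP; rewrite eq_le p0 andbT leNgt; apply/negP => pp.
pose n := maxn N (Num.truncn (K / p)).
have := H n (leq_maxl _ _); rewrite leNgt => /negP; apply.
rewrite mulrC -ltr_pdivrMr//; apply: lt_le_trans (truncnS_gt _) _.
by rewrite ler_nat ltnS leq_maxr.
Qed.

End complex_sequences.

(** * The first gap: upsilon, omega and the solution on it *)

Section gap.
Variables (R : realType) (L : \bar R) (ups : {measure set (measurableTypeR R) -> \bar R}).
Hypothesis ups_fin : forall c, halfopen L c -> (ups `[0%R, c]%classic < +oo)%E.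
Local Notation C := R[i].
Local Notation normc := (@ComplexField.Normc.normc R).
Local Notation Re := (@complex.Re R).
Local Notation Im := (@complex.Im R).
Local Notation dom := (halfopen L).
Local Notation H1 := (@H1loc R L).
Local Notation test := (test L).
Local Notation state := (state L ups).
Local Notation iz := (@iz R).
Implicit Types (g h : R -> C) (c x y e eta : R) (z : C).

Variables (a : R) (Om : (R -> C) -> C) (M : C -> C) (f : C -> R -> C) (b c0 s0 : R).
Hypothesis S : state a Om M f.

Definition remainder z : C := - (z * (M z - b%:C * z - c0%:C)).

Hypothesis asym : ctends (fun n => remainder (iz n)) s0%:C.

Let da : dom a. Proof. exact: st_dom S. Qed.
Let a0 : 0 <= a. Proof. exact: dom0 da. Qed.

Lemma remainderE z : z != 0 -> M z = b%:C * z + c0%:C - remainder z / z.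
Proof. by move=> z0; rewrite /remainder; field. Qed.

(** M(z)/z along [iz] tends to b by the expansion and to the mass at a by [M_over_z_limit]. *)
Lemma ups_atom : fine (ups [set a]) = b.
Proof.
have e1 : ctends (fun n => (M (iz n) - iz n * (fine (ups [set a]))%:C) / iz n)
    ((b%:C - (fine (ups [set a]))%:C) + c0%:C * 0 - s0%:C * (0 * 0)).
  apply: (eq_ctends (F := fun n => (b%:C - (fine (ups [set a]))%:C) + c0%:C * (iz n)^-1 -
      remainder (iz n) * ((iz n)^-1 * (iz n)^-1))).
    by move=> n; rewrite [M _]remainderE ?iz_neq0//; field; exact: iz_neq0.
  apply: ctendsB; last by apply: ctendsM => //; apply: ctendsM; exact: ctends_izV.
  by apply: ctendsD; [exact: ctends_cst|apply: ctendsZ; exact: ctends_izV].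
have e2 : ctends (fun n => (M (iz n) - iz n * (fine (ups [set a]))%:C) / iz n) 0.
  move=> e e0; have [Y HY] := M_over_z_limit ups_fin S e0.
  exists (Num.truncn Y) => n Yn; rewrite subr0 normcM ComplexField.Normc.normcV normc_iz.
  apply: HY; last by [].
  by apply: ltW; apply: lt_le_trans (truncnS_gt _) _; rewrite ler_nat ltnS.
have := ctends_unique e1 e2; rewrite !mulr0 subr0 addr0 => /eqP.
by rewrite subr_eq0 => /eqP/(congr1 Re) /= ->.
Qed.

(** This is |z|^2 times the energy inequality at z = i(n+1), with the atom b moved to the right
    side. The growing factor in front of the mass term later forces upsilon to vanish on the gap. *)
Lemma energy_remainder n c : a <= c -> dom c ->
  cenergy (f (iz n)) a c + n.+1%:R ^+ 2 * sqnorm ups `]a, c]%classic (f (iz n)) <= Re (remainder (iz n)).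
Proof.
move=> ac dc; have := st_ups_point ups_fin S (iz_nonreal R n) ac dc.
rewrite normc_iz ups_atom.
have y0 : 0 < n.+1%:R :> R by [].
have -> : Im (M (iz n)) / Im (iz n) - b = Re (remainder (iz n)) / n.+1%:R ^+ 2.
  rewrite /remainder /iz; case: (M _) => p q /=; field.
  by rewrite gt_eqF.
rewrite ler_pdivlMr ?exprn_gt0// mulrDl divfK; last by rewrite gt_eqF ?exprn_gt0.
by rewrite [_ * n.+1%:R ^+ 2]mulrC.
Qed.

Lemma residue_ge0 : 0 <= s0.
Proof.
rewrite leNgt; apply/negP => s00.
have [N HN] := asym (e := - s0 / 2) ltac:(lra).
have := energy_remainder N (lexx a) da; have := HN N (leqnn N).
have := Re_le_normc (remainder (iz N) - s0%:C).
have := cenergy_ge0 (f (iz N)) a a; have := sqnorm_ge0 ups `]a, a]%classic (f (iz N)).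
have : Re (remainder (iz N) - s0%:C) = Re (remainder (iz N)) - s0 by case: (remainder _).
move=> -> q0 e0 /(le_trans (ler_norm _)) h1 h2 h3.
have : 0 <= N.+1%:R ^+ 2 * sqnorm ups `]a, a]%classic (f (iz N)) by rewrite mulr_ge0 ?sqr_ge0.
by move: h1 h2 h3; lra.
Qed.

Lemma energy_eventually e : 0 < e -> exists N, forall n c, (N <= n)%N -> a <= c -> dom c ->
  cenergy (f (iz n)) a c + n.+1%:R ^+ 2 * sqnorm ups `]a, c]%classic (f (iz n)) <= s0 + e.
Proof.
move=> e0; have [N HN] := asym e0; exists N => n c Nn ac dc.
apply: le_trans (energy_remainder n ac dc) _.
have := le_trans (le_trans (ler_norm _) (Re_le_normc _)) (HN n Nn).
have -> : Re (remainder (iz n) - s0%:C) = Re (remainder (iz n)) - s0 by case: (remainder _).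
by rewrite lerBlDl.
Qed.

(* By Cauchy-Schwarz |f x - 1|^2 <= (c - a) * cenergy f a c, and the energy is asymptotically
   at most s0. *)
Lemma solution_lower_bound c : a < c -> dom c -> (c - a) * s0 < 1 ->
  exists d B N, [/\ 0 < d, 0 <= B & forall n, (N <= n)%N ->
    [/\ cenergy (f (iz n)) a c <= B, n.+1%:R ^+ 2 * sqnorm ups `]a, c]%classic (f (iz n)) <= B &
       forall x, a <= x <= c -> d <= normc (f (iz n) x)]].
Proof.
move=> ac dc cs; have ca : 0 < c - a by rewrite subr_gt0.
pose e := (1 - (c - a) * s0) / 2 / (c - a).
have e0 : 0 < e by rewrite !divr_gt0// subr_gt0.
pose q := (c - a) * (s0 + e).
have qE : q = (1 + (c - a) * s0) / 2 by rewrite /q /e; field; rewrite gt_eqF.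
have s00 := residue_ge0.
have q0 : 0 <= q by apply: mulr_ge0; [exact: ltW|apply: addr_ge0 => //; exact: ltW].
have q1 : q < 1 by rewrite qE; lra.
have [N HN] := energy_eventually e0.
exists (1 - Num.sqrt q), (s0 + e), N; split.
- by rewrite subr_gt0 -[ltRHS]sqrtr1 ltr_sqrt.
- by rewrite addr_ge0// ltW.
move=> n Nn; have h := HN n c Nn (ltW ac) dc.
have Ege := cenergy_ge0 (f (iz n)) a c.
have qge : 0 <= n.+1%:R ^+ 2 * sqnorm ups `]a, c]%classic (f (iz n)).
  by rewrite mulr_ge0 ?sqr_ge0 ?sqnorm_ge0.
have Ele : cenergy (f (iz n)) a c <= s0 + e by lra.
split => //; first by lra.
move=> x /andP[ax xc]; have nz := iz_nonreal R n; have Hf := st_H1 S nz.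
have dx : dom x by exact: (domS dc (le_trans a0 ax) xc).
have : normc (f (iz n) x - 1) <= Num.sqrt q.
  rewrite -(ler_pXn2r (n := 2))// ?nnegrE ?normc_ge0 ?sqrtr_ge0// [leRHS]sqr_sqrtr//.
  rewrite -(st_norm S nz); apply: le_trans (H1loc_increment Hf a0 ax dx) _.
  apply: ler_pM => //; rewrite ?subr_ge0 ?cenergy_ge0//; first by rewrite lerD2r.
  exact: le_trans (cenergy_le Hf a0 (lexx a) ax xc dc) Ele.
have := normcD (f (iz n) x) (1 - f (iz n) x).
rewrite [X in normc X](_ : _ = 1); last by ring.
rewrite ComplexField.Normc.normc1 -[normc (1 - _)]cnormN opprB; lra.
Qed.

Lemma ups_gap c : a < c -> dom c -> (c - a) * s0 < 1 -> ups `]a, c]%classic = 0%E.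
Proof.
move=> ac dc cs; have [d [B [N [d0 B0 H]]]] := solution_lower_bound ac dc cs.
have sub : `]a, c]%classic `<=` `[0, c]%classic.
  by move=> x; rewrite /= !in_itv/= => /andP[p ->]; rewrite (le_trans a0 (ltW p)).
have mI : measurable (`]a, c]%classic : set (measurableTypeR R)) by exact: measurable_itv.
have fu : (ups `]a, c]%classic < +oo)%E := ups_itv_fin ups_fin dc mI sub.
suff : fine (ups `]a, c]%classic) * d ^+ 2 = 0.
  move=> /eqP; rewrite mulf_eq0 sqrf_eq0 (gt_eqF d0) orbF => /eqP u0.
  by rewrite -[LHS]fineK ?u0// ge0_fin_numE.
apply: (@linear_bound_zero _ _ B N); first by rewrite mulr_ge0 ?sqr_ge0// fine_ge0.
move=> n Nn; have [_ h1 h2] := H n Nn; apply: le_trans h1.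
rewrite [leLHS]mulrC; apply: ler_pM => //.
- by rewrite mulr_ge0 ?sqr_ge0// fine_ge0.
- by rewrite expr2 ler_peMr// ler1n.
rewrite mulrC -(sqnorm_ups_cst ups_fin d dc mI sub).
apply: (sqnorm_ups_mono ups_fin (@H1loc_cst R L d%:C) (st_H1 S (iz_nonreal R n)) dc mI sub) => x xI.
have /andP[ax xc] : a < x <= c by move: xI; rewrite /= in_itv.
rewrite normc_real ger0_norm ?(ltW d0)//.
by apply: h2; rewrite (ltW ax).
Qed.

(* Testing the equation of f z with the quotient h / f z makes Om act on h itself; all other
   terms are explicit, and z tends to infinity. *)
Lemma omega_gap c h : a < c -> (c - a) * s0 < 1 -> test c h -> Om h = c0%:C * h a.
Proof.
move=> ac cs th; have [dc Hh hc] := th.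
have [d [B [N [d0 B0 H]]]] := solution_lower_bound ac dc cs.
have Hhk := H1loc_clamp Hh a0 (ltW ac) dc.
have u0 := ups_gap ac dc cs.
have [Bh Bh0 HBh] := H1loc_bounded Hh dc.
pose E := 2 * ((d^-1) ^+ 2 * cenergy (h \o clamp a c) a c + Bh ^+ 2 * ((d^-1 ^+ 2) ^+ 2 * B)).
pose K := 2 * (Num.sqrt B * Num.sqrt E).
have [N' HN'] := asym ltr01.
apply/eqP; rewrite -subr_eq0; apply/eqP/ComplexField.Normc.eq0_normc.
apply: (@linear_bound_zero _ _ ((`|s0| + 1) * normc (h a) + K) (maxn N N')) => [|n].
  exact: normc_ge0.
rewrite geq_max => /andP[/H[h1 _ h2] /HN' h3].
have nz := iz_nonreal R n; have Hf := st_H1 S nz.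
(* The lower bound on f z holds on [a,c] only; clamping keeps the denominator away from zero on all
   of [0,L), so the quotient is a test function. *)
have Hfk := H1loc_clamp Hf a0 (ltW ac) dc.
have lowf x : d <= normc ((f (iz n) \o clamp a c) x).
  by apply: h2; exact: clamp_itv (ltW ac).
have HfV : H1 (fun x => ((f (iz n) \o clamp a c) x)^-1).
  by apply: (H1locV Hfk) => c' dc'; exists d.
pose k x := (h \o clamp a c) x * ((f (iz n) \o clamp a c) x)^-1.
have Hk : H1 k := H1locM Hhk HfV.
have kz x : c <= x -> dom x -> k x = 0.
  by move=> cx dx; rewrite /k /comp (clamp_high (ltW ac) cx) (hc c (lexx c) dc) mul0r.
have tk : test c k by split.
have fk x : a <= x -> dom x -> f (iz n) x * k x = h x.
  move=> ax dx; have [xc|cx] := leP x c; last by rewrite kz ?hc ?mulr0// ltW.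
  rewrite /k /comp clamp_id ?ax// mulrCA mulfV ?mulr1//.
  apply: contraTneq (lowf x) => fx; rewrite /comp clamp_id ?ax// fx.
  by rewrite ComplexField.Normc.normc0 -ltNge.
have eq := st_eq S nz tk (ltW ac).
rewrite (state_eq_on S (testM Hf tk) th fk) in eq.
rewrite (cintegral_ups_point ups_fin Hf Hk a0 (ltW ac) dc) ups_atom in eq.
have mI : measurable (`]a, c]%classic : set (measurableTypeR R)) by exact: measurable_itv.
have sub : `]a, c]%classic `<=` `[0, c]%classic.
  by move=> x; rewrite /= !in_itv/= => /andP[p ->]; rewrite (le_trans a0 (ltW p)).
have mfk : cmeasurable `]a, c]%classic (fun x => f (iz n) x * k x).
  by apply: cmeasurableM; [have [] := L2_ups ups_fin Hf dc mI sub|have [] := L2_ups ups_fin Hk dc mI sub].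
rewrite (cintegral_null mI mfk u0) addr0 (fk a (lexx a) da) in eq.
have ka : k a = h a by rewrite -(fk a (lexx a) da) (st_norm S nz) mul1r.
rewrite ka in eq.
have z0 := iz_neq0 R n.
have OmE : Om h - c0%:C * h a = (cdot (f (iz n)) k a c - remainder (iz n) * h a) / iz n.
  apply: (mulfI z0); rewrite mulrBr; move/eqP: eq; rewrite -subr_eq => /eqP <-.
  by rewrite [M _]remainderE//; field.
have Dk : normc (cdot (f (iz n)) k a c) <= K.
  apply: le_trans (cdot_CS Hf Hk a0 dc) _; rewrite ler_pM2l//.
  apply: ler_pM; rewrite ?sqrtr_ge0// ler_wsqrtr//.
  have b1 x : a <= x <= c -> normc ((h \o clamp a c) x) <= Bh.
    move=> /andP[ax xc]; apply: HBh; have /andP[p q] := clamp_itv x (ltW ac).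
    by rewrite (le_trans a0 p).
  have b2 x : a <= x <= c -> normc ((f (iz n) \o clamp a c) x)^-1 <= d^-1.
    move=> _; rewrite ComplexField.Normc.normcV lef_pV2 ?posrE ?lowf//.
    exact: lt_le_trans (lowf x).
  apply: le_trans (cenergyM Hhk HfV a0 (ltW ac) dc b1 b2) _.
  rewrite /E ler_pM2l// lerD2l ler_wpM2l ?sqr_ge0//.
  apply: le_trans (cenergyV Hfk HfV a0 (ltW ac) dc d0 (fun x _ => lowf x)) _.
  have -> : cenergy (f (iz n) \o clamp a c) a c = cenergy (f (iz n)) a c.
    by apply: (eq_cenergy Hfk Hf a0 (ltW ac) dc) => x xac; exact: cderiv_clamp.
  exact: (ler_wpM2l (sqr_ge0 (d^-1 ^+ 2)) h1).
rewrite OmE normcM ComplexField.Normc.normcV normc_iz divfK ?pnatr_eq0//.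
apply: le_trans (normcD _ _) _; rewrite cnormN normcM addrC; apply: lerD => //.
rewrite ler_wpM2r ?normc_ge0//; have := normcD (remainder (iz n) - s0%:C) s0%:C.
by rewrite subrK normc_real; lra.
Qed.

Let below_gap c a' : a < c -> c < a' -> (a' - a) * s0 <= 1 -> (c - a) * s0 < 1.
Proof.
move=> ac ca' h; have := residue_ge0; rewrite le_eqVlt => /orP[/eqP <-|s00]; first by rewrite mulr0.
by apply: lt_le_trans h; rewrite ltr_pM2r// ltrD2r.
Qed.

(** Exhaustion by the intervals ]a, a' - r n], on which the strict inequality required by [ups_gap]
    holds. *)
Lemma ups_gap_open a' : dom a' -> a < a' -> (a' - a) * s0 <= 1 -> ups `]a, a'[%classic = 0%E.
Proof.
move=> da' aa' as0.
pose r n := (a' - a) / n.+2%:R.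
have r0 n : 0 < r n by rewrite divr_gt0 ?subr_gt0.
have r1 n : r n < a' - a by rewrite /r ltr_pdivrMr// ltr_pMr ?subr_gt0// ltr1n.
pose F n : set (measurableTypeR R) := `]a, (a' - r n)%R]%classic.
have FN : ups.-negligible (\bigcup_n F n).
  apply: negligible_bigcup => n; apply/negligibleP; first exact: measurable_itv.
  have an : a < a' - r n by have := r1 n; lra.
  have na : a' - r n < a' by rewrite gtrBl.
  apply: ups_gap => //; last exact: below_gap as0.
  by apply: (domS da') (ltW na); exact: le_trans (ltW an).
apply/negligibleP; first exact: measurable_itv.
apply: negligibleS FN => x; rewrite /= in_itv/= => /andP[ax xa].
pose n := Num.truncn ((a' - a) / (a' - x)); exists n => //.
rewrite /F /= in_itv/= ax /= lerBrDr -lerBrDl; apply: ltW.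
rewrite /r ltr_pdivrMr// mulrC -ltr_pdivrMr ?subr_gt0//.
by apply: lt_trans (truncnS_gt _) _; rewrite ltr_nat.
Qed.

(** The borderline case is reached by approximation. For p slightly below a', g is h - h p up to p
    and 0 afterwards, so [omega_gap] applies to g. The difference u is the constant h p up to p and
    h afterwards; its energy is that of h on [p,a'], which tends to 0. *)
Lemma omega_gap_open a' h : a < a' -> (a' - a) * s0 <= 1 -> test a' h -> Om h = c0%:C * h a.
Proof.
move=> aa' as0 th; have [da' Hh hc] := th; have a0' := a0.
have [B B0 HB] := st_bounded S da'.
pose K := 2 * (B + `|c0| ^+ 2 * (a' - a)).
have K0 : 0 <= K by rewrite mulr_ge0 ?addr_ge0 ?mulr_ge0 ?sqr_ge0 ?subr_ge0 ?(ltW aa').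
suff D0 e : 0 < e -> normc (Om h - c0%:C * h a) ^+ 2 <= e.
  apply/eqP; rewrite -subr_eq0; apply/eqP/normc0_eq => e e0.
  by rewrite -(ler_pXn2r (n := 2))// ?nnegrE ?normc_ge0 ?(ltW e0)// D0 ?exprn_gt0.
move=> e0; have K1 : 0 < K + 1 by lra.
have Ke : (K + 1) * (e / (K + 1)) = e by rewrite mulrCA mulfV ?mulr1// gt_eqF.
have [d d0 Hd] := cenergy_continuous Hh da' (e := e / (K + 1)) ltac:(by rewrite divr_gt0).
have [eta [eta0 etad etaa]] : exists eta, [/\ 0 < eta, eta < d & eta < a' - a].
  exists (Num.min (d / 2) ((a' - a) / 2)); split.
  - by rewrite lt_min !divr_gt0 ?subr_gt0.
  - by apply: (@le_lt_trans _ _ (d / 2)); [rewrite ge_min lexx|lra].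
  - by apply: (@le_lt_trans _ _ ((a' - a) / 2)); [rewrite ge_min lexx orbT|lra].
pose p := a' - eta.
have ap : a < p by rewrite /p; lra.
have pa' : p < a' by rewrite /p; lra.
have pa : a' - p <= a' - a by rewrite /p; lra.
have p0 : 0 <= p by exact: le_trans (ltW ap).
have dp : dom p by exact: (domS da' p0 (ltW pa')).
have E1 : cenergy h p a' < e / (K + 1) by apply: Hd => //; [exact: ltW|rewrite /p; lra].
pose g x := (h \o clamp 0 p) x + - h p.
have Hhp : H1 (h \o clamp 0 p) by exact: (H1loc_clamp Hh (lexx 0) p0 dp).
have Hg : H1 g := H1locD Hhp (@H1loc_cst R L (- h p)).
have tg : test p g.
  split; [exact: dp|exact: Hg|move=> x px _].
  by rewrite /g /comp (clamp_high p0 px) subrr.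
have tg' : test a' g := testS (ltW pa') da' tg.
have Omg := omega_gap ap (below_gap ap pa' as0) tg.
pose u x := h x + -1 * g x.
have tu : test a' u := testD th (testZ (-1) tg').
have Omu : Om u = Om h - Om g.
  by rewrite /u (stateD S th (testZ (-1) tg')) (stateZ S (-1) tg') mulN1r.
have [_ Hu _] := tu.
have Eu : cenergy u 0 a' = cenergy h p a'.
  rewrite (cenergy_split Hu (lexx 0) p0 (ltW pa') da').
  rewrite (cenergy0 Hu (lexx 0) p0 dp) ?add0r; last first.
    move=> x xp; rewrite -(cderiv_cst (h p) x).
    apply: (cderiv_eq_oo (a := 0) (b := p)) => // t /andP[t0 tp].
    by rewrite /u /g /comp clamp_id ?(ltW t0) ?(ltW tp)//; ring.
  apply: (eq_cenergy Hu Hh p0 (ltW pa') da') => x xpa.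
  rewrite -[RHS](cderiv_shift h 0); apply: (cderiv_eq_oo (a := p) (b := a')) => // t /andP[pt ta].
  by rewrite /u /g /comp (clamp_high p0 (ltW pt)); ring.
have ca : clamp 0 p a = a by apply: clamp_id; rewrite a0 (ltW ap).
have ga : g a = h a - h p by rewrite /g /comp ca.
have -> : Om h - c0%:C * h a = Om u + - (c0%:C * h p).
  by rewrite Omu Omg ga; ring.
apply: le_trans (normcD_sqr _ _) _; rewrite cnormN normcM normc_real exprMn.
have n1 : normc (Om u) ^+ 2 <= B * cenergy h p a' by rewrite -Eu; exact: HB.
have n2 : normc (h p) ^+ 2 <= (a' - a) * cenergy h p a'.
  have := H1loc_increment Hh p0 (ltW pa') da'.
  rewrite (hc a' (lexx a') da') sub0r cnormN => /le_trans; apply.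
  exact: (ler_wpM2r (cenergy_ge0 h p a') pa).
have n3 : `|c0| ^+ 2 * normc (h p) ^+ 2 <= `|c0| ^+ 2 * ((a' - a) * cenergy h p a').
  by rewrite ler_wpM2l// sqr_ge0.
apply: (@le_trans _ _ (K * cenergy h p a')).
  have -> : K * cenergy h p a' =
      2 * (B * cenergy h p a' + `|c0| ^+ 2 * ((a' - a) * cenergy h p a')) by rewrite /K; ring.
  by rewrite (ler_pM2l (ltr0Sn R 1)); exact: lerD n1 n3.
apply: (@le_trans _ _ ((K + 1) * (e / (K + 1)))).
  apply: ler_pM; [exact: K0|exact: cenergy_ge0|by rewrite lerDl|exact: ltW E1].
rewrite Ke; exact: lexx.
Qed.

Lemma cintegral_gap (F : R -> C) a' c : dom c -> a < a' -> a' <= c ->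
  ups `]a, a'[%classic = 0%E ->
  (forall A : set (measurableTypeR R), measurable A -> A `<=` `[0, c]%classic -> cmeasurable A F) ->
  (forall A : set (measurableTypeR R), measurable A -> A `<=` `[0, c]%classic -> cintegrable ups A F) ->
  cintegral ups `]a, c]%classic F = cintegral ups `[a', c]%classic F.
Proof.
move=> dc aa' a'c u0 mF iF.
have m1 : measurable (`]a, a'[%classic : set (measurableTypeR R)) by exact: measurable_itv.
have m2 : measurable (`[a', c]%classic : set (measurableTypeR R)) by exact: measurable_itv.
have e : `]a, c]%classic = `]a, a'[%classic `|` `[a', c]%classic :> set R.
  apply/seteqP; split => x /=; rewrite !in_itv/=.
    by move=> /andP[-> ->]; rewrite andbT /=; have [h|h] := ltP x a'; [left|right].
  case=> /andP[h1 h2]; first by rewrite h1 (le_trans (ltW h2)).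
  by rewrite (lt_le_trans aa').
have s1 : `]a, a'[%classic `<=` `[0, c]%classic.
  move=> x; rewrite /= !in_itv/= => /andP[h1 h2].
  by rewrite (le_trans a0 (ltW h1)) (le_trans (ltW h2)).
have s2 : `[a', c]%classic `<=` `[0, c]%classic.
  move=> x; rewrite /= !in_itv/= => /andP[h1 ->]; rewrite andbT.
  by rewrite (le_trans a0)// (le_trans (ltW aa')).
rewrite e cintegral_setU//.
- by rewrite (cintegral_null m1 (mF _ m1 s1) u0) add0r.
- apply/disj_setPS => x [] /=; rewrite !in_itv/= => /andP[_ h1] /andP[h2 _].
  by have := lt_le_trans h1 h2; rewrite ltxx.
- by apply: iF; [exact: measurableU|move=> x [/s1|/s2]].
Qed.

Lemma cintegral_gap_mul g h a' c : H1 g -> H1 h -> dom c -> a < a' -> a' <= c ->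
  ups `]a, a'[%classic = 0%E ->
  cintegral ups `]a, c]%classic (fun x => g x * h x) =
  cintegral ups `[a', c]%classic (fun x => g x * h x).
Proof.
move=> Hg Hh dc aa' a'c u0; apply: cintegral_gap => // A mA Ac.
  by apply: cmeasurableM; [have [] := L2_ups ups_fin Hg dc mA Ac|have [] := L2_ups ups_fin Hh dc mA Ac].
by apply: L2_mul => //; [exact: (L2_ups ups_fin Hg dc mA Ac)|exact: (L2_ups ups_fin Hh dc mA Ac)].
Qed.

(** Equal to minus [remainder]: the derivative of f z immediately to the right of a, obtained from
    [z * M z] by removing the contribution of the weights at a. *)
Definition slope z : C := z * (M z - b%:C * z - c0%:C).

(** Tested with [descent a x], which has constant derivative on the gap and vanishes at x, the
    equation reduces to the terms at a and the increment of f z. *)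
Lemma solution_gap z x : nonreal z -> a < x -> dom x -> (x - a) * s0 <= 1 ->
  f z x = 1 + slope z * (x - a)%:C.
Proof.
move=> nz ax dx xs; have th := test_descent a0 ax dx; have [_ Hh hx] := th.
have Hf := st_H1 S nz.
have u0 := ups_gap_open dx ax xs.
have eq := st_eq S nz th (ltW ax).
have h1 : descent a x a = 1 by exact: descent_low.
have h2 : descent a x x = 0 by exact: descent_high.
rewrite (omega_gap_open ax xs (testM Hf th)) in eq.
rewrite (cintegral_ups_point ups_fin Hf Hh a0 (ltW ax) dx) ups_atom in eq.
rewrite (cintegral_gap_mul Hf Hh dx ax (lexx x) u0) in eq.
rewrite set_itv1 cintegral_set1 ?h2 in eq; last first.
  by apply: (ups_itv_fin ups_fin dx) => // t ->; rewrite /= in_itv/= lexx (le_trans a0)// ltW.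
rewrite h1 (st_norm S nz) (cdot_affine Hf Hh a0 (ltW ax) dx (s := (- (x - a)^-1)%:C)) in eq; last first.
  by move=> t tax; exact: cderiv_descent.
rewrite (st_norm S nz) !mulr0 addr0 !mulr1 in eq.
have xa : (x - a)%:C != 0 :> C by rewrite fmorph_eq0 subr_eq0 gt_eqF.
have e2 : (- (x - a)^-1)%:C * (f z x - 1) = - slope z.
  by rewrite /slope -[_ * (f z x - 1)](addKr (z * M z)) eq; ring.
have -> : f z x = 1 - (x - a)%:C * ((- (x - a)^-1)%:C * (f z x - 1)).
  have -> : (- (x - a)^-1)%:C = - (x - a)%:C^-1 :> C by rewrite rmorphN fmorphV.
  by move: xa (f z x); move: (x - a)%:C => q q0 F; field.
by rewrite e2; ring.
Qed.

(** The multiplied form has no exceptional points at the zeros of q, which makes it convenient under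
    the fractional linear change from M to [next_M]. *)
Definition quotient_of_polynomials (F : C -> C) :=
  exists p q : {poly C}, q != 0 /\ forall z, nonreal z -> q.[z] * F z = p.[z].

(* Otherwise the string is empty to the right of a, and M is explicitly known. *)
Lemma gap_inside : ~ quotient_of_polynomials M -> 0 < s0 /\ dom (a + s0^-1).
Proof.
move=> Mq; have a0' := a0.
have [H|] := pselect (forall c, dom c -> a < c -> (c - a) * s0 <= 1); last first.
  move=> /existsNP[c /not_implyP[dc /not_implyP[ac /negP]]]; rewrite -ltNge => h.
  have s00 : 0 < s0.
    rewrite lt_neqAle residue_ge0 andbT; apply: contraTneq h => <-.
    by rewrite mulr0 -leNgt.
  split=> //; apply: (domS dc); first by rewrite addr_ge0// invr_ge0 ltW.
  apply: ltW; rewrite -ltrBrDl -[s0^-1]mul1r ltr_pdivrMr//.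
exfalso; apply: Mq.
have sol z c : nonreal z -> dom c -> a < c -> f z c = 1 + slope z * (c - a)%:C.
  by move=> nz dc ac; apply: solution_gap => //; exact: H.
have [[l Ll]|Linf] : (exists l, L = l%:E) \/ L = +oo%E.
  by move: da => [_]; case: L => [l| |]//; [left; exists l|right].
(* Finite L: f z is affine up to L and vanishes there, so 1 + slope z (L - a) = 0, which determines
   M. *)
- have al : a < l by move: da => [_]; rewrite Ll lte_fin.
  exists ((l - a)%:C *: ('X * (b%:C *: 'X + c0%:C%:P)) + (-1)%:P), ((l - a)%:C *: 'X).
  have la : (l - a)%:C != 0 :> C by rewrite fmorph_eq0 subr_eq0 gt_eqF.
  split; first by rewrite scaler_eq0 polyX_eq0 orbF.
  move=> z nz; rewrite !(hornerZ, hornerX, hornerD, hornerM, hornerC).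
  suff h : 1 + slope z * (l - a)%:C = 0.
    by apply/eqP; rewrite -subr_eq0 -[X in _ == X]h /slope; apply/eqP; ring.
  apply: normc0_eq => e e0; pose k := normc (slope z) + 1.
  have k0 : 0 < k by rewrite ltr_wpDl ?normc_ge0.
  have [x0 dx0 Hx0] := st_end S nz Ll (e := e / 2) ltac:(lra).
  pose x := Num.max (Num.max x0 ((a + l) / 2)) (l - e / 2 / k).
  have ax : a < x by rewrite !lt_max; apply/orP; left; apply/orP; right; lra.
  have xl : x < l.
    rewrite !gt_max; have [_] := dx0; rewrite Ll lte_fin => -> /=.
    apply/andP; split; [lra|by rewrite gtrBl !divr_gt0].
  have dx : dom x by split; [exact: le_trans (ltW ax)|rewrite Ll lte_fin].
  have -> : 1 + slope z * (l - a)%:C = f z x + slope z * (l - x)%:C.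
    by rewrite sol// -[l - a](subrKA x) rmorphD/=; ring.
  apply: le_trans (normcD _ _) _; rewrite normcM normc_real ger0_norm ?subr_ge0 ?(ltW xl)//.
  have -> : e = e / 2 + k * (e / 2 / k) by field; rewrite gt_eqF.
  apply: lerD; first by apply: Hx0 => //; rewrite !le_max lexx.
  apply: ler_pM; rewrite ?normc_ge0 ?subr_ge0 ?(ltW xl)//; first by rewrite lerDl.
  by rewrite lerBlDr -lerBlDl le_max lexx orbT.
(* Infinite L: f z is affine on a half-line with finite energy, hence its slope is 0 and M z = b z +
   c0. *)
- exists (b%:C *: 'X + c0%:C%:P), 1; split; first exact: oner_neq0.
  move=> z nz; rewrite !(hornerZ, hornerX, hornerD, hornerM, hornerC).
  have z0 : z != 0 by apply: contra_neq nz => ->.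
  suff h : slope z = 0.
    apply/eqP; rewrite -subr_eq0; apply/eqP; apply: (mulfI z0).
    by rewrite mulr0 -h /slope; ring.
  have Hf := st_H1 S nz.
  apply: ComplexField.Normc.eq0_normc; apply/eqP; rewrite -sqrf_eq0; apply/eqP.
  apply: (@linear_bound_zero _ _ (normc z ^+ 2 * (Im (M z) / Im z)) 0%N); first exact: sqr_ge0.
  move=> n _; pose c := a + n.+1%:R.
  have ac : a < c by rewrite ltrDl.
  have dc : dom c by split; [exact: le_trans (ltW ac)|rewrite Linf ltry].
  have nz2 : 0 < normc z ^+ 2.
    rewrite exprn_gt0// lt_neqAle normc_ge0 andbT eq_sym; apply: contra z0.
    by move=> /eqP/ComplexField.Normc.eq0_normc ->.
  have n0 : 0 < n.+1%:R :> R by [].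
  have ca : c - a = n.+1%:R by rewrite /c addrC addKr.
  have E1 := H1loc_increment Hf a0 (ltW ac) dc.
  rewrite (st_norm S nz) (sol z c nz dc ac) ca addrC addKr normcM normc_real in E1.
  rewrite (ger0_norm (ltW n0)) exprMn [X in _ * X]expr2 mulrA mulrC ler_pM2l// in E1.
  apply: (le_trans E1).
  have := st_energy S nz (ltW ac) dc.
  have := sqnorm_ge0 ups `[a, c]%classic (f z) => q0 h.
  rewrite -ler_pdivrMl//; rewrite mulrC.
  by move: q0 h; set A := cenergy _ _ _ / _; lra.
Qed.

(** * Cutting off the first gap *)

Section step.
Hypotheses (s00 : 0 < s0) (da' : dom (a + s0^-1)).
Let a' := a + s0^-1.
Let aa' : a < a'. Proof. by rewrite ltrDl invr_gt0. Qed.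
Let as0 : (a' - a) * s0 <= 1.
Proof. by rewrite /a' [a + _]addrC addrK mulVf ?gt_eqF. Qed.
Let a'0 : 0 <= a'. Proof. exact: le_trans (ltW aa'). Qed.

(* f z is affine with slope [slope z] on the gap, so [next_w z] is its value at a'. *)
Definition next_w z : C := 1 + slope z * (s0^-1)%:C.
Definition next_Om h : C := Om h - c0%:C * h a.
Definition next_M z : C := (M z - b%:C * z - c0%:C) / next_w z.
Definition next_f z x : C := (next_w z)^-1 * f z x.

Lemma next_wE z : nonreal z -> f z a' = next_w z.
Proof.
by move=> nz; rewrite (solution_gap nz aa' da' as0) /next_w /a' [a + _]addrC addrK.
Qed.

Lemma next_Om_lin z g h c : test c g -> test c h ->
  next_Om (fun x => z * g x + h x) = z * next_Om g + next_Om h.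
Proof. by move=> tg th; rewrite /next_Om (st_lin S z tg th); ring. Qed.

Lemma next_Om_supp c h : test c h -> (forall x, a' <= x -> dom x -> h x = 0) -> next_Om h = 0.
Proof.
move=> [dc Hh hc] ha; have th : test a' h by split.
by rewrite /next_Om (omega_gap_open aa' as0 th) subrr.
Qed.

Lemma next_Om_eq_on c g h : test c g -> test c h ->
  (forall x, a' <= x -> dom x -> g x = h x) -> next_Om g = next_Om h.
Proof.
move=> tg th gh; have := next_Om_lin (-1) tg th.
rewrite (next_Om_supp (testD (testZ (-1) tg) th)); last first.
  by move=> x ax dx; rewrite (gh x ax dx) mulN1r addNr.
by rewrite mulN1r addrC => /eqP; rewrite eq_sym subr_eq0 => /eqP.
Qed.

Let cderiv_slope z x : nonreal z -> a < x < a' -> cderiv (f z) x = slope z.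
Proof.
move=> nz xa.
have d1 : cdiff (fun t : R => (- a + 1 * t)%:C) x.
  split => /=; last exact: derivable_cst.
  have : derivable ((cst (- a) : R -> R) + cst 1 * id) x 1.
    apply: derivableD; first exact: derivable_cst.
    by apply: derivableM; [exact: derivable_cst|exact: derivable_id].
  by [].
rewrite -[slope z]mulr1 -[X in _ * X](cderiv_affine (- a) 1 x) -(cderivZ (slope z) d1).
rewrite -(cderiv_shift (fun t => slope z * _) 1).
apply: (cderiv_eq_oo (a := a) (b := a')) => // t /andP[t1 t2].
have dt : dom t by apply: (domS da') (ltW t2); exact: le_trans (ltW t1).
have ts : (t - a) * s0 <= 1.
  by apply: le_trans as0; rewrite ler_pM2r// lerD2r ltW.
by rewrite (solution_gap nz t1 dt ts) addrC mul1r [- a + t]addrC.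
Qed.

(** h is prolonged to the left of a' by a function that vanishes at a, so the weights at a do not
    enter. Since f z has the constant derivative [slope z] on the gap, this part of the integral is
    [slope z * h a']. *)
Lemma step_identity z h c : nonreal z -> test c h -> a' <= c ->
  slope z * h a' + cdot (f z) h a' c =
  z * next_Om (fun x => f z x * h x) + z ^+ 2 * cintegral ups `[a', c]%classic (fun x => f z x * h x).
Proof.
move=> nz th a'c; have [dc Hh hc] := th; have Hf := st_H1 S nz.
have ac : a < c := lt_le_trans aa' a'c.
pose k x := (h \o clamp a' c) x * ascent a a' x.
have Hk : H1 k := H1locM (H1loc_clamp Hh a'0 a'c dc) (H1_ascent a0 aa' da').
have kc x : c <= x -> k x = 0.
  by move=> cx; rewrite /k /comp (clamp_high a'c cx) (hc c (lexx c) dc) mul0r.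
have tk : test c k by split; [exact: dc|exact: Hk|move=> x cx _; exact: kc].
have kh x : a' <= x -> dom x -> k x = h x.
  move=> ax dx; have [xc|cx] := leP x c.
    have xE : clamp a' c x = x by apply: clamp_id; rewrite ax.
    by rewrite /k /comp xE (ascent_high aa' ax) mulr1.
  by rewrite (kc x (ltW cx)) (hc x (ltW cx) dx).
have ka : k a = 0 by rewrite /k (ascent_low a' (lexx a)) mulr0.
have eq := st_eq S nz tk (ltW ac).
have OmE : Om (fun x => f z x * k x) = next_Om (fun x => f z x * h x).
  rewrite -(next_Om_eq_on (testM Hf tk) (testM Hf th)); last first.
    by move=> x ax dx; rewrite (kh x ax dx).
  by rewrite /next_Om ka !mulr0 subr0.
rewrite OmE ka mulr0 add0r (cdot_split Hf Hk a0 (ltW aa') a'c dc) in eq.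
rewrite (cdotC (f z) k a a') (cdot_affine Hk Hf a0 (ltW aa') da' (s := slope z)) in eq; last first.
  by move=> x; exact: cderiv_slope.
rewrite ka subr0 (kh a' (lexx a') da') in eq.
rewrite (eq_cdot (h2 := h) Hf Hk Hh a'0 a'c dc) in eq; last first.
  move=> x xac; apply: (cderiv_eq_oo (a := a') (b := c)) => // t /andP[t1 t2].
  by apply: (kh t (ltW t1)); apply: (domS dc) (ltW t2); exact: le_trans (ltW t1).
rewrite eq (cintegral_ups_point ups_fin Hf Hk a0 (ltW ac) dc) ka !mulr0 add0r.
rewrite (cintegral_gap_mul Hf Hk dc aa' a'c (ups_gap_open da' aa' as0)).
congr (_ + _ * _); apply: eq_cintegral => x; rewrite /= in_itv/= => /andP[h1 h2]; rewrite (kh x h1)//.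
by apply: (domS dc) h2; exact: le_trans h1.
Qed.

Let Mt z := M z - b%:C * z - c0%:C.

Let nz0 z : nonreal z -> z != 0.
Proof. by move=> nz; apply: contra_neq nz => ->. Qed.

Let normz z : nonreal z -> 0 < normc z ^+ 2.
Proof.
move=> nz; rewrite exprn_gt0// lt_neqAle normc_ge0 andbT eq_sym; apply: contra (nz0 nz).
by move=> /eqP/ComplexField.Normc.eq0_normc ->.
Qed.

(** The subtracted term is the energy that f z must have spent on the gap: by Cauchy-Schwarz the
    increment slope z / s0 over the length 1/s0 costs at least |slope z|^2 / s0, and slope z = z
    Mt. *)
Lemma step_energy z c : nonreal z -> a' <= c -> dom c ->
  cenergy (f z) a' c / normc z ^+ 2 + sqnorm ups `[a', c]%classic (f z) <=
  Im (Mt z) / Im z - normc (Mt z) ^+ 2 / s0.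
Proof.
move=> nz a'c dc; have Hf := st_H1 S nz.
have ac : a < c := lt_le_trans aa' a'c.
have := st_ups_point ups_fin S nz (ltW ac) dc; rewrite ups_atom.
rewrite (cenergy_split Hf a0 (ltW aa') a'c dc).
have E1 := H1loc_increment Hf a0 (ltW aa') da'.
rewrite (next_wE nz) (st_norm S nz) /next_w addrC addKr normcM normc_real in E1.
have s00' : 0 < s0^-1 by rewrite invr_gt0.
have ax : a' - a = s0^-1 by rewrite /a' addrC addKr.
rewrite (ger0_norm (ltW s00')) ax exprMn expr2 mulrCA ler_pM2l// in E1.
have E2 : normc (Mt z) ^+ 2 / s0 <= cenergy (f z) a a' / normc z ^+ 2.
  rewrite ler_pdivlMr ?normz//; apply: le_trans E1.
  rewrite /slope normcM -/(Mt z) le_eqVlt; apply/orP; left; apply/eqP; ring.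
have E3 : sqnorm ups `[a', c]%classic (f z) <= sqnorm ups `]a, c]%classic (f z).
  apply: (sqnorm_ups_le ups_fin Hf dc).
  - exact: measurable_itv.
  - exact: measurable_itv.
  - by move=> x; rewrite /= !in_itv/= => /andP[h1 ->]; rewrite (lt_le_trans aa' h1).
  - by move=> x; rewrite /= !in_itv/= => /andP[h1 ->]; rewrite (le_trans a0 (ltW h1)).
have E4 : Im (Mt z) / Im z = Im (M z) / Im z - b.
  rewrite /Mt; move: nz; case: (M z) => p q; case: (z) => u v; rewrite /nonreal /= => v0.
  by field.
rewrite E4 mulrDl; move: E2 E3.
move: (cenergy (f z) a a' / _) (cenergy (f z) a' c / _) (sqnorm ups `]a, c]%classic _)
  (sqnorm ups `[a', c]%classic _) (normc (Mt z) ^+ 2 / s0) (Im (M z) / Im z) => A B D E F G.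
lra.
Qed.

(** If f z vanishes at a', then slope z = - s0 and the right side of [step_energy] is 0. So f z
    vanishes from a' on, and the equation tested near a' gives slope z = 0, contradicting s0 > 0. *)
Lemma next_w_neq0 z : nonreal z -> next_w z != 0.
Proof.
move=> nz; apply/eqP => w0; have Hf := st_H1 S nz.
have fa' : f z a' = 0 by rewrite (next_wE nz).
have z0 := nz0 nz.
have s0C : (s0^-1)%:C != 0 :> C by rewrite fmorph_eq0 invr_eq0 gt_eqF.
have slE : slope z = - s0%:C.
  apply: (mulIf s0C); rewrite mulNr -rmorphM/= mulfV ?gt_eqF//.
  by apply/eqP; rewrite -addr_eq0 addrC; apply/eqP.
have MtE : Mt z = - s0%:C / z.
  by apply: (mulfI z0); rewrite mulrCA mulfV// mulr1 -slE.
have rhs0 : Im (Mt z) / Im z - normc (Mt z) ^+ 2 / s0 = 0.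
  have -> : Mt z = - (s0 / normc z ^+ 2)%:C * z^*%C.
    have n0 : (normc z ^+ 2)%:C != 0 :> C by rewrite fmorph_eq0 gt_eqF// normz.
    apply: (mulIf z0); rewrite MtE divfK// -mulrA normc_conj_mul mulNr -rmorphM /=.
    by rewrite divfK// gt_eqF ?normz.
  rewrite normcM normcJ cnormN normc_real ger0_norm; last first.
    by rewrite divr_ge0 ?(ltW s00) ?sqr_ge0.
  have -> : Im (- (s0 / normc z ^+ 2)%:C * z^*%C) = s0 / normc z ^+ 2 * Im z.
    by case: (z) => u v; rewrite /=; ring.
  rewrite mulfK//.
  have := normz nz; move: (normc z) => q q0; field.
  by rewrite gt_eqF//= ; move: q0; rewrite lt0r sqrf_eq0 => /andP[].
have flat c : a' <= c -> dom c -> f z c = 0.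
  move=> a'c dc; have := step_energy nz a'c dc; rewrite rhs0 => h.
  have E0 : cenergy (f z) a' c = 0.
    apply/eqP; rewrite eq_le cenergy_ge0 andbT.
    have : cenergy (f z) a' c / normc z ^+ 2 <= 0.
      by apply: le_trans h; rewrite lerDl sqnorm_ge0.
    by rewrite ler_pdivrMr ?normz// mul0r.
  have := H1loc_increment Hf a'0 a'c dc; rewrite E0 mulr0 fa' subr0 => h2.
  by apply: ComplexField.Normc.eq0_normc; apply/eqP; rewrite -sqrf_eq0 eq_le h2 sqr_ge0.
have [c a'c dc] : exists2 c, a' < c & dom c.
  move: da' => [_]; rewrite -/a'; case: L => [l| |]//= al.
    rewrite lte_fin in al; exists ((a' + l) / 2); first by rewrite midf_lt.
    by split; [rewrite divr_ge0// addr_ge0// ltW// (le_lt_trans a'0 al)|rewrite lte_fin midf_lt].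
  by exists (a' + 1); [rewrite ltrDl|split; [rewrite addr_ge0|rewrite ltry]].
have th := test_descent a'0 a'c dc; have [_ Hh hc] := th.
have := step_identity nz th (ltW a'c).
rewrite (descent_low a'c (lexx a')) mulr1.
rewrite (cdotC (f z)) (cdot0 Hh Hf a'0 (ltW a'c) dc) ?addr0; last first.
  move=> x xac; rewrite -(cderiv_cst 0 x); apply: (cderiv_eq_oo (a := a') (b := c)) => // t /andP[t1 t2].
  by apply: (flat t (ltW t1)); apply: (domS dc) (ltW t2); exact: le_trans (ltW t1).
rewrite (next_Om_supp (testM Hf th)) ?mulr0 ?add0r; last by move=> x ax dx; rewrite (flat x ax dx) mul0r.
have mI : measurable (`[a', c]%classic : set (measurableTypeR R)) by exact: measurable_itv.
have sub : `[a', c]%classic `<=` `[0, c]%classic by exact: itvccS.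
rewrite (@eq_cintegral _ _ _ ups _ _ (fun x => 0 * (f z x * descent a' c x))); last first.
  move=> x; rewrite /= in_itv/= => /andP[h1 h2]; rewrite (flat x h1) ?mul0r//.
  by apply: (domS dc) h2; exact: le_trans h1.
rewrite cintegralZ; last first.
- by apply: L2_mul => //; [exact: (L2_ups ups_fin Hf dc mI sub)|exact: (L2_ups ups_fin Hh dc mI sub)].
- exact: mI.
rewrite mul0r mulr0 slE => /eqP; rewrite oppr_eq0 fmorph_eq0 => /eqP s0z.
by move: s00; rewrite s0z ltxx.
Qed.

Let next_w_norm z : nonreal z -> 0 < normc (next_w z).
Proof.
move=> nz; rewrite lt_neqAle normc_ge0 andbT eq_sym; apply: contra (next_w_neq0 nz).
by move=> /eqP/ComplexField.Normc.eq0_normc ->.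
Qed.

(** Multiplying Mt by the conjugate of w = 1 + z Mt / s0 and taking imaginary parts reproduces the
    right side of [step_energy], so the energy inequality passes to the next state in its original
    form. *)
Let Im_next_M z : nonreal z ->
  Im (next_M z) / Im z = (normc (next_w z) ^+ 2)^-1 * (Im (Mt z) / Im z - normc (Mt z) ^+ 2 / s0).
Proof.
move=> nz; have w0 := next_w_norm nz.
have -> : next_M z = ((normc (next_w z) ^+ 2)^-1)%:C * (Mt z * (next_w z)^*%C).
  have n0 : (normc (next_w z) ^+ 2)%:C != 0 :> C by rewrite fmorph_eq0 sqrf_eq0 gt_eqF.
  rewrite fmorphV; apply: (mulIf (next_w_neq0 nz)); rewrite /next_M divfK ?next_w_neq0//.
  by rewrite -!mulrA normc_conj_mul mulrCA mulVf ?mulr1.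
have -> : Im (((normc (next_w z) ^+ 2)^-1)%:C * (Mt z * (next_w z)^*%C)) =
    (normc (next_w z) ^+ 2)^-1 * Im (Mt z * (next_w z)^*%C).
  by case: (Mt z * _) => p q; rewrite /=; ring.
rewrite -mulrA; congr (_ * _).
rewrite /next_w /slope -/(Mt z) normc_sqr; move: nz; rewrite /nonreal.
by case: (Mt z) => p q; case: (z) => u v /= v0; field; rewrite v0 gt_eqF.
Qed.

Lemma next_state : state a' next_Om next_M next_f.
Proof.
split.
- exact: da'.
- exact: next_Om_lin.
- move=> c dc; have [B B0 HB] := st_bounded S dc.
  exists (2 * (B + `|c0| ^+ 2 * c)).
    by rewrite mulr_ge0 ?addr_ge0 ?mulr_ge0 ?sqr_ge0 ?(dom0 dc).
  move=> h th; have [_ Hh hc] := th.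
  rewrite /next_Om; apply: le_trans (normcD_sqr _ _) _.
  rewrite cnormN normcM normc_real exprMn -mulrA ler_pM2l// mulrDl -[_ * c * _]mulrA.
  apply: lerD; first exact: HB.
  rewrite ler_wpM2l ?sqr_ge0//; have [ac|ca] := leP a c.
    exact: (normc_le_cenergy Hh hc a0 ac dc).
  rewrite (hc a (ltW ca) da) ComplexField.Normc.normc0 expr0n/=.
  by rewrite mulr_ge0 ?cenergy_ge0 ?(dom0 dc).
- exact: next_Om_supp.
- by move=> z nz; apply: H1locZ; exact: (st_H1 S nz).
- by move=> z nz; rewrite /next_f (next_wE nz) mulVf// next_w_neq0.
- move=> z h c nz th a'c; have [dc Hh hc] := th; have Hf := st_H1 S nz.
  have mI : measurable (`[a', c]%classic : set (measurableTypeR R)) by exact: measurable_itv.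
  have sub : `[a', c]%classic `<=` `[0, c]%classic by exact: itvccS.
  have eq := step_identity nz th a'c.
  have e1 : (fun x => next_f z x * h x) = (fun x => (next_w z)^-1 * (f z x * h x)).
    by apply/funext => x; rewrite /next_f mulrA.
  have e2 : next_Om (fun x => next_f z x * h x) = (next_w z)^-1 * next_Om (fun x => f z x * h x).
    by rewrite e1 /next_Om (stateZ S _ (testM Hf th)); ring.
  rewrite e2 e1 cintegralZ; last first.
  + by apply: L2_mul => //; [exact: (L2_ups ups_fin Hf dc mI sub)|exact: (L2_ups ups_fin Hh dc mI sub)].
  + exact: mI.
  rewrite cdotC (cdotZ _ Hh Hf a'0 a'c dc) cdotC.
  have -> : z * next_M z * h a' = (next_w z)^-1 * (slope z * h a') by rewrite /next_M /slope; ring.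
  by rewrite -mulrDr eq; ring.
- move=> z c nz a'c dc; have Hf := st_H1 S nz; have w0 := next_w_norm nz.
  have mI : measurable (`[a', c]%classic : set (measurableTypeR R)) by exact: measurable_itv.
  have sub : `[a', c]%classic `<=` `[0, c]%classic by exact: itvccS.
  rewrite Im_next_M// (cenergyZ _ Hf a'0 a'c dc).
  rewrite (sqnormZ mI _ (L2_ups ups_fin Hf dc mI sub)).
  rewrite ComplexField.Normc.normcV exprVn -mulrA -mulrDr ler_pM2l ?invr_gt0 ?exprn_gt0//.
  exact: step_energy.
- move=> z l nz Ll e e0; have w0 := next_w_norm nz.
  have [x0 dx0 Hx0] := st_end S nz Ll (e := e * normc (next_w z)) ltac:(by rewrite mulr_gt0).
  exists x0 => // x xx dx; rewrite /next_f normcM ComplexField.Normc.normcV.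
  by rewrite ler_pdivrMl// mulrC Hx0.
Qed.

(** The relation w (1 - z next_M / s0) = 1 inverts the step: a quotient p/q for next_M becomes p /
    (q - z p / s0) for M - b z - c0. *)
Lemma next_M_quotient : quotient_of_polynomials next_M -> quotient_of_polynomials M.
Proof.
move=> [p [q [q0 pq]]].
pose q' := q - (s0^-1)%:C *: ('X * p).
have E z : nonreal z -> q'.[z] * Mt z = p.[z] /\ (q'.[z] = 0 -> q.[z] = 0).
  move=> nz; have w0 := next_w_neq0 nz.
  have q'E : q'.[z] * next_w z = q.[z].
    rewrite /q' !(hornerZ, hornerX, hornerD, hornerM, hornerC, hornerN) -(pq z nz) /next_M -/(Mt z).
    transitivity (q.[z] * (next_w z - (s0^-1)%:C * (z * Mt z)) ).
      by move: (s0^-1)%:C => k; field.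
    by rewrite /next_w /slope -/(Mt z) mulrC [_ * (z * _)]mulrC addrK mul1r.
  split; last by move=> q'0; rewrite -q'E q'0 mul0r.
  apply: (mulIf w0); rewrite mulrAC q'E -(pq z nz) /next_M -/(Mt z).
  by rewrite mulrA divfK.
clearbody q'.
exists (p + q' * (b%:C *: 'X + c0%:C%:P)), q'; split.
  (* If q' were zero, q would vanish at every [iz n], hence at more points than its degree
     allows. *)
  apply: contra_neq q0 => q'0; apply: (roots_geq_poly_eq0 (rs := map iz (iota 0 (size q)))).
  - by apply/allP => z /mapP[n _ ->]; apply/eqP; apply: (E _ (iz_nonreal R n)).2; rewrite q'0 horner0.
  - rewrite map_inj_uniq ?iota_uniq// => i j /(congr1 Im) /= /eqP.
    by rewrite eqr_nat eqSS => /eqP.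
  - by rewrite size_map size_iota.
move=> z nz; rewrite !(hornerZ, hornerX, hornerD, hornerM, hornerC) -(E z nz).1 /Mt; ring.
Qed.

End step.
End gap.

(** * Weyl solutions *)

Transparent H1loc cenergy cdot sqnorm cintegral.

Lemma cintegral_subset d (T : measurableType d) (R : realType) (mu : {measure set T -> \bar R})
    (A D : set T) (F : T -> R[i]) : A `<=` D -> (forall x, D x -> ~ A x -> F x = 0) ->
  cintegral mu D F = cintegral mu A F.
Proof.
move=> AD F0; have H (u : T -> R) : (forall x, D x -> ~ A x -> u x = 0) ->
    \int[mu]_(x in D) u x = \int[mu]_(x in A) u x.
  move=> u0; rewrite /Rintegral integral_mkcond [in RHS]integral_mkcond.
  congr (fine (integral _ _ _)); apply/funext => x; rewrite /patch.
  have [xA|xA] := boolP (x \in A); first by rewrite (mem_set (AD _ (set_mem xA))).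
  case: ifPn => // /set_mem xD; rewrite u0//; by move: xA; rewrite notin_setE.
by rewrite /cintegral !H// => x xD xA; rewrite F0.
Qed.

Section test_functions.
Variables (R : realType) (L : \bar R).
Local Notation C := R[i].
Local Notation normc := (@ComplexField.Normc.normc R).
Local Notation leb := (@lebesgue_measure R).
Local Notation dom := (halfopen L).
Local Notation H1 := (@H1loc R L).
Local Notation test := (test L).
Implicit Types (f g h : R -> C) (a b c x y e : R).

Lemma test_supp c h : test c h -> supp L h `<=` `[0, c]%classic.
Proof.
move=> [dc Hh hc] x [cx [x0 xL]] /=; rewrite in_itv/= x0/=.
have : closure `]-oo, c]%classic x.
  apply: closureS cx => y [dy hy] /=; rewrite in_itv/= leNgt; apply/negP => cy.
  by move: hy; rewrite (hc y (ltW cy) dy) eqxx.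
have /closure_id <- : closed (`]-oo, c]%classic : set R) by exact: lray_closed.
by rewrite /= in_itv.
Qed.

Lemma test_H1c c h : test c h -> H1c L h.
Proof.
move=> th; have [dc Hh hc] := th; split => //.
have -> : supp L h = closure [set x | dom x /\ h x != 0] `&` `[0, c]%classic.
  apply/seteqP; split => x.
    by move=> sx; split; [exact: sx.1|exact: (test_supp th)].
  move=> [cx xc]; split => //; move: xc; rewrite /= in_itv/= => /andP[x0 xc].
  exact: (domS dc).
apply: (subclosed_compact _ (@segment_compact R 0 c)); last by move=> x [].
apply: closedI; first exact: closed_closure.
exact: interval_closed.
Qed.

(** A compact support inside [0,b[ has a largest point y, and h vanishes from the midpoint of y and
    b on; if the support is empty, c = 0 serves. *)
Lemma H1c_test b h : 0 < b -> dom b -> H1c L h -> supp L h `<=` `[0, b[%classic ->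
  exists2 c, c < b & test c h.
Proof.
move=> b0 db [Hh ch] sh.
have hz x : dom x -> ~ supp L h x -> h x = 0.
  move=> dx sx; apply/eqP/negPn/negP => hx; apply: sx; split => //.
  by apply: subset_closure.
have [[y0 sy0]|/forallNP s0] := pselect (exists y, supp L h y); last first.
  exists 0 => //; split; [exact: (domS db (lexx 0) (ltW b0))|exact: Hh|].
  by move=> x _ dx; apply: hz => //; exact: s0.
have [y ys ymax] : exists2 y, y \in supp L h & forall t, t \in supp L h -> t <= y.
  apply: (@compact_EVT_max R R id (supp L h)) => //; first by exists y0.
  by apply: continuous_subspaceT => x; exact: cvg_id.
have := sh _ (set_mem ys); rewrite /= in_itv/= => /andP[y0' yb].
exists ((y + b) / 2); first by rewrite midf_lt.
split; [|exact: Hh|].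
  by apply: (domS db); [rewrite divr_ge0// addr_ge0// ltW|rewrite ltW// midf_lt].
move=> x yx dx; apply: hz => // sx; have := ymax x (mem_set sx).
by rewrite leNgt => /negP; apply; apply: lt_le_trans yx; rewrite midf_lt.
Qed.

Lemma leb_itv_fin c : dom c -> (leb `[0%R, c]%classic < +oo)%E.
Proof. by move=> dc; rewrite leb_itvcc ?(dom0 dc)// ltry. Qed.

(** A Poincare inequality: h vanishes at c, so |h|^2 is at most c times the energy. Continuity in
    the H^1 norm may therefore be expressed by the energy alone, as in [st_bounded]. *)
Lemma H1norm_le c h : test c h -> H1norm c h ^+ 2 <= (c ^+ 2 + 1) * cenergy h 0 c.
Proof.
move=> [dc Hh hc]; have c0 := dom0 dc.
have mI : measurable (`[0, c]%classic : set (measurableTypeR R)) by exact: measurable_itv.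
have L2h : L2 leb `[0, c]%classic h.
  exact: (@L2_ups R L (@lebesgue_measure R) leb_itv_fin h `[0, c]%classic c Hh dc mI).
have L2h' := H1loc_L2 Hh dc.
rewrite /H1norm sqr_sqrtr; last first.
  by apply: Rintegral_ge0 => x _; rewrite addr_ge0 ?sqr_ge0.
rewrite RintegralD//; [|exact: L2_sqr_integrable|exact: L2_sqr_integrable].
rewrite mulrDl mul1r -/(cenergy h 0 c); apply: lerD; last exact: lexx.
have nE : normc ((Num.sqrt (c * cenergy h 0 c))%:C : C) ^+ 2 = c * cenergy h 0 c.
  by rewrite normc_real real_normK ?num_real// sqr_sqrtr// mulr_ge0 ?cenergy_ge0.
apply: (@le_trans _ _ (\int[leb]_(x in `[0, c]) (c * cenergy h 0 c))).
  apply: le_Rintegral => //.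
  - exact: L2_sqr_integrable.
  - apply: (eq_integrable mI (EFin \o fun=> normc ((Num.sqrt (c * cenergy h 0 c))%:C : C) ^+ 2)).
      by move=> x _; rewrite /comp nE.
    apply: L2_sqr_integrable => //.
    exact: (@L2_ups R L (@lebesgue_measure R) leb_itv_fin _ `[0, c]%classic c (@H1loc_cst R L _) dc mI).
  - move=> x; rewrite /= in_itv/= => /andP[x0 xc]; exact: (normc_le_cenergy Hh hc x0 xc dc).
have fl := leb_itv_fin dc.
rewrite Rintegral_cst// -[fine _]/(fine (leb `[0, c]%classic)) leb_itvcc// subr0.
have -> : fine c%:E = c by [].
by rewrite mulrAC -expr2.
Qed.

End test_functions.

Lemma cintegral_real d (T : measurableType d) (R : realType) (mu : {measure set T -> \bar R})
    (D : set T) (u : T -> R) :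
  cintegral mu D (fun x => (u x)%:C) = (\int[mu]_(x in D) u x)%:C.
Proof.
rewrite /cintegral; apply/eqP; rewrite eq_complex; apply/andP; split; apply/eqP => /=.
  by [].
by rewrite /Rintegral integral0.
Qed.

Lemma mulc_conj (R : realType) (w : R[i]) :
  w * w^*%C = ((@ComplexField.Normc.normc R) w ^+ 2)%:C.
Proof. by rewrite mulrC normc_conj_mul. Qed.

(** The integral of a non-negative function is a supremum over simple functions below it, so
    monotonicity in the domain holds without measurability; it is applied to |f'|^2 on all of
    [0,L). *)
Lemma ge0_integral_subset d (T : measurableType d) (R : realType) (mu : {measure set T -> \bar R})
    (A D : set T) (u : T -> \bar R) : A `<=` D -> (forall x, (0 <= u x)%E) ->
  (\int[mu]_(x in A) u x <= \int[mu]_(x in D) u x)%E.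
Proof.
move=> AD u0; rewrite integral_mkcond [leRHS]integral_mkcond.
have p0 (B : set T) x : (0 <= (u \_ B) x)%E by rewrite /patch; case: ifP.
rewrite !ge0_integralTE//; apply: ereal_sup_le => _ [h hA <-]; exists h => // x; apply: le_trans (hA x) _; rewrite /patch.
have [xA|] := boolP (x \in A); first by rewrite (mem_set (AD _ (set_mem xA))).
by case: ifP.
Qed.

Section conjugation.
Variables (R : realType) (L : \bar R).
Local Notation leb := (@lebesgue_measure R).
Implicit Types (f : R -> R[i]) (a c : R).

Lemma cdot_conj f a c : H1loc L f -> 0 <= a -> a <= c -> halfopen L c ->
  cdot f (fun x => (f x)^*%C) a c = (cenergy f a c)%:C.
Proof.
move=> Hf a0 ac dc; rewrite /cenergy /sqnorm -cintegral_real /cdot.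
have mI : measurable (`[a, c]%classic : set (measurableTypeR R)) by exact: measurable_itv.
have Lf := H1loc_L2_itv Hf a0 dc.
apply: ae_eq_cintegral => //.
- apply: cmeasurableM; first by exact: Lf.1.
  exact: (H1loc_cmeasurable_cderiv (H1locJ Hf) a0 dc).
- split; last exact: measurable_cst.
  by apply: measurable_funX; apply: cmeasurable_normc; exact: Lf.1.
- apply: ae_leb_imp (H1loc_cdiff_itv Hf a0 dc) => x df xac.
  by rewrite (cderivJ (df xac)) mulc_conj.
Qed.

Lemma cenergy_conj f a c : H1loc L f -> 0 <= a -> halfopen L c ->
  cenergy (fun x => (f x)^*%C) a c = cenergy f a c.
Proof.
move=> Hf a0 dc; have mI : measurable (`[a, c]%classic : set (measurableTypeR R)) by exact: measurable_itv.
rewrite (cenergyE (H1locJ Hf) a0 dc (L2_conj (H1loc_L2_itv Hf a0 dc))).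
  rewrite /cenergy /sqnorm; congr (fine (integral _ _ _)).
  by apply/funext => x; rewrite normcJ.
by apply: ae_leb_imp (H1loc_cdiff_itv Hf a0 dc) => x df xac; exact: cderivJ (df xac).
Qed.

Lemma cenergy_le_integral f (D : set R) c : H1loc L f -> halfopen L c -> `[0, c]%classic `<=` D ->
  ((cenergy f 0 c)%:E <=
   \int[leb]_(x in D) ((@ComplexField.Normc.normc R) (cderiv f x) ^+ 2)%:E)%E.
Proof.
move=> Hf dc cD; have mI : measurable (`[0, c]%classic : set (measurableTypeR R)) by exact: measurable_itv.
have i1 := L2_sqr_integrable (H1loc_L2 Hf dc).
rewrite /cenergy /sqnorm /Rintegral fineK; last exact: integrable_fin_num i1.
by apply: ge0_integral_subset => // x; rewrite lee_fin sqr_ge0.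
Qed.

End conjugation.

Opaque H1loc cenergy cdot sqnorm.

(** * The energy inequality for Weyl solutions *)

Section Weyl_solutions.
Variables (R : realType) (S : indefinite_string R).
Local Notation C := R[i].
Local Notation normc := (@ComplexField.Normc.normc R).
Local Notation Re := (@complex.Re R).
Local Notation Im := (@complex.Im R).
Local Notation leb := (@lebesgue_measure R).
Local Notation L := (len S).
Local Notation ups := (upsilon S).
Local Notation dom := (halfopen L).
Local Notation H1 := (@H1loc R L).
Local Notation test := (test L).
Implicit Types (f g h : R -> C) (a b c x y e : R) (z : C).

Lemma upsilon_itv_fin c : dom c -> (ups `[0%R, c]%classic < +oo)%E.
Proof.
move=> dc; apply: upsilon_fin; first exact: segment_compact.
by move=> x; rewrite /= in_itv/= => /andP[x0 xc]; exact: (domS dc).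
Qed.

Lemma omega_lin z g h c : test c g -> test c h ->
  omega S (fun x => z * g x + h x) = z * omega S g + omega S h.
Proof. by move=> tg th; have [lin _] := omega_dual S; exact: (lin z g h (test_H1c tg) (test_H1c th)). Qed.

Lemma omega_bounded c : dom c -> exists2 B : R, 0 <= B &
  forall h, test c h -> normc (omega S h) ^+ 2 <= B * cenergy h 0 c.
Proof.
move=> dc; have [_ bnd] := omega_dual S.
have [B HB] := bnd c (mem_set dc).
exists (B ^+ 2 * (c ^+ 2 + 1)); first by rewrite mulr_ge0 ?addr_ge0 ?sqr_ge0.
move=> h th; apply: (@le_trans _ _ ((B * H1norm c h) ^+ 2)).
  have h1 := HB h (test_H1c th) (test_supp th).
  by rewrite ler_pXn2r ?nnegrE ?normc_ge0 ?(le_trans _ h1) ?normc_ge0.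
by rewrite exprMn -mulrA ler_wpM2l ?sqr_ge0// (H1norm_le th).
Qed.

Lemma omega_supp c h : test c h -> (forall x, 0 <= x -> dom x -> h x = 0) -> omega S h = 0.
Proof.
move=> th h0; have [dc Hh _] := th; have [B B0 HB] := omega_bounded dc.
apply: ComplexField.Normc.eq0_normc; apply/eqP; rewrite -sqrf_eq0 eq_le sqr_ge0 andbT.
apply: le_trans (HB _ th) _; rewrite (cenergy0 Hh (lexx 0) (dom0 dc) dc) ?mulr0//.
move=> x x0c; rewrite -(cderiv_cst 0 x); apply: (cderiv_eq_oo (a := 0) (b := c)) => // t /andP[t0 tc].
by apply: h0; [exact: ltW|apply: (domS dc); exact: ltW].
Qed.

Lemma solution_eq z psi d h c : is_solution S z psi d -> test c h ->
  d * h 0 + cdot psi h 0 c =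
  z * omega S (fun x => psi x * h x) + z ^+ 2 * cintegral ups `[0, c]%classic (fun x => psi x * h x).
Proof.
move=> [_ eq] th; have [dc Hh hc] := th; have := eq h (test_H1c th).
have sub : `[0, c]%classic `<=` dom.
  by move=> x; rewrite /= in_itv/= => /andP[x0 xc]; exact: (domS dc).
have out x : dom x -> ~ (`[0, c]%classic : set R) x -> c < x.
  by move=> [x0 _]; rewrite /= in_itv/= x0/= => /negP; rewrite -ltNge.
rewrite (cintegral_subset leb sub); last first.
  move=> x dx xc; rewrite [cderiv h x](_ : _ = 0) ?mulr0//.
  have cx := out x dx xc; have [y xy dy] : exists2 y, x < y & dom y.
    move: dx => [x0]; case: L => [l| |]//= xl.
      rewrite lte_fin in xl; exists ((x + l) / 2); first by rewrite midf_lt.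
      by split; [rewrite divr_ge0// addr_ge0// ltW// (le_lt_trans x0)|rewrite lte_fin midf_lt].
    by exists (x + 1); [rewrite ltrDl|split; [rewrite addr_ge0|rewrite ltry]].
  rewrite -(cderiv_cst 0 x); apply: (cderiv_eq_oo (a := c) (b := y)); last by rewrite cx.
  move=> t /andP[ct ty]; apply: hc; first exact: ltW.
  apply: (domS dy); last exact: ltW.
  by apply: le_trans (ltW ct); exact: dom0 dc.
rewrite (cintegral_subset ups sub) //.
by move=> x dx xc; rewrite (hc x (ltW (out x dx xc)) dx) mulr0.
Qed.

(** The integrand k |psi|^2 is real and non-negative; J is its integral, bounded below by the part
    over [0,b], where the cut-off is 1. *)
Lemma cintegral_conj_mul psi k c b : H1 psi -> H1 (fun x => (k x)%:C) -> dom c ->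
  (forall x, 0 <= k x) -> 0 <= b -> b <= c -> (forall x, x <= b -> k x = 1) ->
  exists2 J : R, sqnorm ups `[0, b]%classic psi <= J &
    cintegral ups `[0, c]%classic (fun x => psi x * ((k x)%:C * (psi x)^*%C)) = J%:C.
Proof.
move=> Hp Hk dc k0 b0 bc k1.
have mc : measurable (`[0, c]%classic : set (measurableTypeR R)) by exact: measurable_itv.
have mb : measurable (`[0, b]%classic : set (measurableTypeR R)) by exact: measurable_itv.
have db : dom b := domS dc b0 bc.
have sub : `[0, b]%classic `<=` `[0, c]%classic by exact: itvccS.
have e x : psi x * ((k x)%:C * (psi x)^*%C) = (k x * normc (psi x) ^+ 2)%:C.
  by rewrite mulrCA mulc_conj -rmorphM.
pose u x := k x * normc (psi x) ^+ 2.
have iu : ups.-integrable `[0, c]%classic (fun x => (u x)%:E).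
  have [i1 _] := L2_mul mc (L2_ups upsilon_itv_fin Hp dc mc (@subset_refl _ _))
    (L2_ups upsilon_itv_fin (H1locM Hk (H1locJ Hp)) dc mc (@subset_refl _ _)).
  by apply: (eq_integrable mc _ _ _ i1) => x _; rewrite e.
have u0 x : 0 <= u x by rewrite mulr_ge0 ?sqr_ge0.
exists (\int[ups]_(x in `[0, c]%classic) u x); last first.
  by rewrite -cintegral_real; apply: eq_cintegral => x _; exact: e.
apply: (@le_trans _ _ (\int[ups]_(x in `[0, b]%classic) u x)).
  rewrite le_eqVlt; apply/orP; left; apply/eqP; apply: eq_Rintegral => x.
  by rewrite inE /= in_itv/= => /andP[_ xb]; rewrite /u k1// mul1r.
apply: fine_le.
- by apply: integrable_fin_num => //; apply: integrableS iu.
- exact: integrable_fin_num.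
- apply: ge0_subset_integral => //; first exact: (measurable_int _ iu).
  by move=> x _; rewrite lee_fin.
Qed.

(** The equation is tested with the conjugate of psi times a cut-off, divided by z, and its
    imaginary part is taken. The omega term drops out because omega is real and its argument is the
    real function k |psi|^2; what remains of the cut-off is the integral over [c,c2]. *)
Lemma Weyl_cutoff z psi d c c2 : nonreal z -> is_solution S z psi d -> 0 <= c -> c < c2 -> dom c2 ->
  cenergy psi 0 c / normc z ^+ 2 + sqnorm ups `[0, c]%classic psi <=
  Im (d * (psi 0)^*%C / z) / Im z +
  normc (cdot psi (fun x => descent c c2 x * (psi x)^*%C) c c2) / (normc z * `|Im z|).
Proof.
move=> nz sol c0 cc2 dc2; have [Hp _] := sol.
have dc : dom c := domS dc2 c0 (ltW cc2).
have Hk := H1_descent c0 cc2 dc2; have HJ := H1locJ Hp.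
pose h x := descent c c2 x * (psi x)^*%C.
have Hh : H1 h := H1locM Hk HJ.
have th : test c2 h.
  split; [exact: dc2|exact: Hh|move=> x cx _].
  by rewrite /h (descent_high cc2 cx) mul0r.
have eq := solution_eq sol th.
have h0 : h 0 = (psi 0)^*%C by rewrite /h (descent_low cc2 c0) mul1r.
have [J HJ1 HJ2] : exists2 J : R, sqnorm ups `[0, c]%classic psi <= J &
    cintegral ups `[0, c2]%classic (fun x => psi x * h x) = J%:C.
  pose k x := (c2 - clamp c c2 x) / (c2 - c).
  have k0 x : 0 <= k x by have /andP[h1 h2] := descent_bound x cc2.
  have k1 x : x <= c -> k x = 1.
    by move=> xc; rewrite /k (clamp_low c2 xc) mulfV// subr_eq0 gt_eqF.
  exact: (cintegral_conj_mul Hp Hk dc2 k0 c0 (ltW cc2) k1).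
rewrite HJ2 h0 (cdot_split Hp Hh (lexx 0) c0 (ltW cc2) dc2) in eq.
have e1 : cdot psi h 0 c = (cenergy psi 0 c)%:C.
  rewrite -(cdot_conj Hp (lexx 0) c0 dc); apply: (eq_cdot Hp Hh HJ (lexx 0) c0 dc) => x xc.
  apply: (cderiv_eq_oo (a := 0) (b := c)) => // t /andP[t0 tc].
  by rewrite /h (descent_low cc2 (ltW tc)) mul1r.
rewrite e1 in eq; set T := cdot psi h c c2 in eq *; set E := cenergy psi 0 c in eq *.
set w := omega S _ in eq.
have w0 : Im w = 0.
  apply: (omega_real (i := S)).
    by apply: (test_H1c (c := c2)); exact: testM.
  move=> x _; rewrite /h mulrCA mulc_conj /descent -rmorphM /=.
  by [].
have z0 : z != 0 by apply: contra_neq nz => ->.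
have zn : 0 < normc z.
  rewrite lt_neqAle normc_ge0 andbT eq_sym; apply: contra z0.
  by move=> /eqP/ComplexField.Normc.eq0_normc ->.
have eq2 : d * (psi 0)^*%C / z + E%:C / z + T / z = w + z * J%:C.
  by rewrite -!mulrDl -addrA eq; field.
have Imz : Im z != 0 by [].
have eq3 : Im (d * (psi 0)^*%C / z) - E * Im z / normc z ^+ 2 + Im (T / z) = Im z * J.
  have := congr1 Im eq2.
  have -> : Im (w + z * J%:C) = Im z * J.
    by move: w0; case: (w) => p q /= ->; case: (z) => u v /=; ring.
  move=> <-.
  have -> : E%:C / z = (E / normc z ^+ 2)%:C * z^*%C.
    have n0 : (normc z ^+ 2)%:C != 0 :> C by rewrite fmorph_eq0 sqrf_eq0 gt_eqF.
    apply: (mulIf z0); rewrite divfK// -mulrA normc_conj_mul -rmorphM /= divfK//.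
    by rewrite sqrf_eq0 gt_eqF.
  case: (d * _ / z) => p1 q1; case: (T / z) => p2 q2; move: (normc z) => r; case: (z) => u v /=; ring.
have TI : - (normc T / (normc z * `|Im z|)) <= - (Im (T / z) / Im z).
  rewrite lerN2; apply: le_trans (ler_norm _) _; rewrite normrM normfV invfM mulrA.
  rewrite ler_pM2r ?invr_gt0 ?normr_gt0//.
  by apply: le_trans (Im_le_normc _) _; rewrite normcM ComplexField.Normc.normcV.
have -> : E / normc z ^+ 2 = Im (d * (psi 0)^*%C / z) / Im z + Im (T / z) / Im z - J.
  apply: (mulIf Imz); rewrite !mulrDl mulNr !divfK// [J * _]mulrC -eq3; ring.
rewrite lerN2 in TI; rewrite -!addrA lerD2l; apply: le_trans TI.
by rewrite gerDl addrC subr_le0.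
Qed.

(** * Weyl solutions near the right endpoint *)

Section tail.
Variables (psi : R -> C).
Hypothesis Hp : H1 psi.
Hypothesis fin : (\int[leb]_(x in dom) (normc (cderiv psi x) ^+ 2)%R%:E < +oo)%E.
Hypothesis psi_end : forall l, L = l%:E -> normc (psi x) @[x --> l^'-] --> (0 : R).

Lemma psi_end_small l e : L = l%:E -> 0 < e -> exists2 x0, dom x0 &
  forall x, x0 <= x -> dom x -> normc (psi x) <= e.
Proof.
move=> Ll e0; have := cvgr_le _ (psi_end Ll) e e0; case=> r /= r0 Hr.
have l0 : 0 < l by have := len_gt0 S; rewrite Ll lte_fin.
pose x0 := Num.max (l / 2) (l - r / 2).
have x0l : x0 < l by rewrite gt_max; apply/andP; split; lra.
exists x0; first by split; [rewrite le_max divr_ge0// ltW|rewrite Ll lte_fin].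
move=> x xx [_]; rewrite Ll lte_fin => xl; apply: Hr => //=.
rewrite ger0_norm ?subr_ge0 ?ltW//; have : l - r / 2 <= x by apply: le_trans xx; rewrite le_max lexx orbT.
by lra.
Qed.

Lemma Weyl_energy_bounded : exists2 K : R, 0 <= K & forall x, dom x -> cenergy psi 0 x <= K.
Proof.
have I0 : (0 <= \int[leb]_(x in dom) (normc (cderiv psi x) ^+ 2)%R%:E)%E.
  by apply: integral_ge0 => x _; rewrite lee_fin sqr_ge0.
exists (fine (\int[leb]_(x in dom) (normc (cderiv psi x) ^+ 2)%R%:E)); first exact: fine_ge0.
move=> x dx; rewrite -lee_fin [X in (_ <= X)%E]fineK ?ge0_fin_numE//.
have := @cenergy_le_integral R L psi dom x Hp dx; apply.
by move=> y; rewrite /= in_itv/= => /andP[y0 yx]; exact: (domS dx).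
Qed.

(** The energy on [0,x] is bounded and increases with x; once it is within e of its supremum, at
    most e is left. *)
Lemma Weyl_tail e : 0 < e -> exists2 x0, dom x0 &
  forall x y, x0 <= x -> x <= y -> dom y -> cenergy psi x y <= e.
Proof.
move=> e0; have [K K0 HK] := Weyl_energy_bounded.
pose A := [set cenergy psi 0 x | x in dom].
have d0 : dom 0 by split => //; exact: len_gt0.
have As : has_sup A.
  split; first by exists (cenergy psi 0 0); exists 0.
  by exists K => _ [x dx <-]; exact: HK.
have [_ [x0 dx0 <-] Hx0] := sup_adherent e0 As.
exists x0 => // x y xx xy dy.
have x00 := dom0 dx0; have x0' : 0 <= x := le_trans x00 xx.
have h1 := cenergy_split Hp (lexx 0) x0' xy dy.
have h2 : cenergy psi 0 y <= sup A by apply: sup_upper_bound => //; exists y.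
have h3 := cenergy_le Hp (lexx 0) (lexx 0) x00 xx (domS dy x0' xy).
by lra.
Qed.

(** With |psi|^2 of the order c2 - c1, a cut-off between c1 and c2 costs bounded energy. For finite
    L, psi vanishes at L and the tail energy is at most 1, so |psi(x)|^2 <= L - c1 = 2 (c2 - c1);
    for infinite L, |psi(x)|^2 grows at most linearly and c2 = 2 c1 with c1 >= 1. The constant G
    covers both cases. *)
Lemma Weyl_cutoff_bound : exists2 G : R, 0 <= G & forall e c, 0 < e -> dom c ->
  exists c1 c2, [/\ c <= c1, c1 < c2, dom c2, cenergy psi c1 c2 <= e &
    forall x, c1 <= x <= c2 -> normc (psi x) ^+ 2 <= G * (c2 - c1)].
Proof.
have [K K0 HK] := Weyl_energy_bounded.
have n0 : 0 <= normc (psi 0) ^+ 2 by exact: sqr_ge0.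
exists (2 * normc (psi 0) ^+ 2 + 4 * K + 2); first by lra.
move=> e c e0 dc; have c0 := dom0 dc.
have e10 : 0 < Num.min e 1 by rewrite lt_min e0 ltr01.
have [x0 dx0 Hx0] := Weyl_tail e10.
have [[l Ll]|Linf] : (exists l, L = l%:E) \/ L = +oo%E.
  by have := len_gt0 S; case: L => [l| |]//; [left; exists l|right].
- pose c1 := Num.max c x0.
  have c1l : c1 < l.
    by rewrite gt_max; move: dc dx0 => [_]; rewrite Ll lte_fin => -> [_]; rewrite lte_fin.
  have cc1 : c <= c1 by rewrite le_max lexx.
  have x0c1 : x0 <= c1 by rewrite le_max lexx orbT.
  have c10 : 0 <= c1 := le_trans c0 cc1.
  have dc2 : dom ((c1 + l) / 2).
    by split; [rewrite divr_ge0// addr_ge0// ltW// (le_lt_trans c10)|rewrite Ll lte_fin midf_lt].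
  have c1c2 : c1 < (c1 + l) / 2 by rewrite midf_lt.
  exists c1, ((c1 + l) / 2); split => //.
    by apply: le_trans (Hx0 _ _ x0c1 (ltW c1c2) dc2) _; rewrite ge_min lexx.
  move=> x /andP[c1x xc2]; have xl : x < l by apply: le_lt_trans xc2 _; rewrite midf_lt.
  apply: (@le_trans _ _ (l - c1)); last first.
    have -> : (c1 + l) / 2 - c1 = (l - c1) / 2 by field.
    have : 0 <= (2 * normc (psi 0) ^+ 2 + 4 * K) * ((l - c1) / 2).
      apply: mulr_ge0; last by rewrite divr_ge0 ?subr_ge0 ?(ltW c1l).
      exact: (addr_ge0 (mulr_ge0 (ler0n _ 2) n0) (mulr_ge0 (ler0n _ 4) K0)).
    by rewrite [X in _ <= X]mulrDl; lra.
  have lc1 : 0 <= l - c1 by rewrite subr_ge0 ltW.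
  rewrite -[leRHS](sqr_sqrtr lc1) ler_pXn2r ?nnegrE ?normc_ge0 ?sqrtr_ge0//.
  apply/ler_addgt0Pr => r r0; have [y0 dy0 Hy0] := psi_end_small Ll r0.
  pose y := Num.max x y0.
  have yl : y < l by rewrite gt_max xl /=; move: dy0 => [_]; rewrite Ll lte_fin.
  have xy : x <= y by rewrite le_max lexx.
  have x0' : 0 <= x := le_trans c10 c1x.
  have dy : dom y by split; [exact: le_trans xy|rewrite Ll lte_fin].
  have h1 := Hy0 y ltac:(by rewrite le_max lexx orbT) dy.
  have h2 : normc (psi y - psi x) <= Num.sqrt (l - c1).
    rewrite -(ler_pXn2r (n := 2))// ?nnegrE ?normc_ge0 ?sqrtr_ge0// sqr_sqrtr//.
    apply: le_trans (H1loc_increment Hp x0' xy dy) _.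
    rewrite -[leRHS]mulr1; apply: ler_pM; rewrite ?subr_ge0 ?cenergy_ge0//.
      by apply: lerB => //; exact: ltW.
    apply: le_trans (Hx0 _ _ (le_trans x0c1 c1x) xy dy) _; by rewrite ge_min lexx orbT.
  rewrite -[psi x](subKr (psi y)); apply: le_trans (normcD _ _) _.
  by rewrite cnormN addrC; exact: lerD.
- pose c1 := Num.max 1 (Num.max c x0).
  have c11 : 1 <= c1 by rewrite le_max lexx.
  have c10 : 0 < c1 by exact: lt_le_trans c11.
  have cc1 : c <= c1 by rewrite !le_max lexx !orbT.
  have x0c1 : x0 <= c1 by rewrite !le_max lexx !orbT.
  have dc2 : dom (2 * c1) by split; [rewrite mulr_ge0// ltW|rewrite Linf ltry].
  have c1c2 : c1 < 2 * c1 by lra.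
  exists c1, (2 * c1); split => //.
    by apply: le_trans (Hx0 _ _ x0c1 (ltW c1c2) dc2) _; rewrite ge_min lexx.
  move=> x /andP[c1x xc2]; have x0' : 0 <= x by apply: le_trans c1x; exact: ltW.
  have dx : dom x := domS dc2 x0' xc2.
  rewrite -[psi x](subrK (psi 0)); apply: le_trans (normcD_sqr _ _) _.
  have h1 := H1loc_increment Hp (lexx 0) x0' dx; rewrite subr0 in h1.
  have h2 : x * cenergy psi 0 x <= 2 * c1 * K.
    by apply: ler_pM => //; [exact: cenergy_ge0|exact: HK].
  have h3 : normc (psi 0) ^+ 2 <= c1 * normc (psi 0) ^+ 2 by rewrite ler_peMl.
  have -> : 2 * c1 - c1 = c1 by ring.
  have -> : (2 * normc (psi 0) ^+ 2 + 4 * K + 2) * c1 =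
    2 * (2 * c1 * K) + 2 * (c1 * normc (psi 0) ^+ 2) + 2 * c1 by ring.
  apply: (@le_trans _ _ (2 * (2 * c1 * K) + 2 * (c1 * normc (psi 0) ^+ 2))); last first.
    by rewrite lerDl mulr_ge0// ltW.
  rewrite mulrDr; apply: lerD; rewrite ler_pM2l//; exact: le_trans h1 h2.
Qed.

Lemma Weyl_remainder e c : 0 < e -> dom c -> exists c1 c2, [/\ c <= c1, c1 < c2, dom c2 &
  normc (cdot psi (fun x => descent c1 c2 x * (psi x)^*%C) c1 c2) <= e].
Proof.
move=> e0 dc; have [G G0 HG] := Weyl_cutoff_bound.
(* The cut-off function has energy at most 2 (G + r) <= 2 (G + 1); with the tail energy below r, the
   bound of [cdot_CS] is 2 sqrt(e^2 / 4) = e. *)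
pose r := Num.min 1 (e ^+ 2 / (8 * (G + 1))).
have G1 : 0 < 8 * (G + 1) by rewrite mulr_gt0//; lra.
have eE : (e / 2) ^+ 2 = e ^+ 2 / (8 * (G + 1)) * (2 * (G + 1)).
  by field; rewrite gt_eqF//; lra.
have r0 : 0 < r by rewrite lt_min ltr01 divr_gt0// exprn_gt0.
have [c1 [c2 [cc1 c1c2 dc2 Er Hx]]] := HG r c r0 dc.
have c10 : 0 <= c1 := le_trans (dom0 dc) cc1.
exists c1, c2; split => //.
have Hk := H1_descent c10 c1c2 dc2; have HJ := H1locJ Hp.
have Hh := H1locM Hk HJ; have cc : 0 < c2 - c1 by rewrite subr_gt0.
apply: le_trans (cdot_CS Hp Hh c10 dc2) _.
have Eh : cenergy (fun x => descent c1 c2 x * (psi x)^*%C) c1 c2 <= 2 * (G + 1).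
  have b1 x : c1 <= x <= c2 -> normc (descent c1 c2 x) <= 1.
    move=> _; have /andP[h1 h2] := descent_bound x c1c2.
    by rewrite /descent normc_real ger0_norm.
  have b2 x : c1 <= x <= c2 -> normc (psi x)^*%C <= Num.sqrt (G * (c2 - c1)).
    move=> xc; have h := Hx x xc; rewrite normcJ.
    rewrite -(ler_pXn2r (n := 2))// ?nnegrE ?normc_ge0 ?sqrtr_ge0// sqr_sqrtr//.
    by apply: le_trans h; exact: sqr_ge0.
  apply: le_trans (cenergyM Hk HJ c10 (ltW c1c2) dc2 b1 b2) _.
  rewrite ler_pM2l// (cenergy_descent c10 c1c2 dc2) (cenergy_conj Hp c10 dc2) expr1n mul1r.
  rewrite sqr_sqrtr; last by rewrite mulr_ge0// ltW.
  rewrite mulfK ?gt_eqF//; apply: lerD => //; apply: (le_trans Er).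
  by rewrite ge_min lexx.
have Er' : cenergy psi c1 c2 <= e ^+ 2 / (8 * (G + 1)).
  by apply: (le_trans Er); rewrite ge_min lexx orbT.
have EE : cenergy psi c1 c2 * cenergy (fun x => descent c1 c2 x * (psi x)^*%C) c1 c2 <= (e / 2) ^+ 2.
  rewrite eE.
  by apply: ler_pM; rewrite ?cenergy_ge0.
rewrite -sqrtrM ?cenergy_ge0//.
have -> : e = 2 * Num.sqrt ((e / 2) ^+ 2).
  by rewrite sqrtr_sqr ger0_norm ?divr_ge0 ?ltW//; field.
by rewrite ler_pM2l// ler_wsqrtr.
Qed.

End tail.

(** [Weyl_cutoff] is applied beyond c, with a cut-off for which [Weyl_remainder] makes the error
    term arbitrarily small. Finite energy and the condition at L enter only here. *)
Lemma Weyl_energy z psi d c : nonreal z -> is_Weyl_solution S z psi d -> dom c ->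
  cenergy psi 0 c / normc z ^+ 2 + sqnorm ups `[0, c]%classic psi <= Im (d * (psi 0)^*%C / z) / Im z.
Proof.
move=> nz [sol _ fin pe] dc; have [Hp _] := sol; have c0 := dom0 dc.
have fin1 : (\int[leb]_(x in dom) (normc (cderiv psi x) ^+ 2)%R%:E < +oo)%E.
  apply: le_lt_trans fin; rewrite leeDl//; apply: integral_ge0 => x _.
  by rewrite lee_fin sqr_ge0.
have z0 : z != 0 by apply: contra_neq nz => ->.
have zn : 0 < normc z.
  rewrite lt_neqAle normc_ge0 andbT eq_sym; apply: contra z0.
  by move=> /eqP/ComplexField.Normc.eq0_normc ->.
have zi : 0 < `|Im z| by rewrite normr_gt0.
apply/ler_addgt0Pr => e e0.
have e0' : 0 < e * (normc z * `|Im z|) by rewrite !mulr_gt0.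
have [c1 [c2 [cc1 c1c2 dc2 Hr]]] := Weyl_remainder Hp fin1 pe e0' dc.
have c10 : 0 <= c1 := le_trans c0 cc1.
have dc1 : dom c1 := domS dc2 c10 (ltW c1c2).
have h1 := Weyl_cutoff nz sol c10 c1c2 dc2.
apply: (@le_trans _ _ (cenergy psi 0 c1 / normc z ^+ 2 + sqnorm ups `[0, c1]%classic psi)).
  apply: lerD.
    rewrite ler_pM2r ?invr_gt0 ?exprn_gt0//.
    exact: (cenergy_le Hp (lexx 0) (lexx 0) c0 cc1 dc1).
  apply: (sqnorm_ups_le upsilon_itv_fin Hp dc1) => //; exact: itvccS.
apply: (le_trans h1); rewrite lerD2l ler_pdivrMr ?mulr_gt0//.
Qed.

(** If psi(0) = 0, the right side of [Weyl_energy] is 0, so psi has no energy and is identically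
    zero. *)
Lemma Weyl_solution_at0 z psi d : nonreal z -> is_Weyl_solution S z psi d -> psi 0 != 0.
Proof.
move=> nz W; have [[Hp _] [x /set_mem dx px] _ _] := W; apply: contra px => /eqP p0.
have x0 := dom0 dx.
have := Weyl_energy nz W dx; rewrite p0.
have -> : (0 : C)^*%C = 0 by apply/eqP; rewrite eq_complex /= oppr0 !eqxx.
rewrite mulr0 mul0r [Im 0]/(0 : R) mul0r => h.
have z0 : z != 0 by apply: contra_neq nz => ->.
have zn : 0 < normc z ^+ 2.
  rewrite exprn_gt0// lt_neqAle normc_ge0 andbT eq_sym; apply: contra z0.
  by move=> /eqP/ComplexField.Normc.eq0_normc ->.
have E0 : cenergy psi 0 x <= 0.
  have : cenergy psi 0 x / normc z ^+ 2 <= 0.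
    by apply: le_trans h; rewrite lerDl sqnorm_ge0.
  by rewrite ler_pdivrMr// mul0r.
have := H1loc_increment Hp (lexx 0) x0 dx; rewrite p0 !subr0 => h2.
apply/eqP/ComplexField.Normc.eq0_normc/eqP; rewrite -sqrf_eq0 eq_le sqr_ge0 andbT.
apply: (le_trans h2); apply: mulr_ge0_le0 => //.
Qed.

(** The Weyl solutions are chosen for all z at once and divided by their values at 0, so that
    [z * m z] becomes their derivative at 0-. *)
Lemma initial_state m : is_Weyl_Titchmarsh S m ->
  exists f : C -> R -> C, state L ups 0 (omega S) m f.
Proof.
move=> mW.
pose P z psi := nonreal z -> exists d, is_Weyl_solution S z psi d /\ m z = d / (z * psi 0).
have [psi Hpsi] : {psi : C -> R -> C & forall z, P z (psi z)}.
  apply: choice => z.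
  have [nz|rz] := pselect (nonreal z); last by exists (fun=> 0).
  by have [p [d H]] := mW z nz; exists p => _; exists d.
have p0 z (nz : nonreal z) : psi z 0 != 0.
  by have [d [W _]] := Hpsi z nz; exact: Weyl_solution_at0 W.
have Hp z (nz : nonreal z) : H1 (psi z) by have [d [[[]]]] := Hpsi z nz.
have pn z (nz : nonreal z) : 0 < normc (psi z 0).
  rewrite lt_neqAle normc_ge0 andbT eq_sym; apply: contra (p0 z nz).
  by move=> /eqP/ComplexField.Normc.eq0_normc ->.
have nz0 z (nz : nonreal z) : z != 0 by apply: contra_neq nz => ->.
exists (fun z x => (psi z 0)^-1 * psi z x); split.
- by split => //; exact: len_gt0.
- exact: omega_lin.
- exact: omega_bounded.
- exact: omega_supp.
- by move=> z nz; apply: H1locZ; exact: Hp.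
- by move=> z nz; rewrite mulVf ?p0.
- move=> z h c nz th c0; have [d [W mE]] := Hpsi z nz; have [dc Hh hc] := th.
  have [sol _ _ _] := W; have eq := solution_eq sol th.
  have mI : measurable (`[0, c]%classic : set (measurableTypeR R)) by exact: measurable_itv.
  have e1 : (fun x => (psi z 0)^-1 * psi z x * h x) = (fun x => (psi z 0)^-1 * (psi z x * h x)).
    by apply/funext => x; rewrite mulrA.
  have tph : test c (fun x => psi z x * h x) := testM (Hp z nz) th.
  rewrite e1 cintegralZ; last first.
  + by apply: L2_mul => //; [exact: (L2_ups upsilon_itv_fin (Hp z nz) dc mI (@subset_refl _ _))
      |exact: (L2_ups upsilon_itv_fin Hh dc mI (@subset_refl _ _))].
  + exact: mI.
  have -> : omega S (fun x => (psi z 0)^-1 * (psi z x * h x)) =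
      (psi z 0)^-1 * omega S (fun x => psi z x * h x).
    have := omega_lin (psi z 0)^-1 tph (test0 dc).
    rewrite [omega S (fun=> 0)](omega_supp (test0 dc))// addr0 => <-.
    by congr (omega S); apply/funext => x; rewrite addr0.
  rewrite cdotC (cdotZ _ Hh (Hp z nz) (lexx 0) c0 dc) cdotC.
  have -> : z * m z * h 0 = (psi z 0)^-1 * (d * h 0).
    by rewrite mE; field; rewrite p0 ?nz0.
  by rewrite -mulrDr eq; ring.
- move=> z c nz c0 dc; have [d [W mE]] := Hpsi z nz.
  have mI : measurable (`[0, c]%classic : set (measurableTypeR R)) by exact: measurable_itv.
  rewrite (cenergyZ _ (Hp z nz) (lexx 0) c0 dc).
  rewrite (sqnormZ mI _ (L2_ups upsilon_itv_fin (Hp z nz) dc mI (@subset_refl _ _))).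
  rewrite ComplexField.Normc.normcV exprVn -mulrA -mulrDr mulrC ler_pdivrMr ?exprn_gt0 ?pn//.
  apply: le_trans (Weyl_energy nz W dc) _.
  have -> : d * (psi z 0)^*%C / z = (normc (psi z 0) ^+ 2)%:C * m z.
    by rewrite mE -mulc_conj; field; rewrite p0 ?nz0.
  rewrite le_eqVlt; apply/orP; left; apply/eqP.
  by case: (m z) => p q /=; ring.
- move=> z l nz Ll e e0; have [d [[_ _ _ pe] _]] := Hpsi z nz.
  have e0' : 0 < e * normc (psi z 0) by rewrite mulr_gt0 ?pn.
  have [x0 dx0 Hx0] := psi_end_small pe Ll e0'.
  exists x0 => // x xx dx; rewrite normcM ComplexField.Normc.normcV ler_pdivrMl ?pn//.
  by rewrite mulrC Hx0.
Qed.

End Weyl_solutions.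

(** * Hankel determinants of reciprocal power series *)

Section Hankel_determinants.
Variable F : fieldType.
Implicit Types (s g : nat -> F) (k l n : nat).

(** Extension by zero to negative indices, as in the entries of a triangular Toeplitz matrix. *)
Definition zext s (i : int) : F := if i is Posz n then s n else 0.

Lemma zext_neg s (i : int) : (i < 0)%R -> zext s i = 0.
Proof. by case: i. Qed.

Definition hankel (s : int -> F) (j : int) (k : nat) : F :=
  \det (\matrix_(p < k, q < k) s (j + p%:Z + q%:Z)).

(** The sign (-1)^(n(n-1)/2) of the permutation that reverses n rows. *)
Fixpoint anti_sign n : F := if n is n'.+1 then (-1) ^+ n' * anti_sign n' else 1.

Lemma anti_sign_sqr n : anti_sign n * anti_sign n = 1.
Proof.
elim: n => [|n IH] /=; first by rewrite mulr1.
by rewrite mulrACA IH mulr1 -expr2 sqrr_sign.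
Qed.

(** The lower triangular Toeplitz matrix of s with its columns in reverse order, so that its blocks
    are Hankel matrices. *)
Definition anti_mx s n : 'M[F]_n := \matrix_(i < n, j < n) zext s (i%:Z + j%:Z - n.-1%:Z).

Lemma det_anti_mx s n : \det (anti_mx s n) = anti_sign n * s 0%N ^+ n.
Proof.
elim: n => [|n IH]; first by rewrite det_mx00 mulr1.
rewrite (expand_det_row _ ord0) (bigD1 ord_max)//= big1 ?addr0; last first.
  move=> j jm; rewrite mxE /= add0r.
  have jn : (j < n)%N by rewrite ltn_neqAle -ltnS ltn_ord andbT.
  by rewrite zext_neg ?mul0r// subr_lt0 ltz_nat.
rewrite mxE /= add0r subrr /= /cofactor /= add0n exprS.
suff -> : row' ord0 (col' ord_max (anti_mx s n.+1)) = anti_mx s n.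
  by rewrite IH; ring.
apply/matrixP => i j; rewrite !mxE /= /bump /= leqNgt ltn_ord /= add0n add1n.
congr zext; case: n i j IH => [[]//|n] i j _ /=.
by lia.
Qed.

Definition reciprocal_series s g := forall n,
  \sum_(i < n.+1) s i * g (n - i)%N = (n == 0%N)%:R.

Lemma zext_conv s g n (i j : 'I_n) : reciprocal_series s g ->
  \sum_(m < n) zext g (i%:Z - m%:Z) * zext s (m%:Z - j%:Z) = (i == j)%:R.
Proof.
move=> sg; have [ij|ji] := ltnP i j.
  have -> : (i == j) = false by apply/negbTE; apply: contraTneq ij => ->; rewrite ltnn.
  apply: big1 => m _; have [mj|jm] := ltnP m j.
    by rewrite (zext_neg s) ?mulr0// subr_lt0 ltz_nat.
  by rewrite (zext_neg g) ?mul0r// subr_lt0 ltz_nat (leq_trans ij jm).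
have := sg (i - j)%N.
have -> : ((i - j)%N == 0%N) = (i == j).
  by rewrite subn_eq0; apply/idP/eqP => [h|->//]; apply: val_inj; apply/eqP; rewrite eqn_leq h ji.
move=> <-.
rewrite -(big_mkord xpredT (fun m => zext g (i%:Z - m%:Z) * zext s (m%:Z - j%:Z))).
rewrite -(big_mkord xpredT (fun m => s m * g (i - j - m)%N)).
have jn : (j <= n)%N by exact: ltnW.
have iN : (i.+1 <= n)%N by [].
rewrite (big_cat_nat (n := j))//= big_nat big1 ?add0r; last first.
  by move=> m /andP[_ mj]; rewrite (zext_neg s) ?mulr0// subr_lt0 ltz_nat.
rewrite (big_cat_nat (n := i.+1))//=; last exact: leqW.
rewrite [X in _ + X]big_nat [X in _ + X]big1 ?addr0; last first.
  by move=> m /andP[im _]; rewrite (zext_neg g) ?mul0r// subr_lt0 ltz_nat.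
rewrite -{1}[nat_of_ord j]add0n big_addn subSn// big_nat [in RHS]big_nat.
apply: eq_bigr => m /andP[_ mij].
have -> : ((m + j)%:Z - j%:Z)%R = m%:Z by lia.
have -> : (i%:Z - (m + j)%:Z)%R = (i - j - m)%N%:Z by lia.
by rewrite mulrC.
Qed.

Lemma anti_mx_mul s g n : reciprocal_series s g ->
  anti_mx g n *m (\matrix_(i < n, j < n) zext s (n.-1%:Z - i%:Z - j%:Z)) = 1%:M.
Proof.
move=> sg; apply/matrixP => i j; rewrite !mxE.
rewrite -(zext_conv i j sg) (reindex_inj rev_ord_inj) /=; apply: eq_bigr => m _.
rewrite !mxE /=; congr (zext _ _ * zext _ _); have := ltn_ord m; lia.
Qed.

(* The triangular Toeplitz matrices of reciprocal series are inverse to each other; read with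
   reversed rows, their minors are Hankel determinants, and Jacobi's identity for complementary
   minors of inverse matrices applies. *)
Lemma hankel_reciprocal s g k l : reciprocal_series s g ->
  hankel (zext g) (l%:Z - k%:Z + 1) k =
  anti_sign (k + l) * g 0%N ^+ (k + l) * hankel (zext s) (k%:Z - l%:Z + 1) l.
Proof.
move=> sg; pose n := (l + k)%N.
pose A : 'M[F]_(l + k) := anti_mx g n.
pose B : 'M[F]_(l + k) := \matrix_(i < n, j < n) zext s (n.-1%:Z - i%:Z - j%:Z).
have AB : A *m B = 1%:M by exact: anti_mx_mul.
(* Jacobi's identity in matrix form: the left block column is that of A B = 1. Taking determinants
   expresses the lower right minor of A by det A and the upper left minor of B. *)
have e : A *m block_mx (ulsubmx B) 0 (dlsubmx B) 1%:M = block_mx 1%:M (ursubmx A) 0 (drsubmx A).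
  rewrite -{1}[A]submxK mulmx_block !mulmx0 !mulmx1 !add0r.
  move: AB; rewrite -{1}[A]submxK -{1}[B]submxK mulmx_block -[1%:M]submxK.
  move/eq_block_mx => [-> _ -> _].
  congr block_mx; apply/matrixP => i j; rewrite !mxE.
    by rewrite (inj_eq (@lshift_inj _ _)).
  by rewrite eq_rlshift.
have := congr1 determinant e.
rewrite det_mulmx det_lblock det_ublock det1 det1 mul1r mulr1 det_anti_mx => d.
have -> : hankel (zext g) (l%:Z - k%:Z + 1) k = \det (drsubmx A).
  congr determinant; apply/matrixP => p q; rewrite !mxE /= /n; congr zext.
  by have := ltn_ord p; move: (nat_of_ord p) (nat_of_ord q) => p' q' pk; clear -pk; lia.
rewrite -d addnC; congr (_ * _).
rewrite /hankel.
(* The corner of B is this Hankel matrix with both rows and columns reversed, so the two signs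
   cancel. *)
have -> : \matrix_(p < l, q < l) zext s (k%:Z - l%:Z + 1 + p%:Z + q%:Z) =
  row_perm (perm (@rev_ord_inj l)) (col_perm (perm (@rev_ord_inj l)) (ulsubmx B)).
  apply/matrixP => p q; rewrite !mxE /= !permE /= /n; congr zext.
  have := ltn_ord p; have := ltn_ord q; move: (nat_of_ord p) (nat_of_ord q) => p' q' h1 h2.
  by clear -h1 h2; lia.
rewrite row_permE col_permE !det_mulmx !det_perm odd_permV.
by rewrite mulrC -mulrA -expr2 sqrr_sign mulr1.
Qed.

(** The two matrices differ in the top left entry only, and its cofactor is the Hankel determinant
    with index raised by 2. *)
Lemma hankel_first_entry (u u' : int -> F) (c : int) m :
  (forall i : nat, u (c + i.+1%:Z) = u' (c + i.+1%:Z)) ->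
  hankel u c m.+1 = hankel u' c m.+1 + (u c - u' c) * hankel u (c + 2) m.
Proof.
move=> uu'.
pose A : 'M[F]_m.+1 := \matrix_(p, q) u (c + p%:Z + q%:Z).
pose B : 'M[F]_m.+1 := \matrix_(p, q) u' (c + p%:Z + q%:Z).
pose D : 'M[F]_m.+1 := \matrix_(p, q) if p == ord0 then (q == ord0)%:R else A p q.
have uE (p q : nat) : (0 < p + q)%N -> u (c + p%:Z + q%:Z) = u' (c + p%:Z + q%:Z).
  move=> pq; have -> : (c + p%:Z + q%:Z = c + (p + q).-1.+1%:Z)%R by lia.
  exact: uu'.
have -> : hankel u c m.+1 = 1 * \det B + (u c - u' c) * \det D.
  apply: (determinant_multilinear (i0 := ord0)).
  - apply/rowP => q; rewrite !mxE /= mul1r addr0.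
    case: q => -[|q] hq /=; first by rewrite mulr1 addr0 addrC subrK.
    by rewrite mulr0 addr0; have := uE 0%N q.+1 isT; rewrite addr0.
  - by apply/matrixP => p q; rewrite !mxE; apply/esym/uE.
  - by apply/matrixP => p q; rewrite !mxE.
rewrite mul1r; congr (_ + _ * _).
rewrite (expand_det_row D ord0) (bigD1 ord0)//= big1 ?addr0; last first.
  by move=> q q0; rewrite mxE /= (negbTE q0) mul0r.
rewrite mxE /= mul1r /cofactor /= expr0 mul1r; congr determinant.
apply/matrixP => p q; rewrite !mxE /= /bump /= !add1n; congr u; lia.
Qed.

(** * Hankel determinants before and after a step *)

Section step.
Variables (s s' : int -> F) (g P sig : nat -> F) (d : nat).
Hypotheses (sg : reciprocal_series (fun n => s n%:Z) g) (d0 : (0 < d)%N) (d2 : (d <= 2)%N).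
Hypotheses (PE : forall i, P i = g (i + d)%N) (Psig : reciprocal_series P sig).
Hypothesis g1 : d = 2%N -> g 1%N = 0.
Hypothesis s'E : forall j : int, s' j = zext sig (j + d%:Z).

Let s0 := zext (fun n => s n%:Z).

(** The constants from two applications of [hankel_reciprocal]. For the determinant Delta_{j,k} of
    the new moments m is 2k + j, so that the factors of different determinants can be compared and
    cancelled. *)
Definition step_factor (m : nat) : F :=
  anti_sign (m + d).-1 * sig 0%N ^+ (m + d).-1 *
  (anti_sign (m + d + d).-1 * g 0%N ^+ (m + d + d).-1).

Let s'_hankel (j : int) k l : (j + d%:Z = l%:Z - k%:Z + 1)%R ->
  hankel s' j k = anti_sign (k + l) * sig 0%N ^+ (k + l) * hankel (zext P) (k%:Z - l%:Z + 1) l.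
Proof.
move=> jl; rewrite -(hankel_reciprocal k l Psig); congr determinant.
by apply/matrixP => p q; rewrite !mxE s'E; congr zext; lia.
Qed.

(** For d = 2 the index i = 1 falls on a negative index of P, where the value 0 is right because g 1
    = 0. *)
Let zextP (i : int) : (0 < i)%R -> zext P (i - d%:Z) = zext g i.
Proof.
case: i => // i i0; have [di|id] := leqP d i.
  rewrite (_ : (i%:Z - d%:Z)%R = (i - d)%N%:Z); last by lia.
  by rewrite /= PE subnK.
rewrite zext_neg; last by lia.
have [e1 e2] : d = 2%N /\ i = 1%N by lia.
by rewrite e2 /= g1.
Qed.

(** Reciprocation is undone twice, from sig to P with size l and from g to s with size k + d. The
    indices in the middle determinant start at 3 - e > 0 in terms of g, where P shifted by d and g
    agree. *)
Lemma hankel_step e k m : (e <= 2)%N -> (0 < k + e)%N -> m.+1 = (k + k + e)%N ->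
  hankel s' (e%:Z - 1) k = step_factor m * hankel s0 (e%:Z - 1) (k + d).
Proof.
move=> e2 ke mE; pose l := (k + e + d - 2)%N.
have lE : (l + 2 = k + e + d)%N by rewrite /l; lia.
rewrite (@s'_hankel _ k l); last by lia.
have -> : hankel (zext P) (k%:Z - l%:Z + 1) l = hankel (zext g) ((k + d)%N%:Z - l%:Z + 1) l.
  congr determinant; apply/matrixP => p q; rewrite !mxE -zextP; last by lia.
  by congr zext; lia.
rewrite (hankel_reciprocal l (k + d) sg) /step_factor -!mulrA.
have -> : (k + l = (m + d).-1)%N by lia.
have -> : (l + (k + d) = (m + d + d).-1)%N by lia.
congr (_ * (_ * (_ * (_ * hankel _ _ _)))); lia.
Qed.

(** Here the middle determinant starts at index 0, where the shifted P has 0 instead of g 0.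
    [hankel_first_entry] corrects this, and the extra term later becomes the shift of all positions
    by g 0 = 1/s 0. *)
Lemma hankel_step2 k m : m = (k + k + 2)%N ->
  hankel s' 2 k = step_factor m * (hankel s0 2 (k + d) - g 0%N * hankel s0 0 (k + d).+1).
Proof.
move=> mE; pose l := (k + d)%N.
rewrite (@s'_hankel _ k l.+1); last by lia.
have -> : (k%:Z - l.+1%:Z + 1 = - d%:Z)%R by lia.
have H : hankel (zext P) (- d%:Z) l.+1 =
    hankel (zext g) 0 l.+1 - g 0%N * hankel (zext g) 2 l.
  rewrite (hankel_first_entry (u := zext g) (u' := fun i => zext P (i - d%:Z))); last first.
    by move=> i; rewrite add0r zextP.
  have z : zext P (0 - d%:Z) = 0 by apply: zext_neg; lia.
  rewrite z subr0 [(0 + 2)%R]add0r /= addrK; congr determinant; apply/matrixP => p q; rewrite !mxE; congr zext; lia.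
rewrite H.
have -> : hankel (zext g) 0 l.+1 = hankel (zext g) (l%:Z - l.+1%:Z + 1) l.+1.
  by congr hankel; lia.
have -> : hankel (zext g) 2 l = hankel (zext g) (l.+1%:Z - l%:Z + 1) l.
  by congr hankel; lia.
rewrite (hankel_reciprocal l.+1 l sg) (hankel_reciprocal l l.+1 sg) /step_factor.
have -> : (k + l.+1 = (m + d).-1)%N by rewrite /l; lia.
have -> : (l.+1 + l = (m + d + d).-1)%N by rewrite /l; lia.
have -> : (l + l.+1 = (m + d + d).-1)%N by rewrite /l; lia.
have -> : (l.+1%:Z - l%:Z + 1 = 2)%R by lia.
have -> : (l%:Z - l.+1%:Z + 1 = 0)%R by lia.
rewrite -/s0; ring.
Qed.

Lemma step_factor_neq0 m : g 0%N != 0 -> sig 0%N != 0 -> step_factor m != 0.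
Proof.
move=> g0 sig0; have as0 n : anti_sign n != 0 :> F.
  by apply/eqP => h; have := anti_sign_sqr n; rewrite h mul0r => /eqP; rewrite eq_sym oner_eq0.
by rewrite !mulf_neq0 ?expf_neq0.
Qed.

(** Makes the factors cancel in the formula for the jump masses, where a squared determinant with
    parameter m stands over two with m - 1 and m + 1. *)
Lemma step_factor_sqr m : (0 < m)%N ->
  step_factor m ^+ 2 = step_factor m.-1 * step_factor m.+1.
Proof.
case: m => // m _; rewrite /step_factor [m.+1.-1]succnK.
have as1 n : anti_sign n * anti_sign n.+1 = (-1) ^+ n :> F.
  by rewrite /= mulrCA anti_sign_sqr mulr1.
have as2 n : anti_sign n * anti_sign n.+2 = -1 :> F.
  transitivity (- ((-1) ^+ n * (-1) ^+ n) * (anti_sign n * anti_sign n) : F).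
    by rewrite /= exprS; ring.
  by rewrite anti_sign_sqr mulr1 -expr2 sqrr_sign.
have as1' n (x y : F) : anti_sign n * x * (anti_sign n.+1 * y) = (-1) ^+ n * (x * y).
  by rewrite mulrACA as1.
have as2' n (x y : F) : anti_sign n * x * (anti_sign n.+2 * y) = -1 * (x * y).
  by rewrite mulrACA as2.
have [->|->] : d = 1%N \/ d = 2%N by lia.
  rewrite !addn1 !succnK !as1' !exprS.
  by move: (sig 0%N ^+ m) (g 0%N ^+ m) ((-1) ^+ m) => p q r; ring.
rewrite !addn2 !succnK !as2' !exprS.
by move: (sig 0%N ^+ m) (g 0%N ^+ m) => p q; ring.
Qed.

End step.

(** The Schur complement, expressed by a solution x of the linear system, so that an explicit
    solution can be plugged in. *)
Lemma det_bordered k (H : 'M[F]_k) (a : 'M[F]_1) (r : 'rV[F]_k) (c x : 'cV[F]_k) : H *m x = c ->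
  \det (block_mx a r c H) = \det H * (a 0 0 - (r *m x) 0 0).
Proof.
move=> Hx; have -> : block_mx a r c H = block_mx (a - r *m x) r 0 H *m block_mx 1%:M 0 x 1%:M.
  by rewrite mulmx_block !mulmx1 !mulmx0 !add0r subrK Hx.
by rewrite det_mulmx det_ublock det_lblock !det1 !mulr1 mulrC det_mx11 !mxE.
Qed.

Lemma det_bordered' k (H : 'M[F]_k) (a : 'M[F]_1) (r : 'rV[F]_k) (c x : 'cV[F]_k) : H *m x = c ->
  \det (block_mx H c r a) = \det H * (a 0 0 - (r *m x) 0 0).
Proof.
move=> Hx; have -> : block_mx H c r a = block_mx H 0 r (a - r *m x) *m block_mx 1%:M x 0 1%:M.
  by rewrite mulmx_block !mulmx1 !mulmx0 !addr0 Hx addrC subrK.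
by rewrite det_mulmx det_ublock det_lblock !det1 !mulr1 det_mx11 !mxE.
Qed.

(** The Desnanot-Jacobi identity in divided form. All three determinants of index c and c + 1 are
    borderings of the Hankel matrix of index c + 2, and the quotients are computed as Schur
    complements. *)
Lemma hankel_Desnanot (u : int -> F) (c : int) k :
  hankel u (c + 2) k != 0 -> hankel u (c + 2) k.+1 != 0 ->
  hankel u c k.+1 / hankel u (c + 2) k - hankel u c k.+2 / hankel u (c + 2) k.+1 =
  hankel u (c + 1) k.+1 ^+ 2 / (hankel u (c + 2) k * hankel u (c + 2) k.+1).
Proof.
move=> H0 H1.
pose Hm n : 'M[F]_n := \matrix_(p < n, q < n) u (c + 2 + p%:Z + q%:Z).
pose bv n : 'cV[F]_n := \col_(p < n) u (c + 1 + p%:Z).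
pose h : 'cV[F]_k := \col_(p < k) u (c + 2 + k%:Z + p%:Z).
pose s1 : 'M[F]_1 := (u (c + 1 + k%:Z))%:M; pose s2 : 'M[F]_1 := (u (c + 2 + k%:Z + k%:Z))%:M.
have unit0 : Hm k \in unitmx by rewrite unitmxE unitfE.
pose x := invmx (Hm k) *m bv k; pose y := invmx (Hm k) *m h.
have Hx : Hm k *m x = bv k by rewrite mulmxA mulmxV// mul1mx.
have Hy : Hm k *m y = h by rewrite mulmxA mulmxV// mul1mx.
have HT : (Hm k)^T = Hm k by apply/matrixP => p q; rewrite !mxE; congr u; ring.
have border n (z : 'cV_n) : Hm n *m z = bv n ->
    hankel u c n.+1 = hankel u (c + 2) n * (u c - ((bv n)^T *m z) 0 0).
  move=> Hz; have := det_bordered (u c)%:M (bv n)^T Hz; rewrite [(_%:M) 0 0]mxE mulr1n => <-.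
  rewrite /hankel -(@submxK F 1 n 1 n (\matrix_(p < n.+1, q < n.+1) u (c + p%:Z + q%:Z))).
  congr determinant; refine (f_equal4 (@block_mx F 1 n 1 n) _ _ _ _); apply/matrixP => p q; rewrite !mxE /= ?(ord1 p) ?(ord1 q) /=
    ?mulr1n; congr u; lia.
have hk1 j : hankel u j k.+1 = \det (\matrix_(p < k + 1, q < k + 1) u (j + p%:Z + q%:Z)).
  by rewrite addn1.
have e1 : hankel u (c + 2) k.+1 = hankel u (c + 2) k * (s2 0 0 - (h^T *m y) 0 0).
  rewrite -(det_bordered' s2 h^T Hy) hk1.
  rewrite -(submxK (\matrix_(p < k + 1, q < k + 1) u (c + 2 + p%:Z + q%:Z))).
  congr determinant; congr block_mx; apply/matrixP => p q; rewrite !mxE /= ?(ord1 p) ?(ord1 q) /=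
    ?mulr1n; congr u; lia.
have e2 : hankel u (c + 1) k.+1 ^+ 2 =
    (hankel u (c + 2) k * (s1 0 0 - (h^T *m x) 0 0)) ^+ 2.
  rewrite -(det_bordered' s1 h^T Hx).
  (* A cyclic permutation: the bordered matrix is the Hankel matrix of index c + 1 with its first
     column moved to the end. The sign disappears in the square. *)
  pose rho (q : 'I_(k + 1)) : 'I_(k + 1) := insubd q (if (q < k)%N then q.+1 else 0)%N.
  have rhoE q : nat_of_ord (rho q) = (if (q < k)%N then q.+1 else 0)%N.
    by rewrite /rho val_insubd; rewrite (_ : (_ < k + 1)%N = true)//; case: ifP => //; lia.
  have rho_inj : injective rho.
    move=> p q /(congr1 (@nat_of_ord _)); rewrite !rhoE => e; apply: val_inj => /=.
    have := ltn_ord p; have := ltn_ord q.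
    by move: e; case: ifP; case: ifP; lia.
  have -> : block_mx (Hm k) (bv k) h^T s1 =
      col_perm (perm rho_inj) (\matrix_(p < k + 1, q < k + 1) u (c + 1 + p%:Z + q%:Z)).
    rewrite -[RHS]submxK; congr block_mx; apply/matrixP => p q;
      rewrite !mxE permE rhoE /= ?(ord1 p) ?(ord1 q) /= ?mulr1n ?ltn_ord ?addn0 ?ltnn; congr u; lia.
  by rewrite col_permE det_mulmx det_perm exprMn sqrr_sign mulr1 hk1.
pose e := s2 0 0 - (h^T *m y) 0 0.
have en0 : e != 0 by move: H1; rewrite e1 mulf_eq0 negb_or => /andP[].
pose tau := (s1 0 0 - (h^T *m x) 0 0) / e.
have sym : ((bv k)^T *m y) 0 0 = (h^T *m x) 0 0.
  have -> : (bv k)^T *m y = (h^T *m x)^T.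
    by rewrite trmx_mul trmxK -{1}Hx trmx_mul HT -mulmxA Hy.
  by rewrite mxE.
(* The solution of the system of size k + 1 by block elimination from those of size k, with tau the
   new last coordinate. *)
have := @border k.+1; rewrite -[k.+1]addn1 => /(_ (col_mx (x - tau *: y) tau%:M)).
have HmE : Hm (k + 1)%N = block_mx (Hm k) h h^T s2.
  rewrite -[LHS]submxK; congr block_mx; apply/matrixP => p q; rewrite !mxE /= ?(ord1 p) ?(ord1 q) /=
    ?mulr1n; congr u; lia.
have bvE : bv (k + 1)%N = col_mx (bv k) s1.
  rewrite -[LHS]vsubmxK; congr col_mx; apply/matrixP => p q; rewrite !mxE /= ?(ord1 p) ?(ord1 q) /=
    ?mulr1n; congr u; lia.
rewrite HmE bvE mul_block_col => -> //; last first.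
  congr col_mx.
    by rewrite mulmxBr Hx -scalemxAr Hy mul_mx_scalar subrK.
  rewrite mulmxBr -scalemxAr mul_mx_scalar; apply/matrixP => i j; rewrite (ord1 i) (ord1 j).
  have E (A B C : 'M[F]_1) : (A - tau *: B + tau *: C) 0 0 = A 0 0 - tau * B 0 0 + tau * C 0 0.
    by rewrite !mxE.
  rewrite E; transitivity ((h^T *m x) 0 0 + tau * e); first by rewrite /e; ring.
  by rewrite /tau mulfVK// addrC subrK.
rewrite tr_col_mx mul_row_col mulmxBr -scalemxAr.
have E (A B C : 'M[F]_1) : (A - tau *: B + C) 0 0 = A 0 0 - tau * B 0 0 + C 0 0.
  by rewrite !mxE.
rewrite E sym.
rewrite !addn1 (border _ _ Hx) e1 -/e e2.
have -> : (s1^T *m tau%:M) 0 0 = s1 0 0 * tau by rewrite mul_mx_scalar !mxE mulrC.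
rewrite [in RHS]exprMn /tau; field.
by rewrite en0 H0.
Qed.

End Hankel_determinants.

(** * Expansions along the imaginary axis *)

Opaque H1loc cenergy cdot sqnorm cintegral.

Section expansions.
Variable R : realType.
Local Notation C := R[i].
Local Notation normc := (@ComplexField.Normc.normc R).
Local Notation iz := (@iz R).
Implicit Types (F G : nat -> C) (u v g : nat -> R).

Lemma eq_ctends_from F G (l : C) n0 : (forall n, (n0 <= n)%N -> F n = G n) -> ctends F l -> ctends G l.
Proof.
move=> FG Fl e e0; have [N HN] := Fl e e0; exists (maxn n0 N) => n.
by rewrite geq_max => /andP[h1 h2]; rewrite -FG// HN.
Qed.

(* [expand N F u] states that F n = u_0 + u_1 t + ... + u_N t^N + o(t^N) for
   t = 1 / iz n. *)
Fixpoint expand N F u : Prop :=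
  ctends F (u 0%N)%:C /\
  if N is N'.+1 then expand N' (fun n => (F n - (u 0%N)%:C) * iz n) (fun i => u i.+1) else True.

Lemma expand_lead N F u : expand N F u -> ctends F (u 0%N)%:C.
Proof. by case: N => [[]|N []]. Qed.

Lemma expand_tail N F u : expand N.+1 F u ->
  expand N (fun n => (F n - (u 0%N)%:C) * iz n) (fun i => u i.+1).
Proof. by case. Qed.

Lemma eq_expand N F G u v n0 : (forall n, (n0 <= n)%N -> F n = G n) -> u =1 v ->
  expand N F u -> expand N G v.
Proof.
elim: N F G u v => [|N IH] F G u v FG uv /= [h1 h2]; split.
- by rewrite -uv; exact: eq_ctends_from FG h1.
- by [].
- by rewrite -uv; exact: eq_ctends_from FG h1.
- by apply: IH h2 => [n nn|i]; rewrite ?FG// uv.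
Qed.

Lemma expand_pred N F u : expand N.+1 F u -> expand N F u.
Proof.
elim: N F u => [|N IH] F u /= [h1 h2]; split => //.
exact: IH.
Qed.

Lemma expandD N F G u v : expand N F u -> expand N G v ->
  expand N (fun n => F n + G n) (fun i => u i + v i).
Proof.
elim: N F G u v => [|N IH] F G u v /= [h1 h2] [k1 k2]; split => //.
- by rewrite rmorphD; exact: ctendsD.
- by rewrite rmorphD; exact: ctendsD.
- apply: eq_expand (IH _ _ _ _ h2 k2) => // n _; rewrite rmorphD; ring.
Unshelve. exact: 0%N.
Qed.

Lemma expandZ N F u (r : R) : expand N F u -> expand N (fun n => r%:C * F n) (fun i => r * u i).
Proof.
elim: N F u => [|N IH] F u /= [h1 h2]; split => //.
- by rewrite rmorphM; exact: ctendsZ.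
- by rewrite rmorphM; exact: ctendsZ.
- apply: eq_expand (IH _ _ h2) => // n _; rewrite rmorphM; ring.
Unshelve. exact: 0%N.
Qed.

Definition conv u v n := \sum_(i < n.+1) u i * v (n - i)%N.

Lemma expandM N F G u v : expand N F u -> expand N G v -> expand N (fun n => F n * G n) (conv u v).
Proof.
have c0 u' v' : conv u' v' 0%N = u' 0%N * v' 0%N by rewrite /conv big_ord1.
elim: N F G u v => [|N IH] F G u v hF hG; split => //.
- by rewrite c0 rmorphM; apply: ctendsM; [exact: expand_lead hF|exact: expand_lead hG].
- by rewrite c0 rmorphM; apply: ctendsM; [exact: expand_lead hF|exact: expand_lead hG].
- have h1 := IH _ _ _ _ (expand_tail hF) (expand_pred hG).
  have h2 := expandZ (u 0%N) (expand_tail hG).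
  apply: eq_expand (expandD h1 h2) => [n _|i]; first by rewrite c0 rmorphM; ring.
  by rewrite /conv [RHS]big_ord_recl subn0 addrC.
Unshelve. exact: 0%N.
Qed.

(** By induction from 1/F - 1/u_0 = - (F - u_0) / (u_0 F): the factor F - u_0 gains one order, so
    1/F is needed only to the previous order. *)
Lemma expandV N F u g : reciprocal_series u g -> expand N F u -> expand N (fun n => (F n)^-1) g.
Proof.
move=> ug; have := ug 0%N; rewrite big_ord1 /= => ug0.
have u0 : u 0%N != 0 by apply: contra_eq_neq ug0 => ->; rewrite mul0r eq_sym oner_eq0.
have g0 : g 0%N = (u 0%N)^-1 by apply: (mulfI u0); rewrite ug0 mulfV.
have uC : (u 0%N)%:C != 0 :> C by rewrite fmorph_eq0.
have lead F' : ctends F' (u 0%N)%:C -> ctends (fun n => (F' n)^-1) (g 0%N)%:C.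
  by move=> h; rewrite g0 fmorphV; exact: ctendsV.
elim: N => [|N IH] hF; split => //; first exact: lead (expand_lead hF).
  exact: lead (expand_lead hF).
have h1 := expandZ (- (u 0%N)^-1) (expandM (expand_tail hF) (IH (expand_pred hF))).
have [n0 Hn0] : exists n0, forall n, (n0 <= n)%N -> F n != 0.
  have nu : 0 < normc (u 0%N)%:C.
    rewrite lt_neqAle normc_ge0 andbT eq_sym; apply: contra uC.
    by move=> /eqP/ComplexField.Normc.eq0_normc ->.
  have [n0 Hn0] := expand_lead hF (e := normc (u 0%N)%:C / 2) ltac:(by rewrite divr_gt0).
  exists n0 => n /Hn0; apply: contraTneq => ->; rewrite sub0r cnormN -ltNge.
  by rewrite ltr_pdivrMr// ltr_pMr// ltr1n.
apply: (eq_expand (n0 := n0)) h1 => [n /Hn0 Fn|i].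
  have e1 : ((u 0%N)^-1)%:C = ((u 0%N)%:C)^-1 :> C by rewrite fmorphV.
  have e2 : (- (u 0%N)^-1)%:C = - ((u 0%N)%:C)^-1 :> C by rewrite rmorphN fmorphV.
  by rewrite g0 e1 e2; move: uC; move: (u 0%N)%:C => w w0; field; rewrite Fn w0.
have := ug i.+1; rewrite big_ord_recl /= subn0 => /eqP; rewrite addrC addr_eq0 => /eqP h.
by rewrite /conv h mulrNN mulKf.
Qed.

(** Each coefficient depends on all earlier ones, so the recursion builds the list [pre n] of the
    first n + 1 coefficients. *)
Lemma reciprocal_exists u : u 0%N != 0 -> exists g, reciprocal_series u g.
Proof.
move=> u0.
pose next (l : seq R) := - (u 0%N)^-1 * \sum_(j < size l) u j.+1 * nth 0 l (size l - j.+1)%N.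
pose fix pre n := if n is n'.+1 then rcons (pre n') (next (pre n')) else [:: (u 0%N)^-1].
have sz n : size (pre n) = n.+1 by elim: n => //= n IH; rewrite size_rcons IH.
pose g n := nth 0 (pre n) n.
have gE n i : (i <= n)%N -> nth 0 (pre n) i = g i.
  elim: n => [|n IH] /=; first by rewrite leqn0 => /eqP ->.
  rewrite leq_eqVlt => /orP[/eqP -> //|]; rewrite ltnS => ilen.
  by rewrite nth_rcons sz ltnS ilen IH.
exists g; case=> [|n]; first by rewrite big_ord1 /g /= mulfV.
rewrite big_ord_recl /= subn0 {1}/g /= nth_rcons sz ltnn eqxx /next sz mulrA mulrN mulfV// mulN1r.
apply/eqP; rewrite addrC subr_eq0; apply/eqP; apply: eq_bigr => j _.
by rewrite subSS gE ?leq_subr.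
Qed.

End expansions.

(** * Strings that begin with finitely many point masses *)

Section chains.
Variables (R : realType) (L : \bar R) (ups : {measure set (measurableTypeR R) -> \bar R}).
Hypothesis ups_fin : forall c, halfopen L c -> (ups `[0%R, c]%classic < +oo)%E.
Local Notation C := R[i].
Local Notation dom := (halfopen L).
Local Notation test := (test L).
Local Notation state := (state L ups).
Local Notation iz := (@iz R).
Implicit Types (h : R -> C) (a c x y : R) (z : C) (p w v : nat -> R).

(** There are N weights, at p 0 = a up to p (N-1), but N + 1 points: p N is the end of the last gap,
    and nothing is said about the string at p N itself. *)
Definition chain a (Om : (R -> C) -> C) N p w v : Prop :=
  [/\ p 0%N = a, (forall n, (n < N)%N -> p n < p n.+1), dom (p N) & (forall n, (n < N)%N -> 0 <= v n)] /\
  (forall c h, test c h -> c < p N -> Om h = \sum_(0 <= n < N) (w n)%:C * h (p n)) /\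
  (forall A : set (measurableTypeR R), measurable A -> A `<=` `[a, (p N)%R[%classic ->
     ups A = (\sum_(0 <= n < N) (v n)%:E * \d_(p n : measurableTypeR R) A)%E).

Lemma eq_chain a Om N p w v p' w' v' : (forall n, (n <= N)%N -> p n = p' n) ->
  (forall n, (n < N)%N -> w n = w' n) -> (forall n, (n < N)%N -> v n = v' n) ->
  chain a Om N p w v -> chain a Om N p' w' v'.
Proof.
move=> pp ww vv [[h1 h2 h3 h4] [h5 h6]]; split; [split|split].
- by rewrite -pp.
- by move=> n nN; rewrite -!pp ?h2// ltnW.
- by rewrite -pp.
- by move=> n nN; rewrite -vv ?h4.
- move=> c h th; rewrite -pp// => /(h5 c h th) ->.
  by apply: eq_big_nat => n /andP[_ nN]; rewrite ww// pp// ltnW.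
- move=> A mA; rewrite -pp// => /(h6 A mA) ->.
  by apply: eq_big_nat => n /andP[_ nN]; rewrite vv// pp// ltnW.
Qed.

Lemma chain0 a Om M f p w v : state a Om M f -> p 0%N = a -> chain a Om 0 p w v.
Proof.
move=> S p0; split; [split|split] => //.
- by rewrite p0; exact: st_dom S.
- move=> c h th; rewrite p0 => ca; rewrite big_nil; apply: (st_supp S th) => x ax dx.
  have [_ _ hc] := th; apply: hc => //; exact: le_trans (ltW ca) ax.
- move=> A mA; rewrite p0 => Aa; rewrite big_nil; have -> : A = set0; last by rewrite measure0.
  apply/seteqP; split => // x /Aa; rewrite /= in_itv/= => /andP[h1 h2].
  by have := le_lt_trans h1 h2; rewrite ltxx.
Qed.

Definition shift0 (x : R) p n := if n is n'.+1 then p n' else x.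

Lemma chainS a Om M f b c0 s0 N p w v : state a Om M f ->
  ctends (fun n => remainder M b c0 (iz n)) s0%:C -> 0 < s0 -> dom (a + s0^-1) ->
  chain (a + s0^-1) (next_Om a Om c0) N p w v ->
  chain a Om N.+1 (shift0 a p) (shift0 c0 w) (shift0 b v).
Proof.
move=> S asym s00 da' [[p0 pi dp v0] [hO hU]].
have a0 := dom0 (st_dom S).
set a' := a + s0^-1 in da' p0 hO hU.
have aa' : a < a' by rewrite ltrDl invr_gt0.
have as0 : (a' - a) * s0 <= 1 by rewrite /a' [a + _]addrC addrK mulVf ?gt_eqF.
have pa n : (n <= N)%N -> a' <= p n.
  elim: n => [|n IH] nN; first by rewrite p0.
  exact: le_trans (IH (ltnW nN)) (ltW (pi n nN)).
have bE := ups_atom ups_fin S asym.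
split; [split|split] => //.
- by case=> [|n] nN /=; [rewrite p0|exact: pi].
- by case=> [|n] nN /=; [rewrite -bE fine_ge0|exact: v0].
- move=> c h th cp; rewrite big_nat_recl//= -(hO c h th cp) /next_Om; ring.
- move=> A mA Ap; have a'p := pa N (leqnn N).
  (* The base point, the open gap and the part described by the given chain; the gap carries no
     mass. *)
  pose A1 := A `&` [set a]; pose A2 := A `&` `]a, a'[%classic; pose A3 := A `&` `[a', (p N)%R[%classic.
  have m1 : measurable A1 by exact: measurableI.
  have m2 : measurable A2 by apply: measurableI => //; exact: measurable_itv.
  have m3 : measurable A3 by apply: measurableI => //; exact: measurable_itv.
  have AE : A = A1 `|` (A2 `|` A3).
    apply/seteqP; split => x; last by case=> [[]//|[[]//|[]]].
    move=> Ax; have := Ap x Ax; rewrite /= in_itv/= => /andP[ax xp].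
    move: ax; rewrite le_eqVlt => /orP[/eqP ax|ax]; first by left; split.
    have [xa|xa] := ltP x a'; [right; left|right; right]; split => //=; rewrite in_itv/=.
      by rewrite ax.
    by rewrite xa.
  have u2 : ups A2 = 0%E.
    apply/eqP; rewrite eq_le measure_ge0 andbT -(ups_gap_open ups_fin S asym da' aa' as0).
    by apply: le_measure; rewrite ?inE// => x [].
  have -> : ups A = (ups A1 + ups A3)%E.
    rewrite [in LHS]AE measureU//; last 2 first.
    + exact: measurableU.
    + apply/seteqP; split => // x [[_ /= ->]] [[_ /=]|[_ /=]]; rewrite in_itv/=.
        by rewrite ltxx.
      by move=> /andP[]; rewrite leNgt aa'.
    have A23 : A2 `&` A3 = set0.
      apply/seteqP; split => // x [[_ /=]] + [_ /=]; rewrite !in_itv/= => /andP[_ h1] /andP[h2 _].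
      by have := lt_le_trans h1 h2; rewrite ltxx.
    transitivity (ups A1 + (ups A2 + ups A3))%E; last by rewrite u2 add0e.
    by congr (_ + _)%E; exact: measureU.
  rewrite big_nat_recl//=; congr (_ + _)%E.
    rewrite diracE; have [aA|aA] := boolP (a \in A).
      rewrite mule1 -bE fineK; last first.
        rewrite ge0_fin_numE//; apply: (ups_itv_fin ups_fin (st_dom S)) => // x ->.
        by rewrite /= in_itv/= lexx a0.
      congr (ups _); apply/seteqP; split => x; first by case.
      by move=> /= ->; split => //; exact: set_mem.
    rewrite mule0 /A1; have -> : A `&` [set a] = set0; last by rewrite measure0.
    by apply/seteqP; split => // x [Ax /= xa]; move: aA; rewrite -xa mem_set.
  rewrite hU//; last by move=> x [].
  apply: eq_big_nat => n /andP[_ nN]; congr (_ * _)%E; rewrite !diracE; congr (_%:R%:E); congr nat_of_bool.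
  have pn : p n < p N.
    suff H k : (k <= N)%N -> (n < k)%N -> p n < p k by exact: H.
    elim: k => // k IH kN; rewrite ltnS leq_eqVlt => /orP[/eqP ->|nk].
      exact: pi.
    by apply: lt_trans (IH (ltnW kN) nk) (pi k kN).
  apply/idP/idP => /set_mem h; apply: mem_set; first by case: h.
  by split => //=; rewrite in_itv/= pn pa// ltnW.
Qed.

End chains.

(** * Expansion of the next Weyl-Titchmarsh function *)

Section next_expansion.
Variables (R : realType) (L : \bar R) (ups : {measure set (measurableTypeR R) -> \bar R}).
Hypothesis ups_fin : forall c, halfopen L c -> (ups `[0%R, c]%classic < +oo)%E.
Local Notation C := R[i].
Local Notation iz := (@iz R).
Variables (a : R) (Om : (R -> C) -> C) (M : C -> C) (f : C -> R -> C) (b c0 : R) (s : nat -> R).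
Hypothesis S : state L ups a Om M f.
Variable K : nat.
Hypothesis asym : expand K.*2 (fun n => remainder M b c0 (iz n)) s.
Hypothesis nonrat : ~ quotient_of_polynomials M.

Let asym0 : ctends (fun n => remainder M b c0 (iz n)) (s 0%N)%:C.
Proof. exact: expand_lead asym. Qed.

Lemma next_gap : 0 < s 0%N /\ halfopen L (a + (s 0%N)^-1).
Proof. exact: (gap_inside ups_fin S asym0 nonrat). Qed.

Let s00 : 0 < s 0%N. Proof. by case: next_gap. Qed.
Let da' : halfopen L (a + (s 0%N)^-1). Proof. by case: next_gap. Qed.

Lemma next_state' : state L ups (a + (s 0%N)^-1) (next_Om a Om c0)
  (next_M M b c0 (s 0%N)) (next_f M f b c0 (s 0%N)).
Proof. exact: (next_state ups_fin S asym0 s00 da'). Qed.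

Lemma next_nonrat : ~ quotient_of_polynomials (next_M M b c0 (s 0%N)).
Proof. by move=> /(next_M_quotient ups_fin S asym0 s00 da'). Qed.

Variable g : nat -> R.
Hypothesis sg : reciprocal_series s g.

Let G n := (remainder M b c0 (iz n))^-1.
Let H n := (G n - (g 0%N)%:C) * iz n.

Lemma g0E : g 0%N = (s 0%N)^-1.
Proof.
have := sg 0%N; rewrite big_ord1 /= => h.
by apply: (mulfI (lt0r_neq0 s00)); rewrite h mulfV ?lt0r_neq0.
Qed.

Lemma g1E : g 1%N = - s 1%N / s 0%N ^+ 2.
Proof.
have := sg 1%N; rewrite big_ord_recl big_ord1 /= g0E => /eqP.
rewrite addr_eq0 => /eqP h; apply: (mulfI (lt0r_neq0 s00)); rewrite h.
by field; exact: lt0r_neq0.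
Qed.

(** So H is minus the reciprocal of [next_M], with the expansion g 1, g 2, ... inherited from 1/r.
    Large n are required because r(iz n), which tends to s 0 > 0, must not vanish. *)
Let next_M_mul : exists n0, forall n, (n0 <= n)%N -> next_M M b c0 (s 0%N) (iz n) * H n = -1.
Proof.
have sC : (s 0%N)%:C != 0 :> C by rewrite fmorph_eq0 lt0r_neq0.
have sVC : ((s 0%N)^-1)%:C = ((s 0%N)%:C)^-1 :> C by rewrite fmorphV.
have [n0 Hn0] : exists n0, forall n, (n0 <= n)%N -> remainder M b c0 (iz n) != 0.
  have nu : 0 < (@ComplexField.Normc.normc R) (s 0%N)%:C.
    by rewrite normc_real normr_gt0 lt0r_neq0.
  have [n0 Hn0] := asym0 (e := (@ComplexField.Normc.normc R) (s 0%N)%:C / 2) ltac:(by rewrite divr_gt0).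
  exists n0 => n /Hn0; apply: contraTneq => ->; rewrite sub0r cnormN -ltNge.
  by rewrite ltr_pdivrMr// ltr_pMr// ltr1n.
exists n0 => n /Hn0 Fn; have zn := iz_neq0 R n.
have w0 := next_w_neq0 ups_fin S asym0 s00 da' (iz_nonreal R n).
have wE : next_w M b c0 (s 0%N) (iz n) = 1 - remainder M b c0 (iz n) / (s 0%N)%:C.
  by rewrite /next_w /slope /remainder sVC; field.
have ME : M (iz n) - b%:C * iz n - c0%:C = - remainder M b c0 (iz n) / iz n.
  by rewrite /remainder; field.
rewrite wE in w0; rewrite /next_M wE ME /H /G g0E sVC.
move: w0 Fn zn sC; move: (iz n) ((s 0%N)%:C) (remainder M b c0 (iz n)) => z k F w0 F0 z0 k0.
have kF : k - F != 0.
  by apply: contra w0 => /eqP h; rewrite -[1](mulfV k0) -mulrBl h mul0r.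
by field; rewrite k0 z0 F0 kF.
Qed.

Let H_neq0 : exists n0, forall n, (n0 <= n)%N -> H n != 0.
Proof.
have [n0 Hn0] := next_M_mul; exists n0 => n /Hn0; apply: contra_eq_neq => ->.
by rewrite mulr0 eq_sym oppr_eq0 oner_neq0.
Qed.

Let expandG : expand K.*2 G g. Proof. exact: expandV sg asym. Qed.

(** If g 1 is not 0, H has a non-zero limit, so [next_M] = -1/H has no linear term and the constant
    term - sig 0. *)
Lemma next_expand1 K' sig : K = K'.+1 -> reciprocal_series (fun i => g i.+1) sig ->
  expand K'.*2 (fun n => remainder (next_M M b c0 (s 0%N)) 0 (- sig 0%N) (iz n)) (fun i => sig i.+1).
Proof.
move=> KE gs; have := expandG; rewrite KE doubleS => /expand_tail/(expandV gs)/expand_tail.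
have [n0 Hn0] := next_M_mul; have [n1 Hn1] := H_neq0.
apply: (eq_expand (n0 := maxn n0 n1)) => // n; rewrite geq_max => /andP[/Hn0 h /Hn1 Hn].
rewrite /remainder; have -> : next_M M b c0 (s 0%N) (iz n) = - (H n)^-1.
  by apply: (mulIf Hn); rewrite h mulNr mulVf.
rewrite -/(H n) rmorphN /= mul0r; ring.
Qed.

Hypothesis g1 : g 1%N = 0.

(** If g 1 = 0, then z H tends to g 2 while next_M / z tends to the mass at the new base point, and
    the product is -1. So g 2 is non-zero, and the mass is known even if there are no moments left
    for another step. *)
Lemma next_atom K' : K = K'.+1 ->
  g 2%N * fine (ups [set (a + (s 0%N)^-1)]) = -1.
Proof.
move=> KE; have := expandG; rewrite KE doubleS => /expand_tail/expand_tail/expand_lead.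
rewrite -[fun n => _]/(fun n => (H n - (g 1%N)%:C) * iz n) => Q.
have e2 : ctends (fun n => next_M M b c0 (s 0%N) (iz n) / iz n)
    (fine (ups [set (a + (s 0%N)^-1)]))%:C.
  move=> e e0; have [Y HY] := M_over_z_limit ups_fin next_state' e0.
  exists (Num.truncn Y) => n Yn; have zn := iz_neq0 R n.
  have -> : next_M M b c0 (s 0%N) (iz n) / iz n - (fine (ups [set (a + (s 0%N)^-1)]))%:C =
      (next_M M b c0 (s 0%N) (iz n) - iz n * (fine (ups [set (a + (s 0%N)^-1)]))%:C) / iz n.
    by field.
  rewrite normcM ComplexField.Normc.normcV normc_iz; apply: HY; last by [].
  by apply: ltW; apply: lt_le_trans (truncnS_gt _) _; rewrite ler_nat ltnS.
have [n0 Hn0] := next_M_mul.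
have e3 : ctends (fun n => next_M M b c0 (s 0%N) (iz n) / iz n * ((H n - (g 1%N)%:C) * iz n)) (-1).
  apply: (eq_ctends_from (n0 := n0)) (ctends_cst (-1)) => n /Hn0 <-.
  by rewrite g1; have zn := iz_neq0 R n; field.
have := ctends_unique (ctendsM e2 Q) e3 => /(congr1 (@complex.Re R)).
by rewrite -rmorphM /= mulrC.
Qed.

(** If g 1 = 0, then next_M = - z / (z H) with z H tending to g 2: two orders of the expansion are
    used up by the linear term - sig 0 and the constant term - sig 1. *)
Lemma next_expand2 K' sig : K = K'.+2 -> reciprocal_series (fun i => g i.+2) sig ->
  expand K'.*2 (fun n => remainder (next_M M b c0 (s 0%N)) (- sig 0%N) (- sig 1%N) (iz n))
    (fun i => sig i.+2).
Proof.
move=> KE gs; have := expandG; rewrite KE !doubleS => /expand_tail/expand_tail/(expandV gs)/expand_tail/expand_tail.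
have [n0 Hn0] := next_M_mul; have [n1 Hn1] := H_neq0.
apply: (eq_expand (n0 := maxn n0 n1)) => // n; rewrite geq_max => /andP[/Hn0 h /Hn1 Hn].
have zn := iz_neq0 R n.
rewrite /remainder; have -> : next_M M b c0 (s 0%N) (iz n) = - (H n)^-1.
  by apply: (mulIf Hn); rewrite h mulNr mulVf.
rewrite -/(H n) !rmorphN /= g1.
by move: Hn; move: (H n) => q q0; field; rewrite q0 zn.
Qed.

End next_expansion.

(** * The induction over the moments *)

Section nonzero_indices.
Variable R : realType.
Implicit Types (u : nat -> R) (d k n K : nat).

Lemma nonzeros_ge1 u k : u 0%N != 0 -> (0 < nonzeros u k)%N.
Proof. by move=> u0; rewrite /nonzeros /= u0. Qed.

Lemma nonzero_index1 u K : u 0%N != 0 -> nonzero_index u K 1 = 0%N.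
Proof. by move=> u0; rewrite /nonzero_index /= /nonzeros /= u0. Qed.

Variables (u u' : nat -> R) (d : nat).
Hypotheses (d0 : (0 < d)%N) (u0 : u 0%N != 0) (ud : forall i, (0 < i < d)%N -> u i = 0).
Hypothesis uu' : forall k, (u' k != 0) = (u (k + d)%N != 0).

Lemma nonzeros_low k : (k < d)%N -> nonzeros u k = 1%N.
Proof.
move=> kd; rewrite /nonzeros /= u0 (@eq_in_count _ _ pred0) ?count_pred0// => i.
by rewrite mem_iota => /andP[i0 ik]; rewrite ud ?eqxx// i0 (leq_ltn_trans _ kd).
Qed.

Lemma nonzeros_step k : nonzeros u (k + d) = (nonzeros u' k).+1.
Proof.
have -> : (k + d)%N = (d.-1 + k.+1)%N by lia.
rewrite /nonzeros -addSn prednK// iotaD count_cat.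
have := nonzeros_low (k := d.-1) ltac:(lia); rewrite /nonzeros prednK// => ->.
rewrite add0n add1n; congr _.+1; rewrite -{1}[d]addn0 iotaDl count_map.
by apply: eq_count => i /=; rewrite addnC uu'.
Qed.

(** The first d entries of u contain the single non-zero element u 0; after them u has its zeros
    where u' has them. *)
Lemma nonzero_index_step K n : (0 < n)%N ->
  nonzero_index u (K + d) n.+1 = (nonzero_index u' K n + d)%N.
Proof.
move=> n0; rewrite /nonzero_index -addSn addnC iotaD find_cat ifF; last first.
  apply/negP => /hasP[k]; rewrite mem_iota => /andP[_ kd].
  by rewrite nonzeros_low// eqSS eq_sym => /eqP nz; rewrite nz in n0.
rewrite size_iota addnC add0n -{1}[d]addn0 iotaDl find_map; congr (_ + _)%N.
by apply: eq_find => k /=; rewrite addnC nonzeros_step eqSS.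
Qed.

End nonzero_indices.

(** * Positions, weights and masses under a step *)

Section transport.
Variable R : realType.
Implicit Types (s : int -> R) (a x : R) (k n K : nat).

Lemma hankel_nil s j : hankel s j 0 = 1.
Proof. exact: det_mx00. Qed.

Lemma hankel_one s j : hankel s j 1 = s j.
Proof. by rewrite /hankel det_mx11 mxE !addr0. Qed.

Lemma eq_hankel s s' j k : (forall i : nat, s (j + i%:Z) = s' (j + i%:Z)) -> hankel s j k = hankel s' j k.
Proof.
by move=> ss'; congr determinant; apply/matrixP => p q; rewrite !mxE -!addrA -PoszD ss'.
Qed.

Lemma hankel_two s j : hankel s j 2 = s j * s (j + 2) - s (j + 1) ^+ 2.
Proof.
rewrite /hankel (expand_det_row _ ord0) 2!big_ord_recl big_ord0 addr0 /cofactor !det_mx11 !mxE /=.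
transitivity (s j * ((-1) ^+ 0 * s (j + 2)) + s (j + 1) * ((-1) ^+ 1 * s (j + 1))); last by ring.
by congr (s _ * (_ * s _) + s _ * (_ * s _)); rewrite /bump /=; lia.
Qed.

Definition position s k := hankel s 2 k / hankel s 0 k.+1.
(** At k = kappa n this is minus the sum of the weights omega_0, ..., omega_{n-1}, as their formulas
    telescope. *)
Definition dipole s k := hankel s (-1) k.+1 / hankel s 1 k.
Definition mass s k l := hankel s (-2) k.+2 / hankel s 0 k.+1 - hankel s (-2) l.+1 / hankel s 0 l.
Definition jump_mass s k := hankel s (-1) k.+2 ^+ 2 / (hankel s 0 k.+1 * hankel s 0 k.+2).

(** So upsilon has no mass at x_n when kappa increases by only 1 after n. *)
Lemma mass_next s k : mass s k k.+1 = 0.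
Proof. exact: subrr. Qed.

Lemma mass_jump s k : hankel s 0 k.+1 != 0 -> hankel s 0 k.+2 != 0 -> mass s k k.+2 = jump_mass s k.
Proof. exact: (@hankel_Desnanot R s (-2) k.+1). Qed.

Definition kappa s K := nonzero_index (hankel s 1) K.

Definition points s a K := shift0 a (fun n => a + position s (kappa s K n.+1)).

Definition dipoles s K n :=
  if n == 0%N then - s (-1) else dipole s (kappa s K n) - dipole s (kappa s K n.+1).

Definition masses s K n :=
  if n == 0%N then - s (-2) else mass s (kappa s K n) (kappa s K n.+1).

Definition nondegenerate s k := [/\ hankel s 1 k != 0, hankel s 0 k != 0 & hankel s 0 k.+1 != 0].

(** As kappa increases by at most 2, every mass at a positive point is 0 or a jump mass. The
    vanishing of the skipped determinant is recorded because [jump_mass_step] depends on it. *)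
Definition regular s K :=
  (forall n, (1 <= n <= nonzeros (hankel s 1) K)%N -> nondegenerate s (kappa s K n)) /\
  (forall n, (1 <= n < nonzeros (hankel s 1) K)%N -> kappa s K n.+1 = (kappa s K n).+1 \/
     kappa s K n.+1 = (kappa s K n).+2 /\ hankel s 1 (kappa s K n).+1 = 0).

(* A step passes from K to K - d, where d = 1 if s 1 != 0 and d = 2 otherwise. *)
Section step.
Variables (s s' : int -> R) (g sig : nat -> R) (d : nat).
Hypotheses (s00 : s 0 != 0) (sg : reciprocal_series (fun n => s n%:Z) g) (d0 : (0 < d <= 2)%N).
Hypothesis gsig : reciprocal_series (fun i => g (i + d)%N) sig.
Hypothesis g1 : d = 2%N -> g 1%N = 0.
Hypothesis s'E : forall j : int, s' j = zext sig (j + d%:Z).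

Let g0E : g 0%N = (s 0)^-1.
Proof. by have := sg 0%N; rewrite big_ord1 /= => h; apply: (mulfI s00); rewrite h mulfV. Qed.

Let g0 : g 0%N != 0. Proof. by rewrite g0E invr_eq0. Qed.

Let sig0E : g d * sig 0%N = 1.
Proof. by have := gsig 0%N; rewrite big_ord1 /= add0n. Qed.

Let sig0 : sig 0%N != 0.
Proof. by apply: contra_eq_neq sig0E => ->; rewrite mulr0 eq_sym oner_neq0. Qed.

Let s1 : d = 2%N -> s 1 = 0.
Proof.
move=> /g1 g10; have := sg 1%N; rewrite big_ord_recl big_ord1 /= g10 mulr0 add0r => /eqP.
by rewrite mulf_eq0 (negbTE g0) orbF => /eqP.
Qed.

Let f m := step_factor g sig d m.

Let f0 m : f m != 0. Proof. exact: step_factor_neq0. Qed.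

Let dl : (0 < d)%N. Proof. by case/andP: d0. Qed.
Let dr : (d <= 2)%N. Proof. by case/andP: d0. Qed.

Let nonneg j k : (0 <= j)%R -> hankel (zext (fun n => s n%:Z)) j k = hankel s j k.
Proof. by move=> j0; apply: eq_hankel => i; case: j j0 => // j _; rewrite -PoszD. Qed.

Let step1 k : hankel s' 1 k = f (k + k).+1 * hankel s 1 (k + d).
Proof.
have := hankel_step (s := s) (P := fun i => g (i + d)%N) sg dl dr (fun=> erefl) gsig g1 s'E
  (e := 2) (k := k) (m := (k + k).+1) isT ltac:(lia) ltac:(lia).
by rewrite (_ : (2%:Z - 1 = 1)%R)// nonneg.
Qed.

Let step0 k : hankel s' 0 k = f (k + k) * hankel s 0 (k + d).
Proof.
have := hankel_step (s := s) (P := fun i => g (i + d)%N) sg dl dr (fun=> erefl) gsig g1 s'E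
  (e := 1) (k := k) (m := (k + k)) isT ltac:(lia) ltac:(lia).
by rewrite (_ : (1%:Z - 1 = 0)%R)// nonneg.
Qed.

(** [hankel_step] speaks about the moments extended by 0, in which s (-1) is missing;
    [hankel_first_entry] restores it. *)
Let stepm1 k : hankel s' (-1) k.+1 =
  f (k + k).+1 * (hankel s (-1) (k + d).+1 - s (-1) * hankel s 1 (k + d)).
Proof.
have := hankel_step (s := s) (P := fun i => g (i + d)%N) sg dl dr (fun=> erefl) gsig g1 s'E
  (e := 0) (k := k.+1) (m := (k + k).+1) isT ltac:(lia) ltac:(lia).
rewrite (_ : (0%:Z - 1 = -1)%R)// => ->; congr (_ * _); rewrite addSn.
rewrite (hankel_first_entry (u := s) (u' := zext (fun n => s n%:Z))); last first.
  by move=> i; have -> : (-1 + i.+1%:Z = i%:Z)%R by lia.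
by rewrite subr0 [(-1 + 2)%R](_ : _ = 1)// addrK.
Qed.

Let step2 k : hankel s' 2 k =
  f (k + k).+2 * (hankel s 2 (k + d) - g 0%N * hankel s 0 (k + d).+1).
Proof.
have := hankel_step2 (s := s) (P := fun i => g (i + d)%N) sg dl dr (fun=> erefl) gsig g1 s'E
  (k := k) (m := (k + k).+2) ltac:(lia).
by rewrite !nonneg.
Qed.

Lemma hankel1_step k : (hankel s' 1 k != 0) = (hankel s 1 (k + d) != 0).
Proof. by rewrite step1 mulf_eq0 (negbTE (f0 _)). Qed.

Lemma nondegenerate_step k : nondegenerate s' k -> nondegenerate s (k + d).
Proof.
case; rewrite step1 !step0 !mulf_eq0 !negb_or => /andP[_ h1] /andP[_ h2] /andP[_ h3].
by split; [|exact: h2|exact: h3].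
Qed.

Lemma position_step k : nondegenerate s (k + d) -> position s (k + d) = position s' k + (s 0)^-1.
Proof.
case=> _ _ h3; rewrite /position step2 step0 addSn addnS -g0E.
by move: (f0 (k + k).+2) => F0; field; rewrite h3 F0.
Qed.

Lemma dipole_step k : nondegenerate s (k + d) -> dipole s (k + d) = dipole s' k + s (-1).
Proof.
case=> h1 _ _; rewrite /dipole stepm1 step1.
by move: (f0 (k + k).+1) => F0; field; rewrite h1 F0.
Qed.

(** The correction in [stepm1] is a multiple of the skipped determinant, which is 0; the remaining
    factors cancel by [step_factor_sqr]. *)
Lemma jump_mass_step k : hankel s 0 (k + d).+1 != 0 -> hankel s 0 (k + d).+2 != 0 ->
  hankel s 1 (k + d).+1 = 0 -> jump_mass s (k + d) = jump_mass s' k.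
Proof.
move=> h1 h2 h3; rewrite /jump_mass stepm1 !step0 !addSn !addnS h3 mulr0 subr0.
have F2 : f (k + k).+3 ^+ 2 = f (k + k).+2 * f (k + k).+4 by exact: step_factor_sqr.
rewrite exprMn F2.
by have := f0 (k + k).+2; have := f0 (k + k).+4 => F4 F3; field; rewrite h1 h2 F3 F4.
Qed.

Variable K : nat.

Let u0 : hankel s 1 0 != 0. Proof. by rewrite hankel_nil oner_neq0. Qed.

Let ud i : (0 < i < d)%N -> hankel s 1 i = 0.
Proof.
move=> id; have [d2 ->] : d = 2%N /\ i = 1%N by lia.
by rewrite hankel_one s1.
Qed.

Lemma nonzeros_hankel_step : nonzeros (hankel s 1) (K + d) = (nonzeros (hankel s' 1) K).+1.
Proof. exact: nonzeros_step dl u0 ud hankel1_step K. Qed.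

Lemma kappa1 s2 K2 : kappa s2 K2 1 = 0%N.
Proof. by apply: nonzero_index1; rewrite hankel_nil oner_neq0. Qed.

Lemma kappa_step n : (0 < n)%N -> kappa s (K + d) n.+1 = (kappa s' K n + d)%N.
Proof. exact: nonzero_index_step dl u0 ud hankel1_step K n. Qed.

Let nondegenerate0 : nondegenerate s 0.
Proof. by split; rewrite ?hankel_nil ?oner_neq0 ?hankel_one. Qed.

Let kappaS n : (0 < n <= nonzeros (hankel s' 1) K)%N -> regular s' K ->
  nondegenerate s (kappa s (K + d) n.+1).
Proof. by move=> nN [r _]; rewrite kappa_step; [apply/nondegenerate_step/r|lia]. Qed.

Lemma regular_step : regular s' K -> regular s (K + d).
Proof.
move=> r'; have [r1 r2] := r'; split; rewrite nonzeros_hankel_step.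
- case=> [//|[|n]] nN; first by rewrite kappa1.
  by apply: kappaS r'; lia.
- case=> [//|[|n]] nN.
    rewrite kappa1 (kappa_step (n := 1))// kappa1 add0n.
    have [->|d2] : d = 1%N \/ d = 2%N by lia.
      by left.
    by right; rewrite d2 hankel_one s1.
  rewrite !kappa_step//; have [|->|[-> h]] := r2 n.+1; first by lia.
    by left; rewrite addSn.
  right; split; first by rewrite !addSn.
  by move: h => /eqP; apply: contraTeq; rewrite hankel1_step addSn.
Qed.

Lemma points_step a n : regular s' K -> (n <= (nonzeros (hankel s' 1) K).+1)%N ->
  shift0 a (points s' (a + (s 0)^-1) K) n = points s a (K + d) n.
Proof.
move=> r'; case: n => [//|[|n]] nN /=.
  by rewrite kappa1 /position hankel_nil hankel_one mul1r.
rewrite kappa_step// position_step; last by rewrite -kappa_step//; apply: kappaS.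
by ring.
Qed.

Lemma dipoles_step n : regular s' K -> (n < (nonzeros (hankel s' 1) K).+1)%N ->
  shift0 (- s (-1)) (dipoles s' K) n = dipoles s (K + d) n.
Proof.
move=> r'; case: n => [//|[|n]] nN /=; rewrite /dipoles /=.
  rewrite kappa1 (kappa_step (n := 1))// kappa1.
  have nd : nondegenerate s (0 + d)%N.
    by rewrite -(kappa1 s' K) -kappa_step//; apply: kappaS; first by lia.
  by rewrite (dipole_step nd) {1 2}/dipole !hankel_nil !hankel_one; field.
rewrite !kappa_step// !dipole_step; first by ring.
  by rewrite -kappa_step//; apply: kappaS.
by rewrite -kappa_step//; apply: kappaS => //; lia.
Qed.

(** The determinants of index -2 are not transported. Every mass apart from the first weight is 0 or
    a jump mass, and jump masses involve only the indices -1 and 0. *)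
Lemma masses_step n : regular s' K -> (n < (nonzeros (hankel s' 1) K).+1)%N ->
  shift0 (- s (-2)) (masses s' K) n = masses s (K + d) n.
Proof.
move=> r'; case: n => [//|[|n]] nN /=; rewrite /masses /=.
  rewrite kappa1 (kappa_step (n := 1))// kappa1.
  have nd : nondegenerate s (0 + d)%N.
    by rewrite -(kappa1 s' K) -kappa_step//; apply: kappaS; first by lia.
  (* The first weight - s' (-2) of the cut string is 0 for d = 1 and - sig 0 for d = 2; in the
     second case it has to equal the jump mass of s at index 0, checked explicitly. *)
  rewrite s'E add0n; have [d1|d2] : d = 1%N \/ d = 2%N by lia.
    by rewrite d1 mass_next zext_neg ?oppr0.
  have s10 := s1 d2.
  have h1 : hankel s 0 1 != 0 by rewrite hankel_one.
  have h2 : hankel s 0 2 != 0 by rewrite -d2; case: nd.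
  rewrite d2 mass_jump// /jump_mass hankel_one !hankel_two.
  move: h2; rewrite hankel_two !(add0r, addNr) [(-1 + 2)%R](_ : _ = 1)// s10.
  rewrite expr0n /= subr0 mulr0 sub0r => h2.
  have e : s 0 * g 2%N + (s 1 * g 1%N + s 2 * g 0%N) = 0.
    by have := sg 2%N; rewrite !big_ord_recl big_ord0 addr0.
  have s2 : s 2 != 0 by apply: contra_neq h2 => ->; rewrite mulr0.
  have g2E : g 2%N = - s 2 / s 0 ^+ 2.
    apply: (mulfI s00); move/eqP: e; rewrite addr_eq0 => /eqP ->.
    by rewrite s10 g0E; field.
  have -> : sig 0%N = - s 0 ^+ 2 / s 2.
    have g20 : g 2%N != 0 by rewrite g2E mulf_neq0 ?oppr_eq0 ?invr_eq0 ?expf_neq0.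
    apply: (mulfI g20); have := sig0E; rewrite d2 => ->.
    by rewrite g2E; field; rewrite s2 s00.
  by field; rewrite s2 s00.
rewrite !kappa_step//; have [r1 r2] := r'.
have [_ q2 q3] := r1 n.+1 ltac:(lia); have [_ t2 _] := r1 n.+2 ltac:(lia).
have nd := nondegenerate_step (r1 n.+1 ltac:(lia)); have nd' := nondegenerate_step (r1 n.+2 ltac:(lia)).
have [|h|[h hz]] := r2 n.+1; first by lia.
  by rewrite h addSn !mass_next.
rewrite h in t2 nd' *; rewrite !addSn in nd' *; have [_ _ w3] := nd; have [_ w2 _] := nd'.
rewrite !mass_jump// jump_mass_step//.
by move: hz => /eqP; apply: contraTeq; rewrite hankel1_step addSn.
Qed.

(** The non-vanishing of the determinant of index 0 and size kappa(N) + 2 lies beyond [regular]; in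
    the induction it comes from the positivity of the last mass. *)
Lemma last_mass_step : regular s' K -> hankel s 1 (K + d) = 0 ->
  hankel s' 1 K = 0 /\ ((kappa s' K (nonzeros (hankel s' 1) K)).+1 = K ->
    hankel s' 0 (kappa s' K (nonzeros (hankel s' 1) K)).+2 != 0 ->
    (kappa s (K + d) (nonzeros (hankel s 1) (K + d))).+1 = (K + d)%N /\
    jump_mass s (kappa s (K + d) (nonzeros (hankel s 1) (K + d))) =
    jump_mass s' (kappa s' K (nonzeros (hankel s' 1) K))).
Proof.
move=> r' h; have h' : hankel s' 1 K = 0.
  by move: h => /eqP; apply: contraTeq; rewrite hankel1_step.
split => // kK z2; have N0 : (0 < nonzeros (hankel s' 1) K)%N.
  by apply: nonzeros_ge1; rewrite hankel_nil oner_neq0.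
rewrite nonzeros_hankel_step kappa_step//; split; first by rewrite -addSn kK.
have NN : (1 <= nonzeros (hankel s' 1) K <= nonzeros (hankel s' 1) K)%N by rewrite N0 leqnn.
have [r1 _] := r'; have [_ _ w3] := nondegenerate_step (r1 _ NN).
apply: jump_mass_step => //.
  have := step0 (kappa s' K (nonzeros (hankel s' 1) K)).+2; rewrite !addSn => e.
  by apply: contra_neq z2; rewrite e => ->; rewrite mulr0.
by rewrite -addSn kK.
Qed.

End step.

End transport.

(** * Induction on the number of moments *)

Section main_induction.
Variables (R : realType) (L : \bar R) (ups : {measure set (measurableTypeR R) -> \bar R}).
Hypothesis ups_fin : forall c, halfopen L c -> (ups `[0%R, c]%classic < +oo)%E.
Local Notation C := R[i].
Local Notation iz := (@iz R).
Local Notation chain := (chain L ups).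
Implicit Types (s : int -> R) (K : nat).

Definition last_mass s a K : Prop := hankel s 1 K = 0 ->
  let k := kappa s K (nonzeros (hankel s 1) K) in
  [/\ k.+1 = K, ups [set (a + position s k)%R] = (jump_mass s k)%:E & 0 < jump_mass s k].

Definition described s a (Om : (R -> C) -> C) K : Prop :=
  [/\ regular s K,
     chain a Om (nonzeros (hankel s 1) K) (points s a K) (dipoles s K) (masses s K) &
     last_mass s a K].

Section one_step.
Variables (a : R) (Om : (R -> C) -> C) (M : C -> C) (f : C -> R -> C) (s : int -> R) (K : nat).
Local Notation b := (- s (-2)).
Local Notation c0 := (- s (-1)).
Local Notation sn := (fun n : nat => s n%:Z).
Hypothesis S : state L ups a Om M f.
Hypothesis asym : expand K.*2 (fun n => remainder M b c0 (iz n)) sn.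
Hypothesis nonrat : ~ quotient_of_polynomials M.

Let s00 : 0 < s 0. Proof. by have [] := next_gap ups_fin S asym nonrat. Qed.
Let da' : halfopen L (a + (s 0)^-1). Proof. by have [] := next_gap ups_fin S asym nonrat. Qed.
Let asym0 : ctends (fun n => remainder M b c0 (iz n)) (s 0)%:C. Proof. exact: expand_lead asym. Qed.

(** The end of the induction: the moments reach no further than the first gap, as for K = 0 and for
    K = 1 with s 1 = 0. *)
Lemma chain_one : nonzeros (hankel s 1) K = 1%N ->
  regular s K /\ chain a Om 1 (points s a K) (dipoles s K) (masses s K).
Proof.
move=> N1; have k1 := kappa1 s K; split.
  split=> n; rewrite N1 => nN; last by lia.
  have -> : n = 1%N by lia.
  by rewrite k1; split; rewrite ?hankel_nil ?oner_neq0 ?hankel_one ?lt0r_neq0.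
have := chainS ups_fin S asym0 s00 da' (N := 0) (p := fun=> a + (s 0)^-1) (w := fun=> 0) (v := fun=> 0).
move=> /(_ (chain0 _ _ (next_state' ups_fin S asym nonrat) erefl)).
apply: eq_chain.
- case=> [//|[|//]] _ /=; rewrite k1 /position hankel_nil hankel_one mul1r//.
- by case.
- by case.
Qed.

Lemma described_step d K' (s' : int -> R) (g sig : nat -> R) : K = (K' + d)%N -> (0 < d <= 2)%N ->
  reciprocal_series sn g -> reciprocal_series (fun i => g (i + d)%N) sig ->
  (d = 2%N -> g 1%N = 0) -> (forall j : int, s' j = zext sig (j + d%:Z)) ->
  described s' (a + (s 0)^-1) (next_Om a Om c0) K' -> described s a Om K.
Proof.
move=> KE d12 sg gs g1 s'E [r' c' l'].
have sn0 : s 0 != 0 by exact: lt0r_neq0.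
have N'0 : (0 < nonzeros (hankel s' 1) K')%N.
  by apply: nonzeros_ge1; rewrite hankel_nil oner_neq0.
have NE := nonzeros_hankel_step sn0 sg d12 gs g1 s'E K'.
split.
- by rewrite KE; exact: (regular_step sn0 sg d12 gs g1 s'E r').
- rewrite KE NE; apply: eq_chain (chainS ups_fin S asym0 s00 da' c') => n nN.
  + exact: (points_step sn0 sg d12 gs g1 s'E).
  + exact: (dipoles_step sn0 sg d12 gs g1 s'E).
  + exact: (masses_step sn0 sg d12 gs g1 s'E).
- move=> h; rewrite KE in h.
  have [h' H] := last_mass_step sn0 sg d12 gs g1 s'E r' h.
  have [e1 e2 e3] := l' h'.
  have z2 : hankel s' 0 (kappa s' K' (nonzeros (hankel s' 1) K')).+2 != 0.
    by apply: contraTneq e3 => h2; rewrite /jump_mass h2 mulr0 invr0 mulr0 ltxx.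
  have [q1 q2] := H e1 z2; rewrite KE; split => //; last by rewrite q2.
  rewrite q2 -e2; congr (ups [set _]).
  (* The last point of the chain, computed from s and from s', is the same point of the string. *)
  have := points_step sn0 sg d12 gs g1 s'E a r' (leqnn _); rewrite -NE.
  rewrite [in LHS]NE /=; rewrite {1}[points]lock NE -lock /=.
  by case: (nonzeros (hankel s' 1) K') N'0.
Qed.

End one_step.

(** Strong induction on K for all states at once, since a step lowers K by 1 or 2 and changes base
    point, functional and solutions. *)
Lemma described_all K a Om M f s : state L ups a Om M f ->
  expand K.*2 (fun n => remainder M (- s (-2)) (- s (-1)) (iz n)) (fun n : nat => s n%:Z) ->
  ~ quotient_of_polynomials M -> described s a Om K.
Proof.
elim/ltn_ind: K a Om M f s => K IH a Om M f s S asym nonrat.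
have [s00 da'] := next_gap ups_fin S asym nonrat.
have sn0 : s 0 != 0 by exact: lt0r_neq0.
have u0 : hankel s 1 0 != 0 by rewrite hankel_nil oner_neq0.
have [g sg] := @reciprocal_exists R (fun n : nat => s n%:Z) sn0.
case: K IH asym => [|K] IH asym.
  have N1 : nonzeros (hankel s 1) 0 = 1%N by rewrite /nonzeros /= u0.
  have [r c] := chain_one S asym nonrat N1; split => //; first by rewrite N1.
  by move=> h; move: u0; rewrite h eqxx.
have S' := next_state' ups_fin S asym nonrat.
have nonrat' := next_nonrat ups_fin S asym nonrat.
(* As g 1 = - s 1 / s 0^2, this distinguishes whether s 1 vanishes. *)
have [g1|g1] := eqVneq (g 1%N) 0; last first.
  have [sig gs] := @reciprocal_exists R (fun i => g i.+1) g1.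
  have ex := next_expand1 ups_fin S asym nonrat sg erefl gs.
  pose s' (j : int) := zext sig (j + 1%:Z).
  have D : described s' (a + (s 0)^-1) (next_Om a Om (- s (-1))) K.
    apply: (IH K (ltnSn K)) S' _ nonrat'.
    apply: (eq_expand (n0 := 0)) ex => [n _|i]; first by rewrite /s' /= oppr0.
    by rewrite /s' -PoszD addn1.
  apply: (described_step S asym nonrat (d := 1) _ _ sg) D; [by rewrite addn1|by []| |by []|by []].
  by have -> : (fun i => g (i + 1)%N) = (fun i => g i.+1) by apply/funext => i; rewrite addn1.
have s1 : s 1 = 0.
  have := g1E ups_fin S asym nonrat sg; rewrite g1 => /esym/eqP.
  by rewrite mulf_eq0 invr_eq0 expf_eq0 (negbTE sn0) orbF oppr_eq0 => /eqP.
have at2 := next_atom ups_fin S asym nonrat sg g1 erefl.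
have g2 : g 2%N != 0 by apply: contra_eq_neq at2 => ->; rewrite mul0r eq_sym oppr_eq0 oner_neq0.
(* With K = 1 and s 1 = 0 no moments are left for another step, but [next_atom] still yields the
   mass at a + 1/s 0; it is the last mass of the statement. *)
case: K IH asym S' nonrat' at2 => [|K] IH asym S' nonrat' at2.
  have N1 : nonzeros (hankel s 1) 1 = 1%N by rewrite /nonzeros /= u0 hankel_one s1 eqxx.
  have [r c] := chain_one S asym nonrat N1; split => //; first by rewrite N1.
  move=> _; rewrite /= N1 kappa1 /position hankel_nil hankel_one mul1r.
  have fu : (ups [set a + (s 0)^-1]%R < +oo)%E.
    apply: (ups_itv_fin ups_fin da') => // x ->; rewrite /= in_itv/= lexx andbT.
    exact: dom0 da'.
  have e : s 0 * g 2%N + (s 1 * g 1%N + s 2 * g 0%N) = 0.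
    by have := sg 2%N; rewrite !big_ord_recl big_ord0 addr0.
  have g0 := g0E ups_fin S asym nonrat sg.
  have g2E : g 2%N = - s 2 / s 0 ^+ 2.
    apply: (mulfI sn0); move/eqP: e; rewrite addr_eq0 => /eqP ->.
    by rewrite s1 g0; field.
  have s2 : s 2 != 0 by apply: contra_neq g2 => h; rewrite g2E h oppr0 mul0r.
  have jE : jump_mass s 0 = fine (ups [set (a + (s 0)^-1)%R]).
    apply: (mulfI g2); rewrite at2 /jump_mass hankel_one !hankel_two.
    rewrite [(-1 + 2)%R](_ : _ = 1)// [(-1 + 1)%R](_ : _ = 0)// [(0 + 2)%R](_ : _ = 2)// [(0 + 1)%R](_ : _ = 1)//.
    by rewrite s1 g2E; field; rewrite s2 sn0.
  split => //; first by rewrite jE fineK// ge0_fin_numE.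
  rewrite jE lt_neqAle fine_ge0// andbT eq_sym.
  by apply: contra_eq_neq at2 => ->; rewrite mulr0 eq_sym oppr_eq0 oner_neq0.
have [sig gs] := @reciprocal_exists R (fun i => g i.+2) g2.
have ex := next_expand2 ups_fin S asym nonrat sg g1 erefl gs.
pose s' (j : int) := zext sig (j + 2%:Z).
have D : described s' (a + (s 0)^-1) (next_Om a Om (- s (-1))) K.
  apply: (IH K (leqnSn K.+1)) S' _ nonrat'.
  apply: (eq_expand (n0 := 0)) ex => [n _|i]; first by [].
  by rewrite /s' -PoszD addn2.
apply: (described_step S asym nonrat (d := 2) _ _ sg) D; [by rewrite addn2|by []| |by []|by []].
by have -> : (fun i => g (i + 2)%N) = (fun i => g i.+2) by apply/funext => i; rewrite addn2.
Qed.

End main_induction.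

(** * Moments of the spectral measure *)

Transparent H1loc cenergy cdot sqnorm cintegral.

Section moment_expansion.
Variables (R : realType) (rho : {measure set (measurableTypeR R) -> \bar R}) (K : nat).
Hypothesis rho_moments : moments_exist rho (2 * K)%N.
Local Notation C := R[i].
Local Notation normc := (@ComplexField.Normc.normc R).
Local Notation iz := (@iz R).
Implicit Types (k n : nat) (t y : R).

Lemma dominated_integrable (u : R -> R) k : (k <= 2 * K)%N -> measurable_fun setT u ->
  (forall t, `|u t| <= `|t| ^+ k) -> rho.-integrable setT (EFin \o u).
Proof.
move=> kK mu uk; have i : rho.-integrable setT (fun t => (`|t| ^+ k)%:E).
  apply/integrableP; split.
    by apply/measurable_EFinP; apply: measurable_funX; exact: normr_measurable.
  apply: le_lt_trans (rho_moments kK); rewrite le_eqVlt; apply/orP; left; apply/eqP.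
  by apply: eq_integral => t _ /=; rewrite ger0_norm// exprn_ge0.
apply: le_integrable i => //; first exact/measurable_EFinP.
by move=> t _; rewrite /= lee_fin [leRHS]ger0_norm// exprn_ge0.
Qed.

(** At z = iy, the real part of 1/(t - z) is the kernel with k = 1, and its imaginary part is y
    times the kernel with k = 0. *)
Definition cauchy_kernel k y t := t ^+ k / (y ^+ 2 + t ^+ 2).

Lemma kernel_den_gt0 y t : 0 < y -> 0 < y ^+ 2 + t ^+ 2.
Proof. by move=> y0; rewrite ltr_pwDl ?exprn_gt0 ?sqr_ge0. Qed.

Lemma measurable_kernel k y : 0 < y -> measurable_fun setT (cauchy_kernel k y).
Proof.
move=> y0; apply: continuous_measurable_fun => t; apply: cvgM; first exact: exprn_continuous.
apply: cvgV; first by rewrite gt_eqF// kernel_den_gt0.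
by apply: cvgD; [exact: cvg_cst|exact: exprn_continuous].
Qed.

Lemma kernel_bound k y t : 0 < y -> `|cauchy_kernel k y t| <= `|t| ^+ k / y ^+ 2.
Proof.
move=> y0; have d0 := kernel_den_gt0 t y0; have y2 : 0 < y ^+ 2 by rewrite exprn_gt0.
rewrite normrM normfV normrX (ger0_norm (ltW d0)) ler_wpM2l ?exprn_ge0//.
by rewrite lef_pV2 ?posrE// lerDl sqr_ge0.
Qed.

Lemma kernel_bound1 k y t : 0 < y -> `|cauchy_kernel k.+1 y t| <= `|t| ^+ k / y.
Proof.
move=> y0; have d0 := kernel_den_gt0 t y0.
rewrite normrM normfV normrX (ger0_norm (ltW d0)) exprSr -mulrA ler_wpM2l ?exprn_ge0//.
rewrite ler_pdivrMr// mulrC ler_pdivlMr//.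
have := sqr_ge0 (y - `|t|); have := sqr_ge0 `|t|; have := sqr_ge0 y.
by rewrite -[t ^+ 2]real_normK ?num_real// sqrrB; move: `|t| => r; rewrite !expr2; lra.
Qed.

Lemma kernel_bound2 k y t : 0 < y -> `|cauchy_kernel k.+2 y t| <= `|t| ^+ k.
Proof.
move=> y0; have d0 := kernel_den_gt0 t y0.
rewrite normrM normfV normrX (ger0_norm (ltW d0)) -[k.+2]addn2 exprD -mulrA -[leRHS]mulr1.
rewrite ler_wpM2l ?exprn_ge0// ler_pdivrMr// mul1r real_normK ?num_real//.
by rewrite lerDr sqr_ge0.
Qed.

(** The denominator gains two powers of t, which is why moments up to 2K reach as far as k = 2K +
    2. *)
Lemma kernel_integrable k y : (k <= (2 * K).+2)%N -> 1 <= y ->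
  rho.-integrable setT (EFin \o cauchy_kernel k y).
Proof.
move=> kK y1; have y0 : 0 < y by exact: lt_le_trans y1.
have mk := measurable_kernel k y0.
have [k0|k0] := leqP k (2 * K).
  apply: (dominated_integrable k0 mk) => t; apply: le_trans (kernel_bound k t y0) _.
  by rewrite ler_pdivrMr ?exprn_gt0// ler_peMr ?exprn_ge0// exprn_ege1.
case: k k0 kK mk => [//|[|k]] k0 kK mk.
  apply: (dominated_integrable (k := 0)) => // t.
  apply: le_trans (kernel_bound1 0 t y0) _.
  by rewrite ler_pdivrMr// ler_peMr ?exprn_ge0.
by apply: (dominated_integrable (k := k)) => // t; exact: kernel_bound2.
Qed.

(** Dominated convergence with |t|^k as dominating function, for integrands that tend to 0 pointwise
    like 1/n. *)
Lemma small_integrals (u : nat -> R -> R) k : (k <= 2 * K)%N ->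
  (forall n, measurable_fun setT (u n)) -> (forall n t, `|u n t| <= `|t| ^+ k) ->
  (forall t, exists B : R, forall n, `|u n t| <= B / n.+1%:R) ->
  forall e : R, 0 < e -> exists N, forall n, (N <= n)%N -> `|\int[rho]_t (u n t)| <= e.
Proof.
move=> kK mu uk uB e e0.
have ig : rho.-integrable setT (fun t => (`|t| ^+ k)%:E).
  apply: (dominated_integrable (u := fun t => `|t| ^+ k) kK).
    by apply: measurable_funX; exact: normr_measurable.
  by move=> t; rewrite ger0_norm// exprn_ge0.
have m0 : measurable_fun setT (cst 0%E : measurableTypeR R -> \bar R) by exact: measurable_cst.
have [] := @dominated_convergence _ _ R rho setT measurableT (fun n t => (u n t)%:E) (cst 0%E)
  (fun t => (`|t| ^+ k)%:E) (fun n => (measurable_EFinP _ _).2 (mu n)) m0 _ ig _.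
- apply: aeW => t _; have [B HB] := uB t.
  apply: cvg_EFin; first by apply: nearW.
  apply/cvgrPdist_le => r r0; near=> n; rewrite sub0r normrN; apply: le_trans (HB n) _.
  rewrite ler_pdivrMr// mulrC -ler_pdivrMr//.
  apply: ltW; apply: lt_le_trans (truncnS_gt _) _; rewrite ler_nat ltnS; near: n.
  exact: nbhs_infty_ge.
- by apply: aeW => t n _; rewrite lee_fin.
move=> _ _; rewrite integral_cst// mul0e => cv.
have /fine_cvgP[_ cv'] := cv.
have /cvgrPdist_le/(_ e e0)[N _ HN] := cv'.
by exists N => n Nn; have := HN n Nn; rewrite /= sub0r normrN.
Unshelve. all: by end_near.
Qed.

Definition kernel_integral k n := \int[rho]_t (cauchy_kernel k n.+1%:R t).

(* The integral of z t^k / (z - t) at z = iz n. *)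
Definition truncated_moment k n : C :=
  (n.+1%:R ^+ 2 * kernel_integral k n) +i* (- (n.+1%:R * kernel_integral k.+1 n)).

Lemma kernel_integral_moment k n : (k <= 2 * K)%N ->
  n.+1%:R ^+ 2 * kernel_integral k n + kernel_integral k.+2 n = \int[rho]_t (t ^+ k).
Proof.
move=> kK; have n1 : 1 <= n.+1%:R :> R by rewrite ler1n.
have n0 : 0 < n.+1%:R :> R by [].
have i1 := kernel_integrable (k := k) ltac:(lia) n1.
have i2 := kernel_integrable (k := k.+2) ltac:(lia) n1.
rewrite /kernel_integral -RintegralZl// -RintegralD//; last first.
  by have := integrableZl measurableT (n.+1%:R ^+ 2) i1.
apply: eq_Rintegral => t _; rewrite /cauchy_kernel -[in t ^+ k.+2]addn2 exprD.
by field; rewrite gt_eqF// kernel_den_gt0.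
Qed.

Lemma truncated_moment_error k n : (k <= 2 * K)%N ->
  truncated_moment k n - (\int[rho]_t (t ^+ k))%:C =
  (- kernel_integral k.+2 n) +i* (- (n.+1%:R * kernel_integral k.+1 n)).
Proof.
move=> kK; rewrite -(kernel_integral_moment n kK).
by apply/eqP; rewrite eq_complex /=; apply/andP; split; apply/eqP; ring.
Qed.

(** From z t^k / (z - t) - t^k = t^(k+1) / (z - t), multiplied by z and integrated. *)
Lemma truncated_moment_next k n : (k <= 2 * K)%N ->
  (truncated_moment k n - (\int[rho]_t (t ^+ k))%:C) * iz n = truncated_moment k.+1 n.
Proof.
move=> kK; rewrite truncated_moment_error// /iz /truncated_moment.
by apply/eqP; rewrite eq_complex /=; apply/andP; split; apply/eqP; ring.
Qed.

(** Real and imaginary part of the error have the integrands t^(k+2) / (y^2 + t^2) and y t^(k+1) /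
    (y^2 + t^2) up to sign. Both are dominated by |t|^k and tend to 0 like 1/y, so the k-th moment
    is all that has to exist. *)
Lemma truncated_moment_limit k : (k <= 2 * K)%N ->
  ctends (truncated_moment k) (\int[rho]_t (t ^+ k))%:C.
Proof.
move=> kK e e0; have e20 : 0 < e / 2 by rewrite divr_gt0.
have n0 n : 0 < n.+1%:R :> R by [].
have lin t : exists B : R, forall n, `|cauchy_kernel k.+2 n.+1%:R t| <= B / n.+1%:R.
  by exists (`|t| ^+ k.+1) => n; exact: kernel_bound1.
have [N1 H1] := small_integrals (u := fun n t => cauchy_kernel k.+2 n.+1%:R t) kK
  (fun n => measurable_kernel k.+2 (n0 n)) (fun n t => kernel_bound2 k t (n0 n)) lin e20.
have meas n : measurable_fun setT (fun t : R => n.+1%:R * cauchy_kernel k.+1 n.+1%:R t).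
  by apply: measurable_funM; [exact: measurable_cst|exact: measurable_kernel].
have [N2 H2] := small_integrals (u := fun n t => n.+1%:R * cauchy_kernel k.+1 n.+1%:R t) kK meas
  ltac:(move=> n t; rewrite normrM ger0_norm// mulrC -ler_pdivlMr//; exact: kernel_bound1)
  ltac:(move=> t; exists (`|t| ^+ k.+1) => n; rewrite normrM ger0_norm// mulrC -ler_pdivlMr// -mulrA -invfM -expr2; exact: kernel_bound) e20.
exists (maxn N1 N2) => n; rewrite geq_max => /andP[/H1 h1 /H2 h2].
rewrite truncated_moment_error//; apply: le_trans (normc_le_ReIm _) _.
rewrite /= !normrN; have -> : e = e / 2 + e / 2 by field.
apply: lerD => //; rewrite /kernel_integral -RintegralZl//.
by apply: kernel_integrable; rewrite ?ler1n//; lia.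
Qed.

Lemma truncated_moment_expand N k : (k + N <= 2 * K)%N ->
  expand N (truncated_moment k) (fun i => \int[rho]_t (t ^+ (k + i))).
Proof.
elim: N k => [|N IH] k kN; split; rewrite ?addn0 //.
- by apply: truncated_moment_limit; lia.
- by apply: truncated_moment_limit; lia.
- apply: (eq_expand (n0 := 0)) (IH k.+1 _) => [n _|i|]; last by lia.
    by rewrite truncated_moment_next//; lia.
  by rewrite addSnnS.
Qed.

(** Since rho is finite, the regularising term t / (1 + t^2) can be integrated separately and joins
    a in the constant - s_{-1}; what remains of r is the integral of z / (z - t). *)
Lemma Herglotz_remainder m a b n : Herglotz_representation m a b rho ->
  remainder m b (a - \int[rho]_t (t / (1 + t ^+ 2))) (iz n) = truncated_moment 0 n.
Proof.
move=> [_ _ rep]; rewrite /remainder (rep _ (iz_nonreal R n)).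
have n0 : 0 < n.+1%:R :> R by [].
have n1 : 1 <= n.+1%:R :> R by rewrite ler1n.
have i0 := kernel_integrable (k := 0) ltac:(lia) n1.
have i1 := kernel_integrable (k := 1) ltac:(lia) n1.
have j1 := kernel_integrable (k := 1) ltac:(lia) (lexx 1).
have jE : \int[rho]_t (t / (1 + t ^+ 2)) = \int[rho]_t (cauchy_kernel 1 1 t).
  by apply: eq_Rintegral => t _; rewrite /cauchy_kernel expr1 expr1n.
have E t : (t%:C - iz n)^-1 - (t / (1 + t ^+ 2))%:C =
    (cauchy_kernel 1 n.+1%:R t - cauchy_kernel 1 1 t) +i* (n.+1%:R * cauchy_kernel 0 n.+1%:R t) :> C.
  have -> : (t%:C - iz n)^-1 = (cauchy_kernel 1 n.+1%:R t) +i* (n.+1%:R * cauchy_kernel 0 n.+1%:R t).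
    have tn : t%:C - iz n != 0.
      apply/eqP => /(congr1 (@complex.Im R)) /= /eqP.
      by rewrite sub0r oppr_eq0 pnatr_eq0.
    apply: (mulIf tn); rewrite mulVf//; apply/esym/eqP; rewrite eq_complex /cauchy_kernel expr1 expr0 /=.
    by apply/andP; split; apply/eqP; field; rewrite gt_eqF// kernel_den_gt0.
  apply/eqP; rewrite eq_complex /cauchy_kernel expr1 expr1n /=.
  by apply/andP; split; apply/eqP; ring.
have -> : cintegral rho setT (fun t => (t%:C - iz n)^-1 - (t / (1 + t ^+ 2))%:C) =
    (kernel_integral 1 n - \int[rho]_t (cauchy_kernel 1 1 t)) +i* (n.+1%:R * kernel_integral 0 n).
  transitivity (cintegral rho setT (fun t => (cauchy_kernel 1 n.+1%:R t - cauchy_kernel 1 1 t) +i*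
    (n.+1%:R * cauchy_kernel 0 n.+1%:R t))).
    by apply: eq_cintegral => t _; exact: E.
  rewrite /cintegral /=.
  by rewrite RintegralB// RintegralZl.
rewrite jE /truncated_moment /iz.
by apply/eqP; rewrite eq_complex /=; apply/andP; split; apply/eqP; ring.
Qed.

End moment_expansion.

Opaque H1loc cenergy cdot sqnorm cintegral.

Lemma is_rational_quotient (R : realType) (m : R[i] -> R[i]) : quotient_of_polynomials m -> is_rational m.
Proof.
move=> [p [q [q0 pq]]]; exists p, q; split => // z nz qz.
by rewrite -pq// [_ * m z]mulrC mulfK.
Qed.

Theorem corollary2p5 (R : realType) (S : indefinite_string R) (m : R[i] -> R[i])
  (a b : R) (rho : {measure set (measurableTypeR R) -> \bar R}) (K : nat)
  (m_WT : is_Weyl_Titchmarsh S m)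
  (m_rep : Herglotz_representation m a b rho)
  (m_nonrational : ~ is_rational m)
  (rho_moments : moments_exist rho (2 * K)%N) :
  let D := Hankel (moment a b rho) in
  let N := nonzeros (D 1) K in
  let kappa := nonzero_index (D 1) K in
  let x := fun n : nat => D 2 (kappa n) / D 0 (kappa n).+1 in
  let w := fun n : nat =>
    if n == 0%N then - (D (-1) 1%N / D 1 0%N)
    else D (-1) (kappa n).+1 / D 1 (kappa n)
         - D (-1) (kappa n.+1).+1 / D 1 (kappa n.+1) in
  let v := fun n : nat =>
    if n == 0%N then - (D (-2) 1%N / D 0 0%N)
    else D (-2) (kappa n).+2 / D 0 (kappa n).+1
         - D (-2) (kappa n.+1).+1 / D 0 (kappa n.+1) in
  [/\ (* the quotients above are well defined *)
      [/\ D 1 0%N != 0, D 0 0%N != 0 &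
          forall n, (1 <= n <= N)%N ->
            [/\ D 1 (kappa n) != 0, D 0 (kappa n) != 0 & D 0 (kappa n).+1 != 0]],
      [/\ (forall n, (1 <= n <= N)%N -> 0 < x n /\ ((x n)%:E < len S)%E),
          (forall n, (1 <= n < N)%N -> x n < x n.+1) &
          (forall n, (n < N)%N -> 0 <= v n)],
      (forall h : R -> R[i], H1c (len S) h -> supp (len S) h `<=` `[0, x N[ ->
         omega S h = (w 0%N)%:C * h 0 + \sum_(1 <= n < N) (w n)%:C * h (x n)),
      (forall A : set (measurableTypeR R), measurable A -> A `<=` `[0, x N[ ->
         upsilon S A = ((v 0%N)%:E * \d_(0%R : measurableTypeR R) A
           + \sum_(1 <= n < N) (v n)%:E * \d_(x n : measurableTypeR R) A)%E) &
      (D 1 K = 0 ->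
         [/\ (kappa N).+1 = K,
             upsilon S [set x N] =
               (D (-1) (kappa N).+2 ^+ 2
                / (D 0 (kappa N).+1 * D 0 (kappa N).+2))%:E &
             0 < D (-1) (kappa N).+2 ^+ 2
                 / (D 0 (kappa N).+1 * D 0 (kappa N).+2)])].
Proof.
have [f S0] := initial_state m_WT.
pose s := moment a b rho.
have expansion : expand K.*2 (fun n => remainder m (- s (-2)) (- s (-1)) (iz R n)) (fun n : nat => s n%:Z).
  apply: (eq_expand (n0 := 0)) (truncated_moment_expand rho_moments (N := K.*2) (k := 0) _) => [n _|i|] //.
    by rewrite -(Herglotz_remainder rho_moments n m_rep) /s /= opprK opprB.
  by rewrite add0n mul2n.
have nonrat : ~ quotient_of_polynomials m by move=> /is_rational_quotient.
have [[reg _] [[p0 pi dp v0] [hO hU]] lm] := described_all (@upsilon_itv_fin R S) S0 expansion nonrat.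
move=> D N kappa x w v.
have N0 : (0 < N)%N by apply: nonzeros_ge1; rewrite [D 1 0%N]hankel_nil oner_neq0.
(* Index 0 of the chain is the origin, whereas the value x 0 of the quotient formula is junk: the
   points x n start with n = 1. *)
have pE n : (0 < n)%N -> points s 0 K n = x n by case: n => // n _; rewrite /= add0r.
have wE n : dipoles s K n = w n.
  by case: n => [|n] //; rewrite /w /= [D (-1) 1%N]hankel_one [D 1 0%N]hankel_nil divr1.
have vE n : masses s K n = v n.
  by case: n => [|n] //; rewrite /v /= [D (-2) 1%N]hankel_one [D 0 0%N]hankel_nil divr1.
have pN : points s 0 K N = x N by exact: pE.
have p_gt0 n : (0 < n <= N)%N -> 0 < points s 0 K n.
  elim: n => [//|[|n] IH] /andP[_ nN]; first by rewrite -{1}p0; exact: pi.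
  by apply: lt_trans (IH _) (pi n.+1 nN); exact: ltnW.
have p_leN n : (n <= N)%N -> points s 0 K n <= x N.
  move=> nN; suff H k : (n + k <= N)%N -> points s 0 K n <= points s 0 K (n + k).
    by have := H (N - n)%N; rewrite subnKC// pN; apply.
  elim: k => [|k IH] kN; first by rewrite addn0.
  by rewrite addnS in kN *; exact: le_trans (IH (ltnW kN)) (ltW (pi _ kN)).
have [_ xN_len] : halfopen (len S) (x N) by rewrite -pN.
have xN_gt0 : 0 < x N by rewrite -pN p_gt0 // N0 leqnn.
split.
- by split; rewrite ?[D _ 0%N]hankel_nil ?oner_neq0.
- split=> [n nN|n nN|n nN].
  + have [n0 nN'] := andP nN; rewrite -pE//; split; first exact: p_gt0.
    by apply: le_lt_trans xN_len; rewrite lee_fin p_leN.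
  + have [n0 nN'] := andP nN; rewrite -!pE//; exact: pi.
  + by rewrite -vE; exact: v0.
(* Compact support in the half-open interval leaves room for some c < x N from which h vanishes, as
   the chain requires. *)
- move=> h Hh sh; have [c cx th] := H1c_test xN_gt0 (conj (ltW xN_gt0) xN_len) Hh sh.
  rewrite (hO c h th) ?pN// big_ltn// p0 wE; congr (_ + _).
  by apply: eq_big_nat => n /andP[n0 _]; rewrite wE pE.
- move=> A mA sA; rewrite (hU A mA) ?pN// big_ltn// p0 vE; congr (_ + _)%E.
  by apply: eq_big_nat => n /andP[n0 _]; rewrite vE pE.
- by move=> DK; have [kN uN jN] := lm DK; split => //; rewrite -uN add0r.
Qed.
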